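(* Let $(\Omega,T,F)$ be a cone triple on a manifold $M$ of dimension $n\ge2$ with cone structure $\mathcal C$ and cone domain $A$, let $G:TM\to\mathbb R$, $G(tT_p+w_p)=t^2-F(w_p)^2$ ($t\in\mathbb R$, $w_p\in\ker\Omega_p$), be its associated continuous Lorentz-Finsler metric, and let $\Sigma=G^{-1}(1)\cap\Omega^{-1}((0,\infty))$ be its indicatrix. Let $\mathcal U$ be any neighborhood of the section $T$ regarded as a submanifold of $TM$, such that the closure of $\mathcal U\cap T_pM$ is compact and included in $A$ for all $p\in M$. Then there exists a smooth hypersurface $\tilde\Sigma\subset TM$ satisfying: (a) $\tilde\Sigma=\Sigma$ in $TM$ away from $\mathcal U$. (b) Each $\tilde\Sigma_p=\tilde\Sigma\cap T_pM$ is transverse to all the radial directions $\{\lambda v:\lambda>0\}$ in $A$, and $\tilde\Sigma_p$ is strongly convex with respect to the position vector everywhere.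
   Context: ''Smooth'' means $C^\infty$. A cone triple $(\Omega,T,F)$ on $M$ consists of a non-vanishing 1-form $\Omega$, a vector field $T$ with $\Omega(T)\equiv1$, and a Finsler metric $F$ on the bundle $\ker\Omega$, i.e., a continuous function $F:\ker\Omega\to[0,\infty)$, positive and smooth away from the zero section, with $F(\lambda v)=\lambda F(v)$ for $\lambda>0$ and such that $\frac12\frac{\partial^2}{\partial r\partial s}F^2(v+ru+sw)|_{r=s=0}$ is positive definite for all $v\ne0$. Its cone structure is $\mathcal C=\{F(w_p)T_p+w_p: w_p\in\ker\Omega_p\setminus\{0\},\ p\in M\}$, with cone domain $A=\{tT_p+w_p: w_p\in\ker\Omega_p,\ t>F(w_p),\ p\in M\}$. A hypersurface $\tilde\Sigma_p$ of the vector space $T_pM$ transverse to the position vector is strongly convex with respect to the position vector if its second fundamental form (as an affine hypersurface) with respect to the position vector is positive definite at every point. *)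

(* Defs.v *)
From HB Require Import structures.
From mathcomp Require Import all_boot all_order all_algebra.
From mathcomp Require Import all_classical all_reals all_analysis.

Set Implicit Arguments.
Unset Strict Implicit.
Unset Printing Implicit Defensive.

Import Order.TTheory GRing.Theory Num.Theory.
Import numFieldNormedType.Exports.

Local Open Scope classical_set_scope.
Local Open Scope ring_scope.

(** * Smooth maps between finite-dimensional normed spaces *)

(* f is k times continuously differentiable on the open set U.  In finite
   dimension, continuity of the differential is continuity of x |-> df_x(v) for
   every vector v. *)
Fixpoint Ck_on (R : realType) (V W : normedModType R) (U : set V) (k : nat)
    (f : V -> W) : Prop :=
  match k with
  | 0 => forall x, U x -> {for x, continuous f}
  | k'.+1 => (forall x, U x -> differentiable f x) /\
             (forall v : V, Ck_on U k' (fun x => 'd f x v))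
  end.

Definition smooth_on (R : realType) (V W : normedModType R) (U : set V)
    (f : V -> W) : Prop :=
  forall k, Ck_on U k f.

(** * Hypersurfaces of a normed space and their affine geometry *)

Section Hypersurfaces.
Context {R : realType} {V : normedModType R}.
Implicit Types (S : set V) (v u w : V).

(* Embedded hypersurface: locally a regular level set. *)
Definition smooth_hypersurface S : Prop :=
  forall v, S v -> exists (O : set V) (g : V -> R^o),
    [/\ open_nbhs v O, smooth_on O g,
        (forall x, O x -> (S x <-> g x = 0)) &
        exists u, 'd g v u != 0].

(* T_v S, as the set of velocities of smooth curves in S through v. *)
Definition tangent_to S v : set V :=
  [set u | exists (e : R) (gam : R^o -> V),
    [/\ 0 < e, smooth_on [set t : R^o | `|t| < e] gam,
        (forall t : R^o, `|t| < e -> S (gam t)),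
        gam 0 = v & 'd gam (0 : R^o) (1 : R^o) = u]].

(* S is transverse at v to the radial direction of v: T_v S + R v = V. *)
Definition transverse_radially S v : Prop :=
  forall w, exists u (a : R), tangent_to S v u /\ w = u + a *: v.

(* Second fundamental form of S at v with respect to the transverse field xi,
   given by the Gauss formula D_u Y = (tangent part) + h(u, w) xi, where D is
   the flat connection of V and Y is any local smooth field, tangent to S along
   S, with Y(v) = w.  The default value 0 is never used when xi is transverse
   to the hypersurface S. *)
Definition second_fundamental_form S (xi : V -> V) v u w : R :=
  xget 0 [set a : R | exists (O : set V) (Y : V -> V),
    [/\ open_nbhs v O, smooth_on O Y,
        (forall q, O q -> S q -> tangent_to S q (Y q)),
        Y v = w & tangent_to S v ('d Y v u - a *: xi v)]].

(* Strong convexity with respect to the position vector, the field [id]. *)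
Definition strongly_convex S : Prop :=
  smooth_hypersurface S /\
  forall v, S v -> forall u, tangent_to S v u -> u != 0 ->
    0 < second_fundamental_form S id v u u.

End Hypersurfaces.

(** * Smooth manifolds *)

(* Second countable Hausdorff spaces with a smooth atlas; the maps [cmap c] and
   [cinv c] are only meaningful on [cdom c] and on its image. *)
Record smoothManifold (R : realType) (n : nat) := SmoothManifold {
  mspace :> topologicalType;
  mspace_hausdorff : hausdorff_space mspace;
  mspace_second_countable : @second_countable mspace;
  atlas : Type;
  cdom : atlas -> set mspace;
  cmap : atlas -> mspace -> 'rV[R]_n;
  cinv : atlas -> 'rV[R]_n -> mspace;
  cdom_open : forall c, open (cdom c);
  cimg_open : forall c, open (cmap c @` cdom c);
  cmapK : forall c p, cdom c p -> cinv c (cmap c p) = p;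
  cmap_continuous : forall c, {within cdom c, continuous (cmap c)};
  cinv_continuous : forall c, {within cmap c @` cdom c, continuous (cinv c)};
  cdom_cover : forall p, exists c, cdom c p;
  ctransition_smooth : forall c d,
    smooth_on (cmap c @` (cdom c `&` cdom d)) (cmap d \o cinv c)
}.

Arguments atlas {R n} M : rename.
Arguments cdom {R n M} c : rename.
Arguments cmap {R n M} c p : rename.
Arguments cinv {R n M} c x : rename.

Definition cimg (R : realType) (n : nat) (M : smoothManifold R n)
  (c : atlas M) : set 'rV[R]_n := cmap c @` cdom c.

(** * Tangent spaces *)

(* A tangent vector at p is a family of coordinate vectors, one for each chart
   around p, related by the differentials of the transition maps; the
   components in the charts that do not contain p are set to 0. *)
Section TangentSpace.
Context {R : realType} {n : nat} {M : smoothManifold R n} (p : M).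

Definition is_tangent (v : atlas M -> 'rV[R]_n) : Prop :=
  (forall c, ~ cdom c p -> v c = 0) /\
  (forall c d, cdom c p -> cdom d p ->
     v d = 'd (cmap d \o cinv c) (cmap c p) (v c)).

Definition tangent_pred : {pred (atlas M -> 'rV[R]_n)} :=
  fun v => `[< is_tangent v >].

Fact tangent_pred_submod : submod_closed tangent_pred.
Proof.
split=> [|a u v /asboolP[u0 ud] /asboolP[v0 vd]]; apply/asboolP; split.
- by [].
- by move=> c d _ _; rewrite /= linear0.
- by move=> c cp; rewrite /= !fctE u0 // v0 // scaler0 addr0.
- move=> c d cp dp; rewrite !fctE (ud c d) // (vd c d) //.
  by rewrite -linearP.
Qed.

HB.instance Definition _ :=
  GRing.isSubmodClosed.Build R (atlas M -> 'rV[R]_n) tangent_pred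
    tangent_pred_submod.

Record tangent := Tangent {
  tangent_val : atlas M -> 'rV[R]_n;
  tangent_valP : tangent_val \in tangent_pred
}.

HB.instance Definition _ := [isSub for tangent_val].
HB.instance Definition _ := [Choice of tangent by <:].
HB.instance Definition _ := [SubChoice_isSubLmodule of tangent by <:].

Definition tcoord (c : atlas M) (v : tangent) : 'rV[R]_n := tangent_val v c.

(* The tangent vector with given coordinates in the chart c around p. *)
Definition tvec (c : atlas M) (y : 'rV[R]_n) : tangent :=
  xget 0 [set v | tcoord c v = y].

End TangentSpace.

Arguments tangent {R n M} p.
Arguments tvec {R n M} p c y.

Lemma eq_near_diff (R : realType) (V W : normedModType R) (f g : V -> W) (x : V) :
  differentiable f x -> {near x, f =1 g} -> 'd g x = 'd f x :> (V -> W).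
Proof.
move=> /diff_locallyP[dc df] fg; apply: diff_unique => //.
have fgx : f x = g x := nbhs_singleton fg.
apply/eqaddoP => e e0; move/eqaddoP: df => /(_ e e0).
have : \forall y \near (0 : V), f (y + x) = g (y + x).
  by have := fg; rewrite (near_shift 0) /= subr0.
rewrite -fgx; apply: filterS2 => y /= fgy.
by rewrite !fctE /= fgy.
Qed.

Section TangentCoordinates.
Context {R : realType} {n : nat} {M : smoothManifold R n}.
Implicit Types (c d : atlas M) (p : M).

Lemma ctransition_open c d : open (cmap c @` (cdom c `&` cdom d)).
Proof.
have -> : cmap c @` (cdom c `&` cdom d) =
    (cmap c @` cdom c) `&` cinv c @^-1` cdom d.
  apply/seteqP; split=> [_ [p [cp dp] <-]|_ [[p cp <-]]] /=.
    by split; [exists p|rewrite cmapK].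
  by rewrite cmapK// => dp; exists p.
have cc : {in cmap c @` cdom c, continuous (cinv c)}.
  by rewrite -continuous_open_subspace; [exact: cinv_continuous|exact: cimg_open].
by move/(continuous_inP _ (@cimg_open _ _ _ c)) : cc; apply; exact: cdom_open.
Qed.

Lemma ctransition_differentiable c d p : cdom c p -> cdom d p ->
  differentiable (cmap d \o cinv c) (cmap c p).
Proof.
by move=> cp dp; case: (@ctransition_smooth _ _ M c d 1) => + _; apply; exists p.
Qed.

Lemma ctransition_id c p (y : 'rV[R]_n) : cdom c p ->
  'd (cmap c \o cinv c) (cmap c p) y = y.
Proof.
move=> cp; rewrite (@eq_near_diff _ _ _ id) ?diff_val//.
near=> x; have [q cq <-] : (cmap c @` cdom c) x.
  by near: x; apply: open_nbhs_nbhs; split; [exact: cimg_open|exists p].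
by rewrite /= cmapK.
Unshelve. all: by end_near. Qed.

Lemma ctransition_comp c d e p (y : 'rV[R]_n) :
  cdom c p -> cdom d p -> cdom e p ->
  'd (cmap e \o cinv c) (cmap c p) y =
  'd (cmap e \o cinv d) (cmap d p) ('d (cmap d \o cinv c) (cmap c p) y).
Proof.
move=> cp dp ep; have pE : cmap d p = (cmap d \o cinv c) (cmap c p).
  by rewrite /= cmapK.
have cd := ctransition_differentiable cp dp.
have := ctransition_differentiable dp ep; rewrite pE => de.
have df := differentiable_comp cd de.
have cde : {near cmap c p, (cmap e \o cinv d) \o (cmap d \o cinv c) =1
                           cmap e \o cinv c}.
  near=> x; have [q [cq dq] <-] : (cmap c @` (cdom c `&` cdom d)) x.
    by near: x; apply: open_nbhs_nbhs; split; [exact: ctransition_open|exists p].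
  by rewrite /= cmapK// cmapK.
exact: (congr1 (@^~ y) (etrans (eq_near_diff df cde) (diff_comp cd de))).
Unshelve. all: by end_near. Qed.

(* The coordinates in a chart around p identify T_pM with R^n. *)
Lemma tcoord_tvec p c (y : 'rV[R]_n) :
  cdom c p -> tcoord c (tvec p c y) = y.
Proof.
move=> cp; pose v d := if `[< cdom d p >]
  then 'd (cmap d \o cinv c) (cmap c p) y else 0.
have vP : v \in tangent_pred p.
  apply/asboolP; split=> [d dp|d e dp ep]; rewrite /v; first by rewrite asboolF.
  by rewrite !asboolT//; exact: ctransition_comp.
apply: (@xgetPex _ 0 [set v : tangent p | tcoord c v = y]).
by exists (Tangent vP); rewrite /= /tcoord /= /v asboolT// ctransition_id.
Qed.

Lemma tcoord_inj p c : cdom c p -> injective (@tcoord R n M p c).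
Proof.
move=> cp v w; rewrite /tcoord => vw; apply: val_inj; apply/funext => d.
have /asboolP[v0 vE] := tangent_valP v; have /asboolP[w0 wE] := tangent_valP w.
case: (pselect (cdom d p)) => dp /=; last by rewrite v0 ?w0.
by rewrite (vE c d)// (wE c d)// vw.
Qed.

Lemma tvec_tcoord p c (v : tangent p) :
  cdom c p -> tvec p c (tcoord c v) = v.
Proof. by move=> cp; apply: (tcoord_inj cp); rewrite tcoord_tvec. Qed.

End TangentCoordinates.

(** * The tangent bundle *)

Record tangentBundle (R : realType) (n : nat) (M : smoothManifold R n) :=
  TVec { tbase : M; tvect : tangent tbase }.

Arguments TVec {R n M} tbase tvect.

HB.instance Definition _ (R : realType) (n : nat) (M : smoothManifold R n) :=
  gen_eqMixin (tangentBundle M).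
HB.instance Definition _ (R : realType) (n : nat) (M : smoothManifold R n) :=
  gen_choiceMixin (tangentBundle M).

Section TangentBundle.
Context {R : realType} {n : nat} {M : smoothManifold R n}.
Implicit Types (c : atlas M) (S : set (tangentBundle M)).

(* Bundle charts: (x, y) |-> the vector with coordinates y at the point with
   coordinates x. *)
Definition bundle_cinv c (xy : 'rV[R]_n * 'rV[R]_n) : tangentBundle M :=
  TVec (cinv c xy.1) (tvec (cinv c xy.1) c xy.2).

Definition in_chart c S : set ('rV[R]_n * 'rV[R]_n) :=
  [set xy | cimg c xy.1 /\ S (bundle_cinv c xy)].

Definition bundle_open S : Prop := forall c, open (in_chart c S).

Fact bundle_openT : bundle_open setT.
Proof.
move=> c.
have -> : in_chart c setT = fst @^-1` (cimg c) by apply/seteqP; split=> x // [].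
by apply: open_comp; [move=> x _; exact: cvg_fst | exact: cimg_open].
Qed.

Fact bundle_openI : setI_closed bundle_open.
Proof.
move=> A B Ao Bo c.
have -> : in_chart c (A `&` B) = in_chart c A `&` in_chart c B.
  by apply/seteqP; split=> x [] => [? []|[? ?] []].
exact: openI.
Qed.

Fact bundle_open_bigU (I : Type) (f : I -> set (tangentBundle M)) :
  (forall i, bundle_open (f i)) -> bundle_open (\bigcup_i f i).
Proof.
move=> fo c.
have -> : in_chart c (\bigcup_i f i) = \bigcup_i in_chart c (f i).
  by apply/seteqP; split=> x => [[? [i]]|[i _ []]]; [exists i|split=> //; exists i].
by apply: bigcup_open => i _; exact: fo.
Qed.

HB.instance Definition _ := isOpenTopological.Build (tangentBundle M)
  bundle_openT bundle_openI bundle_open_bigU.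

Definition bundle_smooth_on S (g : tangentBundle M -> R) : Prop :=
  forall c, smooth_on (in_chart c S) (fun xy => g (bundle_cinv c xy) : R^o).

(* Smoothness along an arbitrary subset, e.g. an embedded submanifold: local
   extendability to a smooth function on an open subset of TM. *)
Definition smooth_along S (f : tangentBundle M -> R) : Prop :=
  forall q, S q -> exists (O : set (tangentBundle M)) (g : tangentBundle M -> R),
    [/\ open_nbhs q O, bundle_smooth_on O g &
        forall v, O v -> S v -> f v = g v].

Definition bundle_hypersurface S : Prop :=
  forall c, smooth_hypersurface (in_chart c S).

Definition fiber S (p : M) : set (tangent p) := [set v | S (TVec p v)].
Arguments fiber S p : clear implicits.

(* S_p is transverse to all the radial directions in A_p, i.e. each ray
   {l v | l > 0} with v in A_p crosses S_p exactly once, and transversally.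
   The linear notions are read in the linear coordinates of T_pM given by a
   chart. *)
Definition transverse_to_rays (A : set (tangentBundle M)) S (p : M) : Prop :=
  forall v : tangent p, A (TVec p v) ->
    (exists! l : R, 0 < l /\ S (TVec p (l *: v))) /\
    (forall l : R, 0 < l -> S (TVec p (l *: v)) ->
       forall c, cdom c p ->
         transverse_radially (tcoord c @` fiber S p) (tcoord c (l *: v))).

Definition fiber_strongly_convex S (p : M) : Prop :=
  forall c, cdom c p -> strongly_convex (tcoord c @` fiber S p).

End TangentBundle.

(** * Cone triples *)

Section ConeTriples.
Context {R : realType} {n : nat} {M : smoothManifold R n}.
Implicit Types (Omega : forall p : M, {scalar tangent p})
  (T : forall p : M, tangent p) (F : tangentBundle M -> R).

Definition smooth_form Omega : Prop :=
  forall (c : atlas M) (y : 'rV[R]_n),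
    smooth_on (cimg c)
      (fun x => Omega (cinv c x) (tvec (cinv c x) c y) : R^o).

Definition smooth_field T : Prop :=
  forall c : atlas M, smooth_on (cimg c) (fun x => tcoord c (T (cinv c x))).

Definition kernel_bundle Omega : set (tangentBundle M) :=
  [set v | Omega (tbase v) (tvect v) = 0].

Definition fundamental_tensor F (p : M) (v u w : tangent p) : R :=
  2^-1 * derive1 (fun r : R =>
           derive1 (fun s : R => F (TVec p (v + r *: u + s *: w)) ^+ 2) 0) 0.

(* A Finsler metric on the vector subbundle D of TM.  The values of F outside
   D are irrelevant. *)
Record finsler_metric (D : set (tangentBundle M)) F : Prop := {
  finsler_continuous : {within D, continuous F};
  finsler_ge0 : forall v, D v -> 0 <= F v;
  finsler_gt0 : forall v, D v -> tvect v != 0 -> 0 < F v;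
  finsler_smooth : smooth_along [set v | D v /\ tvect v != 0] F;
  finsler_homogeneous : forall (p : M) (v : tangent p) (l : R),
    D (TVec p v) -> 0 < l -> F (TVec p (l *: v)) = l * F (TVec p v);
  finsler_pos_def : forall (p : M) (v u : tangent p),
    D (TVec p v) -> v != 0 -> D (TVec p u) -> u != 0 ->
    0 < fundamental_tensor F v u u
}.

Record cone_triple Omega T F : Prop := {
  cone_form_smooth : smooth_form Omega;
  cone_form_nonvanishing : forall p : M, exists v, Omega p v != 0;
  cone_field_smooth : smooth_field T;
  cone_form_field : forall p : M, Omega p (T p) = 1;
  cone_finsler : finsler_metric (kernel_bundle Omega) F
}.

Definition cone_domain Omega T F : set (tangentBundle M) :=
  [set v | exists (p : M) (t : R) (w : tangent p),
    [/\ Omega p w = 0, F (TVec p w) < t & v = TVec p (t *: T p + w)]].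

Definition indicatrix Omega (G : tangentBundle M -> R) :
    set (tangentBundle M) :=
  [set v | G v = 1 /\ 0 < Omega (tbase v) (tvect v)].

End ConeTriples.

(* Main.v *)
From HB Require Import structures.
Require Import Defs.
From mathcomp Require Import all_boot all_order all_algebra.
From mathcomp Require Import all_classical all_reals all_analysis.
From mathcomp Require Import ring lra zify.

(* With W = ker Omega, the indicatrix is the graph t = sqrt (1 + F(w)^2) over W;
   it is convex and smooth except above w = 0, i.e. except at T.  Locally on M,
   replace it by the regularised maximum of itself and of a quadric
   t = sqrt (c^2 + k |w|^2), with c > 1 close to 1 and k small: the quadric lies
   above the indicatrix near w = 0 and below it outside a small tube around T.
   A regularised maximum of convex functions is convex, so only C^0 estimates
   are needed.  Strong convexity and transversality of the graph of a function
   phi on W mean that D^2 phi > 0 and dphi_w(w) < phi(w); these conditions are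
   stable under convex combinations, so that the local constructions are glued
   with bump functions on M. *)

Import Order.TTheory GRing.Theory Num.Theory.
Import numFieldNormedType.Exports.

Set Implicit Arguments.
Unset Strict Implicit.
Unset Printing Implicit Defensive.

Local Open Scope classical_set_scope.
Local Open Scope ring_scope.

(** * Calculus of C^k and smooth maps *)

(** Functions on ker Omega are extended to T_pM as constant along T: the hypersurface becomes the
    zero set of [Omega - phi], and no frame of ker Omega is chosen. At a point y of this graph the
    second fundamental form along u is [D^2 phi (u, u) / (phi y - dphi_y y)], which is where the two
    conditions on phi come from. The radial condition also makes [phi (l y) / l] strictly decreasing
    in l, so that a ray meets the graph at most once. The obstacle near T is that [F ^ 2] need not
    be smooth on the zero section, and that its size varies with the base point. A compactness
    argument in a chart gives [F ^ 2 >= a |w|^2] locally uniformly. With [40 e = a rho], the quadric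
    has height [1 + 3 e] at w = 0, more than the smoothing width [2 e] above the indicatrix, and
    coefficient [k = a / 4], small enough for the indicatrix to exceed it by [2 e] once
    [|w|^2 >= rho]. So that the change stays inside U under convex combinations, the whole segment
    in the direction T between the indicatrix and the new graph is required to lie in U. *)

Lemma eq_on_diff (R : realType) (V W : normedModType R) (U : set V)
    (f g : V -> W) x : open U -> U x -> (forall y, U y -> f y = g y) ->
  differentiable f x -> differentiable g x /\ 'd g x = 'd f x :> (V -> W).
Proof.
move=> Uo Ux fg df; have nU : \forall y \near x, f y = g y.
  by near=> y; apply: fg; near: y; exact: open_nbhs_nbhs.
split; last exact: eq_near_diff.
apply/diff_locallyP; rewrite (eq_near_diff df nU).
move: (df) => /diff_locallyP[dc fE]; split=> //.
have fgx : f x = g x by exact: fg.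
apply/eqaddoP => e e0; move/eqaddoP: fE => /(_ e e0).
have : \forall y \near (0 : V), f (y + x) = g (y + x).
  by have := nU; rewrite (near_shift 0) /= subr0.
by rewrite -fgx; apply: filterS2 => y /= fgy; rewrite !fctE /= fgy.
Unshelve. all: by end_near. Qed.

Section SmoothCalculus.
Context {R : realType}.
Implicit Types (V W X : normedModType R) (k : nat).

Lemma Ck_on_continuous V W (U : set V) k (f : V -> W) :
  Ck_on U k f -> Ck_on U 0 f.
Proof.
case: k => // k [df _] x Ux; apply: differentiable_continuous; exact: df.
Qed.

Lemma Ck_onW V W (U : set V) k (f : V -> W) : Ck_on U k.+1 f -> Ck_on U k f.
Proof.
elim: k f => [|k IH] f; first exact: Ck_on_continuous.
by move=> [df ddf]; split=> // v; apply: IH; exact: ddf.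
Qed.

Lemma Ck_on_sub V W (U U' : set V) k (f : V -> W) :
  U' `<=` U -> Ck_on U k f -> Ck_on U' k f.
Proof.
move=> UU'; elim: k f => [|k IH] f /=; first by move=> fc x /UU' /fc.
by move=> [df ddf]; split=> [x /UU' /df//|v]; apply: IH.
Qed.

Lemma Ck_on_eq V W (U : set V) k (f g : V -> W) : open U ->
  (forall x, U x -> f x = g x) -> Ck_on U k f -> Ck_on U k g.
Proof.
move=> Uo; elim: k f g => [|k IH] f g fg /=.
  move=> fc x Ux; suff : g y @[y --> x] --> g x by []; rewrite -(fg x Ux).
  have : \forall y \near x, f y = g y.
    by near=> y; apply: fg; near: y; exact: open_nbhs_nbhs.
  by move=> /near_eq_cvg/cvg_trans; apply; exact: (fc x Ux).
move=> [df ddf]; split=> [x Ux|v].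
  by have [] := eq_on_diff Uo Ux fg (df x Ux).
apply: IH (ddf v) => x Ux.
by have [_ ->] := eq_on_diff Uo Ux fg (df x Ux).
Unshelve. all: by end_near. Qed.

Lemma Ck_on_cst V W (U : set V) k (a : W) : Ck_on U k (cst a : V -> W).
Proof.
elim: k a => [|k IH] a /=; first by move=> x _; exact: cst_continuous.
split=> [x _|v]; first exact: differentiable_cst.
have -> : (fun x => 'd (cst a : V -> W) x v) = cst 0.
  by apply/funext => x; rewrite diff_cst.
exact: IH.
Qed.

Lemma Ck_on_linear V W (U : set V) k (L : {linear V -> W}) :
  continuous L -> Ck_on U k L.
Proof.
move=> Lc; case: k => [|k] /=; first by move=> x _; exact: Lc.
split=> [x _|v]; first exact: linear_differentiable.
have -> : (fun x => 'd L x v) = cst (L v).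
  by apply/funext => x; rewrite diff_lin.
exact: Ck_on_cst.
Qed.

Lemma Ck_on_lin_comp V W X (U : set V) k (f : V -> W) (L : {linear W -> X}) :
  open U -> continuous L -> Ck_on U k f -> Ck_on U k (L \o f).
Proof.
move=> Uo Lc; elim: k f => [|k IH] f /=.
  by move=> fc x Ux; apply: continuous_comp; [exact: fc|exact: Lc].
move=> [df ddf]; split=> [x Ux|v].
  by apply: differentiable_comp; [exact: df|exact: linear_differentiable].
apply: Ck_on_eq (IH _ (ddf v)) => // x Ux.
rewrite diff_comp//; [|exact: df|exact: linear_differentiable].
by rewrite /= diff_lin.
Qed.

Lemma Ck_on_add V W (U : set V) k (f g : V -> W) :
  open U -> Ck_on U k f -> Ck_on U k g -> Ck_on U k (f \+ g).
Proof.
move=> Uo; elim: k f g => [|k IH] f g /=.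
  by move=> fc gc x Ux; apply: continuousD; [exact: fc|exact: gc].
move=> [df ddf] [dg ddg]; split=> [x Ux|v].
  by apply: differentiableD; [exact: df|exact: dg].
apply: Ck_on_eq (IH _ _ (ddf v) (ddg v)) => // x Ux.
by rewrite diffD//; [exact: df|exact: dg].
Qed.

Lemma Ck_on_sum V W (I : Type) (r : seq I) (P : pred I) (U : set V) k
    (f : I -> V -> W) : open U -> (forall i, P i -> Ck_on U k (f i)) ->
  Ck_on U k (fun x => \sum_(i <- r | P i) f i x).
Proof.
move=> Uo fC; elim: r => [|i r IH].
  apply: Ck_on_eq (Ck_on_cst U k 0) => // x _; by rewrite big_nil.
case Pi : (P i).
  by apply: Ck_on_eq (Ck_on_add Uo (fC i Pi) IH) => // x _; rewrite big_cons Pi.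
by apply: Ck_on_eq IH => // x _; rewrite big_cons Pi.
Qed.

Lemma Ck_on_mul V (U : set V) k (f g : V -> R^o) :
  open U -> Ck_on U k f -> Ck_on U k g -> Ck_on U k (fun x => f x * g x : R^o).
Proof.
move=> Uo; elim: k f g => [|k IH] f g /=.
  by move=> fc gc x Ux; apply: continuousM; [exact: fc|exact: gc].
move=> [df ddf] [dg ddg]; split=> [x Ux|v].
  by apply: differentiableM; [exact: df|exact: dg].
have fC : Ck_on U k f by exact: (Ck_onW (conj df ddf)).
have gC : Ck_on U k g by exact: (Ck_onW (conj dg ddg)).
apply: Ck_on_eq (Ck_on_add Uo (IH _ _ fC (ddg v)) (IH _ _ gC (ddf v))) => // x Ux.
have fx : differentiable f x by exact: df.
have gx : differentiable g x by exact: dg.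
by rewrite (diffM fx gx).
Qed.

(** Finite dimension in the form that the chain rule uses: [Ck_on] differentiates along fixed
    vectors only, so a varying vector has to be expanded on fixed ones with continuous linear
    coefficients. *)
Definition has_coordinates W := exists (I : finType) (e : I -> W)
  (c : I -> {linear W -> R^o}),
  (forall i, continuous (c i)) /\ forall w, w = \sum_i c i w *: e i.

Lemma has_coordinatesR : has_coordinates R^o.
Proof.
exists unit, (fun _ => 1), (fun _ => idfun); split.
  by move=> _ x; exact: cvg_id.
by move=> w; rewrite (big_pred1 tt) => [|[]//]; rewrite /= /GRing.scale /= mulr1.
Qed.

Lemma has_coordinates_rV n : has_coordinates 'rV[R]_n.
Proof.
pose c i (w : 'rV[R]_n) : R^o := w 0 i.
have cl i : linear (c i) by move=> a u v; rewrite /c !mxE.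
pose L i : {linear 'rV[R]_n -> R^o}
  := HB.pack (c i) (GRing.isLinear.Build _ _ _ _ (c i) (cl i)).
exists 'I_n, (fun i => delta_mx 0 i), L; split.
  by move=> i x; exact: coord_continuous.
by move=> w; rewrite {1}(row_sum_delta w).
Qed.

Lemma has_coordinates_prod V W :
  has_coordinates V -> has_coordinates W -> has_coordinates (V * W)%type.
Proof.
move=> [I [e [c [cc ce]]]] [J [e' [c' [cc' ce']]]].
pose g (z : I + J) : V * W := match z with inl i => (e i, 0) | inr j => (0, e' j) end.
pose d (z : I + J) (w : V * W) : R^o :=
  match z with inl i => c i w.1 | inr j => c' j w.2 end.
have dl z : linear (d z) by case: z => i a u v; rewrite /d /= linearP.
pose L z : {linear (V * W)%type -> R^o} :=
  HB.pack (d z) (GRing.isLinear.Build _ _ _ _ (d z) (dl z)).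
exists (I + J)%type, g, L; split.
  case=> i x.
    by apply: (@continuous_comp _ _ _ fst (c i)); [exact: cvg_fst|exact: cc].
  by apply: (@continuous_comp _ _ _ snd (c' i)); [exact: cvg_snd|exact: cc'].
move=> [v w]; rewrite big_sumType /=; apply: injective_projections => /=.
  rewrite (raddf_sum fst) (raddf_sum fst) /= [X in _ + X]big1 ?addr0 => [|i _].
    exact: ce.
  by rewrite scaler0.
rewrite (raddf_sum snd) (raddf_sum snd) /= [X in X + _]big1 ?add0r => [|i _].
  exact: ce'.
by rewrite scaler0.
Qed.

Lemma Ck_on_coord V W (U : set V) k (f : V -> W) (I : finType) (e : I -> W)
    (c : I -> {linear W -> R^o}) : open U ->
  (forall w, w = \sum_i c i w *: e i) ->
  (forall i, Ck_on U k (c i \o f)) -> Ck_on U k f.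
Proof.
move=> Uo ce fC.
have scC (i : I) : continuous ( *:%R^~ (e i) : R^o -> W).
  by move=> x; exact: scalel_continuous.
have sl (i : I) : linear ( *:%R^~ (e i) : R^o -> W).
  by move=> a u v; rewrite scalerDl scalerA.
pose s (i : I) : {linear R^o -> W} :=
  HB.pack ( *:%R^~ (e i) : R^o -> W)
    (GRing.isLinear.Build _ _ _ _ ( *:%R^~ (e i) : R^o -> W) (sl i)).
apply: (@Ck_on_eq _ _ _ _ (fun x => \sum_i (s i \o (c i \o f)) x)) => //.
apply: Ck_on_sum => // i _; apply: Ck_on_lin_comp => //; exact: scC.
Qed.

Lemma Ck_on_scale V W (U : set V) k (f : V -> R^o) (g : V -> W) :
  has_coordinates W -> open U -> Ck_on U k f -> Ck_on U k g ->
  Ck_on U k (fun x => f x *: g x).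
Proof.
move=> [I [e [c [cc ce]]]] Uo fC gC; apply: (Ck_on_coord Uo ce) => i.
apply: (@Ck_on_eq _ _ _ _ (fun x => f x * (c i \o g) x : R^o)) => //.
  by move=> x _ /=; rewrite linearZ.
by apply: Ck_on_mul => //; apply: Ck_on_lin_comp.
Qed.

(** The differential of [g \o f] applies ['d g (f x)] to the moving vector ['d f x v]. Expanding
    this vector on the [e i] leaves products of a scalar function by [(fun y => 'd g y (e i)) \o f],
    to which the induction hypothesis applies. *)
Lemma Ck_on_comp V W X (U : set V) (U' : set W) k (f : V -> W) (g : W -> X) :
  has_coordinates W -> has_coordinates X -> open U -> open U' ->
  (forall x, U x -> U' (f x)) ->
  Ck_on U k f -> Ck_on U' k g -> Ck_on U k (g \o f).
Proof.
move=> hW hX Uo Uo' UU'; elim: k f UU' g => [|k IH] f UU' g /=.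
  by move=> fc gc x Ux; apply: continuous_comp; [exact: fc|exact/gc/UU'].
move=> [df ddf] [dg ddg]; split=> [x Ux|v].
  by apply: differentiable_comp; [exact: df|exact/dg/UU'].
have [I [e [c [cc ce]]]] := hW.
have fC : Ck_on U k f by exact: Ck_onW.
apply: (@Ck_on_eq _ _ _ _
  (fun x => \sum_i (c i \o (fun x => 'd f x v)) x *: ((fun y => 'd g y (e i)) \o f) x))
    => //.
  move=> x Ux; rewrite diff_comp; [|exact: df|exact/dg/UU'].
  rewrite /= [in RHS](ce ('d f x v)) linear_sum; apply: eq_bigr => i _.
  by rewrite linearZ.
apply: Ck_on_sum => // i _; apply: Ck_on_scale => //.
  by apply: Ck_on_lin_comp.
exact: IH.
Qed.

End SmoothCalculus.

#[local] Hint Extern 0 (has_coordinates _) => (solve [repeat first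
  [exact: has_coordinatesR | exact: has_coordinates_rV
  | apply: has_coordinates_prod]]) : core.

(** * Smoothness at a point *)

Definition smooth_at (R : realType) (V W : normedModType R) (f : V -> W) (x : V) :=
  exists2 B : set V, open_nbhs x B & smooth_on B f.

Section SmoothAt.
Context {R : realType}.
Implicit Types (V W X : normedModType R).

Lemma smooth_on_at V W (U : set V) (f : V -> W) x :
  open U -> U x -> smooth_on U f -> smooth_at f x.
Proof. by exists U. Qed.

Lemma smooth_at_on V W (U : set V) (f : V -> W) :
  (forall x, U x -> smooth_at f x) -> smooth_on U f.
Proof.
(* Forgetting that [B] is open and serves all orders leaves a claim that is inductive in [k]. *)
move=> fU k; have {fU} : forall x, U x -> exists2 B : set V, B x & Ck_on B k f.
  by move=> x /fU [B [_ Ox] fO]; exists B => //; exact: fO.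
elim: k f => [|k IH] f fU /=.
  by move=> x Ux; have [B Ox] := fU x Ux; apply.
split=> [x Ux|v]; first by have [B Ox [+ _]] := fU x Ux; apply.
by apply: IH => x Ux; have [B Ox [_ fO]] := fU x Ux; exists B => //; exact: fO.
Qed.

Lemma smooth_at_near V W (f : V -> W) x :
  smooth_at f x -> \forall y \near x, smooth_at f y.
Proof.
move=> [B [Oo Ox] fO]; near=> y; exists B => //; split=> //.
by near: y; exact: open_nbhs_nbhs.
Unshelve. all: by end_near. Qed.

Lemma smooth_at_eq V W (f g : V -> W) x :
  {near x, f =1 g} -> smooth_at f x -> smooth_at g x.
Proof.
move=> /= fg [B [Oo Ox] fO].
have : nbhs x ([set y | f y = g y]°) by exact/nbhs_interior.
exists (B `&` [set y | f y = g y]°).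
  split; first by apply: openI => //; exact: open_interior.
  by split=> //; exact: nbhs_singleton.
move=> k; apply: (@Ck_on_eq _ _ _ _ _ f).
- by apply: openI => //; exact: open_interior.
- by move=> y [_ /interior_subset].
- by apply: Ck_on_sub (fO k) => y [].
Qed.

Lemma smooth_at_differentiable V W (f : V -> W) x :
  smooth_at f x -> differentiable f x.
Proof. by move=> [B [_ Ox]] /(_ 1%N) [+ _]; exact. Qed.

Lemma smooth_at_continuous V W (f : V -> W) x :
  smooth_at f x -> {for x, continuous f}.
Proof. by move=> /smooth_at_differentiable/differentiable_continuous. Qed.

Lemma smooth_at_diff V W (f : V -> W) x (v : V) :
  smooth_at f x -> smooth_at (fun y => 'd f y v) x.
Proof. by move=> [B Ox fO]; exists B => // k; have [_] := fO k.+1; exact. Qed.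

Lemma smooth_at_cst V W (a : W) (x : V) : smooth_at (fun _ => a) x.
Proof. by exists setT => [|k]; [split; [exact: openT|]|exact: Ck_on_cst]. Qed.

Lemma smooth_at_linear V W (L : {linear V -> W}) x :
  continuous L -> smooth_at L x.
Proof.
by move=> Lc; exists setT => [|k]; [split; [exact: openT|]|exact: Ck_on_linear].
Qed.

Lemma smooth_at_comp V W X (f : V -> W) (g : W -> X) x :
  has_coordinates W -> has_coordinates X ->
  smooth_at f x -> smooth_at g (f x) -> smooth_at (fun y => g (f y)) x.
Proof.
move=> hW hX [B [Oo Ox] fO] [B' [Oo' Ox'] gO'].
have Oo2 : open (B `&` f @^-1` B').
  have fc : {in B, continuous f}.
    by move=> y; rewrite inE => Oy; exact: (fO 0).
  by move/(continuous_inP f Oo): fc; exact.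
exists (B `&` f @^-1` B') => // k.
apply: (@Ck_on_comp _ _ _ _ _ B') => //; first by move=> y [].
by apply: Ck_on_sub (fO k) => y [].
Qed.

Lemma smooth_at_lin_comp V W X (f : V -> W) (L : {linear W -> X}) x :
  continuous L -> smooth_at f x -> smooth_at (fun y => L (f y)) x.
Proof.
by move=> Lc [B Ox fO]; exists B => // k; apply: Ck_on_lin_comp => //; case: Ox.
Qed.

Lemma smooth_at2 V W X (Y : normedModType R) (f : V -> W) (g : V -> X) (h : V -> Y) x :
  (forall U k, open U -> Ck_on U k f -> Ck_on U k g -> Ck_on U k h) ->
  smooth_at f x -> smooth_at g x -> smooth_at h x.
Proof.
move=> fgh [B [Oo Ox] fO] [B' [Oo' Ox'] gO'].
exists (B `&` B'); first by split => //; exact: openI.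
move=> k; apply: fgh; first exact: openI.
  by apply: Ck_on_sub (fO k) => y [].
by apply: Ck_on_sub (gO' k) => y [].
Qed.

Lemma smooth_atD V W (f g : V -> W) x :
  smooth_at f x -> smooth_at g x -> smooth_at (fun y => f y + g y) x.
Proof. by apply: smooth_at2 => U k; apply: Ck_on_add. Qed.

Lemma smooth_atM V (f g : V -> R^o) x :
  smooth_at f x -> smooth_at g x -> smooth_at (fun y => f y * g y : R^o) x.
Proof. by apply: smooth_at2 => U k; apply: Ck_on_mul. Qed.

Lemma smooth_atZ V W (f : V -> R^o) (g : V -> W) x : has_coordinates W ->
  smooth_at f x -> smooth_at g x -> smooth_at (fun y => f y *: g y) x.
Proof. by move=> hW; apply: smooth_at2 => U k; exact: Ck_on_scale. Qed.

Lemma smooth_atN V W (f : V -> W) x : smooth_at f x -> smooth_at (fun y => - f y) x.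
Proof.
pose L : {linear W -> W} := (-%R : W -> W).
by apply: (@smooth_at_lin_comp _ _ _ _ L) => y; exact: opp_continuous.
Qed.

Lemma smooth_atB V W (f g : V -> W) x :
  smooth_at f x -> smooth_at g x -> smooth_at (fun y => f y - g y) x.
Proof. by move=> fx gx; apply: smooth_atD => //; exact: smooth_atN. Qed.

Lemma smooth_at_sum V W (I : Type) (r : seq I) (f : I -> V -> W) x :
  (forall i, smooth_at (f i) x) -> smooth_at (fun y => \sum_(i <- r) f i y) x.
Proof.
move=> fx; elim: r => [|i r IH].
  apply: smooth_at_eq (smooth_at_cst 0 x); near=> y; by rewrite big_nil.
apply: smooth_at_eq (smooth_atD (fx i) IH); near=> y; by rewrite big_cons.
Unshelve. all: by end_near. Qed.

Lemma smooth_at_id V (x : V) : smooth_at (fun y => y) x.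
Proof. by apply: (@smooth_at_linear _ _ idfun) => y; exact: cvg_id. Qed.

Lemma smooth_at_fst V W (x : V * W) : smooth_at (fun y : V * W => y.1) x.
Proof. by apply: (@smooth_at_linear _ _ fst) => y; exact: cvg_fst. Qed.

Lemma smooth_at_snd V W (x : V * W) : smooth_at (fun y : V * W => y.2) x.
Proof. by apply: (@smooth_at_linear _ _ snd) => y; exact: cvg_snd. Qed.

Lemma smooth_at_pair V W X (f : V -> W) (g : V -> X) x :
  smooth_at f x -> smooth_at g x -> smooth_at (fun y => (f y, g y)) x.
Proof.
have l1 : linear (fun w : W => (w, 0 : X)).
  move=> a u v; apply: injective_projections => //=.
  by rewrite scaler0 addr0.
have l2 : linear (fun w : X => (0 : W, w)).
  move=> a u v; apply: injective_projections => //=.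
  by rewrite scaler0 addr0.
pose L1 : {linear W -> (W * X)%type}
  := HB.pack (fun w : W => (w, 0 : X)) (GRing.isLinear.Build _ _ _ _ _ l1).
pose L2 : {linear X -> (W * X)%type}
  := HB.pack (fun w : X => (0 : W, w)) (GRing.isLinear.Build _ _ _ _ _ l2).
have c1 : continuous L1 by move=> y; apply: cvg_pair => //=; exact: cvg_cst.
have c2 : continuous L2 by move=> y; apply: cvg_pair => //=; exact: cvg_cst.
move=> /(smooth_at_lin_comp c1) fx /(smooth_at_lin_comp c2) gx.
apply: smooth_at_eq (smooth_atD fx gx); near=> y.
by apply: injective_projections; rewrite /= ?addr0 ?add0r.
Unshelve. all: by end_near. Qed.

Lemma smooth_at_coord n (x : 'rV[R]_n) i :
  smooth_at (fun y : 'rV[R]_n => y 0 i : R^o) x.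
Proof.
pose c (w : 'rV[R]_n) : R^o := w 0 i.
have cl : linear c by move=> a u v; rewrite /c !mxE.
pose L : {linear 'rV[R]_n -> R^o} := HB.pack c (GRing.isLinear.Build _ _ _ _ c cl).
apply: (@smooth_at_linear _ _ L) => y; exact: coord_continuous.
Qed.

Lemma smooth_at_mxE V n (f : V -> 'rV[R]_n) x i :
  smooth_at f x -> smooth_at (fun y => f y 0 i : R^o) x.
Proof.
move=> fx; apply: (@smooth_at_comp _ _ _ _ (fun y : 'rV[R]_n => y 0 i : R^o)) => //.
exact: smooth_at_coord.
Qed.

End SmoothAt.

(** * Smooth real functions *)

Section RealFunctions.
Context {R : realType}.
Implicit Types (f g : R^o -> R^o) (x y : R^o) (U : set R^o) (k : nat).

Lemma is_derive_diff f x (a : R) v : is_derive x 1 f a -> 'd f x v = v * a.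
Proof. by move=> [fx fa]; rewrite deriv1E// derive1E fa. Qed.

Lemma Ck_on_is_derive U k f (df : R^o -> R^o) : open U ->
  (forall x, U x -> is_derive x 1 f (df x)) -> Ck_on U k df -> Ck_on U k.+1 f.
Proof.
move=> Uo fU dfC; split=> [x /fU[fx _]|v]; first exact/derivable1_diffP.
apply: (@Ck_on_eq _ _ _ _ _ (fun x => v * df x : R^o)) => //.
  by move=> x /fU/is_derive_diff ->.
by apply: Ck_on_mul => //; exact: Ck_on_cst.
Qed.

Lemma is_derive_inv x : x != 0 ->
  is_derive x 1 (fun y : R^o => y^-1 : R^o) (- 1 * (x^-1 * x^-1)).
Proof.
move=> x0; apply: (is_derive_eq (@is_deriveV _ id x 1 1 x0 (is_derive_id _ _))).
by rewrite /GRing.scale /=; field.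
Qed.

(** Bootstrap: the derivative of the inverse is a polynomial in the inverse, so each order of
    differentiability yields the next. *)
Lemma smooth_atV x : x != 0 -> smooth_at (fun y : R^o => y^-1 : R^o) x.
Proof.
move=> x0; apply: smooth_on_at (@open_neq R 0) x0 _ => k.
elim: k => [|k IH]; first by move=> y /= y0; exact: inv_continuous.
apply: (@Ck_on_is_derive _ _ _ (fun y => (-1) * (y^-1 * y^-1))).
- exact: (@open_neq R 0).
- by move=> y y0; exact: is_derive_inv.
- apply: Ck_on_mul; [exact: (@open_neq R 0)|exact: Ck_on_cst|].
  by apply: Ck_on_mul => //; exact: (@open_neq R 0).
Qed.

(** Same bootstrap: the derivative is half the inverse of the square root itself. *)
Lemma smooth_at_sqrt x : 0 < x -> smooth_at (Num.sqrt : R^o -> R^o) x.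
Proof.
move=> x0; have o0 : open [set y : R^o | 0 < y] by exact: open_gt.
apply: (smooth_on_at o0 x0).
elim=> [|k IH]; first by move=> y _; exact: sqrt_continuous.
apply: (@Ck_on_is_derive _ _ _ (fun y => 2^-1 * ((fun y : R^o => y^-1 : R^o) \o
  (Num.sqrt : R^o -> R^o)) y)).
- exact: o0.
- move=> y /= y0; apply: (is_derive_eq (is_derive1_sqrt y0)).
  by rewrite invfM.
- apply: Ck_on_mul; [exact: o0|exact: Ck_on_cst|].
  apply: (@Ck_on_comp _ _ _ _ _ [set y | y != 0]) => //.
  + by move=> y /= y0; rewrite gt_eqF// sqrtr_gt0.
  + by apply: smooth_at_on => y; exact: smooth_atV.
Qed.

(* x^-k e^(-1/x), extended by 0 to x <= 0; its derivative is a combination of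
   functions of the same family, so it is flat at 0. *)
Definition flat k x : R^o := if 0 < x then x^-1 ^+ k * expR (- x^-1) else 0.

Lemma flat_ge0 k x : 0 <= flat k x.
Proof.
rewrite /flat; case: ifPn => // x0; apply: mulr_ge0; last exact: expR_ge0.
by rewrite exprn_ge0// invr_ge0 ltW.
Qed.

Lemma flat_gt0 k x : 0 < x -> 0 < flat k x.
Proof.
by move=> x0; rewrite /flat x0 mulr_gt0 ?expR_gt0// exprn_gt0// invr_gt0.
Qed.

Lemma flat_le0 k x : x <= 0 -> flat k x = 0.
Proof. by move=> x0; rewrite /flat ltNge x0. Qed.

(** From [y ^ (k + 2) / (k + 2)! <= expR y] at [y = x^-1]. A quadratic bound is what makes the
    difference quotient at 0 vanish in the limit. *)
Lemma flat_le k x : flat k x <= (k.+2)`!%:R * x ^+ 2.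
Proof.
rewrite /flat; case: ifPn => x0; last by rewrite mulr_ge0 ?ler0n ?sqr_ge0.
have y0 : 0 < x^-1 by rewrite invr_gt0.
have := expR_ge1Dxn k.+1 (ltW y0).
set E := expR _ => hE.
have {}hE : x^-1 ^+ k.+2 / (k.+2)`!%:R <= E by apply: le_trans hE; rewrite lerDr.
have f0 : 0 < (k.+2)`!%:R :> R by rewrite ltr0n fact_gt0.
have E0 : 0 < E by exact: expR_gt0.
rewrite expRN -/E ler_pdivrMr//; move: hE; rewrite ler_pdivrMr// => hE.
have -> : x^-1 ^+ k = x^-1 ^+ k.+2 * x ^+ 2.
  by rewrite -[k.+2]addn2 exprD -mulrA -exprMn mulVf ?gt_eqF// expr1n mulr1.
apply: le_trans (ler_wpM2r _ hE) _; first exact: sqr_ge0.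
by rewrite -mulrA mulrC.
Qed.

Lemma is_derive_flat k x :
  is_derive x 1 (flat k) (flat k.+2 x - k%:R * flat k.+1 x).
Proof.
case: (ltgtP x 0) => x0.
- rewrite !flat_le0 ?ltW// mulr0 subr0.
  apply: (@near_eq_is_derive R R^o R^o (cst 0)).
  near=> y; rewrite flat_le0//; apply: ltW; near: y; exact: lt_nbhsl.
- rewrite /flat x0.
  apply: (@near_eq_is_derive R R^o R^o (fun y : R^o => y^-1 ^+ k * expR (- y^-1))).
    near=> y; suff -> : 0 < y by []; near: y; exact: lt_nbhsr.
  have xn0 : x != 0 by rewrite gt_eqF.
  have dV : is_derive x 1 (fun y : R^o => y^-1 : R^o) (- x ^- 2).
    by apply: (is_derive_eq (is_derive_inv xn0)); field.
  have dE : is_derive x 1 (fun y : R^o => expR (- y^-1) : R^o) (expR (- x^-1) * x ^- 2).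
    apply: (is_derive_eq
      (@is_derive1_comp _ expR (fun y => - y^-1) x _ _ _ (is_deriveN dV))).
    by rewrite opprK.
  have dX : is_derive x 1 (fun y : R^o => y^-1 ^+ k : R^o) (k%:R * x^-1 ^+ k.-1 * - x ^- 2).
    have -> : (fun y : R^o => y^-1 ^+ k : R^o) = (fun y : R^o => y^-1 : R^o) ^+ k.
      by apply/funext => y; rewrite fctE.
    exact: is_deriveX.
  apply: (is_derive_eq (is_deriveM dX dE)).
  rewrite /GRing.scale /= -exprVn !exprS; case: (k) => [|j] /=; first by ring.
  by rewrite !exprS; ring.
(* At 0 the difference quotient is at most a constant times [|h|], by [flat_le]. *)
- rewrite x0 !flat_le0// mulr0 subr0.
  have cv : (h^-1 *: ((flat k \o shift 0) (h *: (1 : R^o)) - flat k 0)) @[h --> 0^']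
    --> (0 : R^o).
    apply/cvgrPdist_le => e e0; near=> h.
    rewrite sub0r normrN /= (@flat_le0 k 0)// subr0 addr0 /GRing.scale /= mulr1.
    have h0 : h != 0 by near: h; exact: nbhs_dnbhs_neq.
    rewrite normrM normfV ler_pdivrMl ?normr_gt0//.
    rewrite ger0_norm ?flat_ge0//; apply: le_trans (flat_le _ _) _.
    rewrite -(real_normK (num_real h)) expr2 mulrA [in leRHS]mulrC ler_pM2r ?normr_gt0//.
    rewrite -ler_pdivlMl ?ltr0n ?fact_gt0//.
    near: h; apply: dnbhs0_le; rewrite mulr_gt0// invr_gt0 ltr0n fact_gt0.
  apply: DeriveDef; first by apply/cvg_ex; exists 0.
  exact: cvg_lim.
Unshelve. all: by end_near. Qed.

Lemma smooth_at_flat k x : smooth_at (flat k) x.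
Proof.
apply: (smooth_on_at openT I) => j.
elim: j k => [|j IH] k.
  move=> y _; apply: differentiable_continuous; apply/derivable1_diffP.
  exact: (@ex_derive _ _ _ _ _ _ _ (is_derive_flat k y)).
apply: (@Ck_on_is_derive _ _ _ (fun y => flat k.+2 y + (- k%:R) * flat k.+1 y)) => //.
- exact: openT.
- by move=> y _; rewrite mulNr; exact: is_derive_flat.
- apply: Ck_on_add => //; first exact: openT.
  by apply: Ck_on_mul => //; [exact: openT|exact: Ck_on_cst].
Qed.

(** Smooth transition from 0 to 1 across [-1, 1]. It is used twice: its primitive is the regularised
    positive part, and it is the profile of the bump functions. *)
Definition smooth_step x : R^o := flat 0 (1 + x) / (flat 0 (1 + x) + flat 0 (1 - x)).

Lemma smooth_step_den x : 0 < flat 0 (1 + x) + flat 0 (1 - x).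
Proof.
have [x0|x0] := leP 0 x.
  by rewrite ltr_pwDl ?flat_ge0// flat_gt0//; lra.
by rewrite ltr_pwDr ?flat_ge0// flat_gt0//; lra.
Qed.

Lemma smooth_step_ge0 x : 0 <= smooth_step x.
Proof. by rewrite divr_ge0 ?flat_ge0// ltW// smooth_step_den. Qed.

Lemma smooth_step_le1 x : smooth_step x <= 1.
Proof.
by rewrite ler_pdivrMr ?smooth_step_den// mul1r lerDl flat_ge0.
Qed.

Lemma smooth_step0 x : x <= -1 -> smooth_step x = 0.
Proof. by move=> x1; rewrite /smooth_step flat_le0 ?mul0r//; lra. Qed.

Lemma smooth_step1 x : 1 <= x -> smooth_step x = 1.
Proof.
move=> x1; have := smooth_step_den x; rewrite /smooth_step (@flat_le0 0 (1 - x)).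
  by rewrite addr0 => x0; rewrite divff// gt_eqF.
lra.
Qed.

Lemma smooth_at_smooth_step x : smooth_at smooth_step x.
Proof.
have f1 : smooth_at (fun y : R^o => flat 0 (1 + y) : R^o) x.
  apply: smooth_at_comp => //; last exact: smooth_at_flat.
  by apply: smooth_atD; [exact: smooth_at_cst|exact: smooth_at_id].
have f2 : smooth_at (fun y : R^o => flat 0 (1 - y) : R^o) x.
  apply: smooth_at_comp => //; last exact: smooth_at_flat.
  by apply: smooth_atB; [exact: smooth_at_cst|exact: smooth_at_id].
apply: smooth_atM => //.
apply: (@smooth_at_comp _ _ _ _ _ (fun y : R^o => y^-1 : R^o)) => //.
  exact: smooth_atD.
by apply: smooth_atV; rewrite gt_eqF// smooth_step_den.
Qed.

(** By the quotient rule the derivative is [(a * db + b * da) / (a + b) ^ 2] with all terms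
    nonnegative. This sign is the convexity of the regularised maximum. *)
Lemma is_derive_smooth_step x :
  exists2 d, is_derive x 1 smooth_step d & 0 <= d.
Proof.
pose a y := flat 0 (1 + y); pose b y := flat 0 (1 - y).
pose da := flat 2 (1 + x); pose db := flat 2 (1 - x).
have dA : is_derive x 1 a da.
  have i1 : is_derive x 1 (fun y : R^o => 1 + y : R^o) 1.
    by apply: (is_derive_eq (@is_deriveD R R^o R^o (cst 1) id x 1 0 1 _ _)); rewrite add0r.
  apply: (is_derive_eq (is_derive1_comp (is_derive_flat 0 (1 + x)) i1)).
  by rewrite mulr1 mul0r subr0.
have dB : is_derive x 1 b (- db).
  have i1 : is_derive x 1 (fun y : R^o => 1 - y : R^o) (-1).
    by apply: (is_derive_eq (@is_deriveB R R^o R^o (cst 1) id x 1 0 1 _ _)); rewrite sub0r.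
  apply: (is_derive_eq
    (@is_derive1_comp R (flat 0) (fun y => 1 - y) x _ _ (is_derive_flat 0 (1 - x)) i1)).
  by rewrite mulrN1 mul0r subr0.
have ab0 := smooth_step_den x; rewrite -/(a x) -/(b x) in ab0.
have abn0 : (a \+ b) x != 0 by rewrite gt_eqF.
have dV := is_deriveV abn0 (is_deriveD dA dB).
have dQ := is_deriveM dA dV.
eexists; first exact: (is_derive_eq dQ erefl).
have a0 : 0 <= a x by exact: flat_ge0.
have b0 : 0 <= b x by exact: flat_ge0.
have da0 : 0 <= da by exact: flat_ge0.
have db0 : 0 <= db by exact: flat_ge0.
rewrite /GRing.scale /=.
rewrite [X in 0 <= X](_ : _ = (a x * db + b x * da) / (a x + b x) ^+ 2).
  by rewrite divr_ge0 ?sqr_ge0// addr_ge0// mulr_ge0.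
by field.
Qed.

(** A primitive of [smooth_step], suitably translated, is a smooth convex substitute [th] for the
    positive part; [q + th (h - q)] is then a regularised maximum of [q] and [h]. *)
Lemma smooth_max_exists : exists th th1 th2 : R^o -> R^o,
  [/\ forall x, smooth_at th x,
      forall x, is_derive x 1 th (th1 x) /\ is_derive x 1 th1 (th2 x),
      forall x, 0 <= th1 x <= 1 /\ 0 <= th2 x,
      forall x, x <= - 2 -> th x = 0 &
      forall x, 2 <= x -> th x = x].
Proof.
pose mu := @lebesgue_measure R.
have sc y : {for y, continuous smooth_step}.
  exact: smooth_at_continuous (smooth_at_smooth_step y).
(* The lower limit -3 lies strictly left of the support of [smooth_step]: the fundamental theorem
   covers [y > -3], and [A] is locally 0 elsewhere. *)
pose A (y : R^o) : R^o := \int[mu]_(t in [set` `[-3, y]]) smooth_step t.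
have A0 y : y <= -1 -> A y = 0.
  move=> y1; rewrite /A (@eq_Rintegral _ _ _ _ _ (cst 0)); last first.
    move=> t; rewrite inE /= in_itv /= => /andP[_ ty].
    by rewrite smooth_step0// (le_trans ty).
  by rewrite Rintegral_cst//= ?mul0r.
have dA y : is_derive y 1 A (smooth_step y).
  have [y3|y3] := ltP (-3) y.
    have yy : y < y + 1 by lra.
    have [|dA A'] := @continuous_FTC1_closed R smooth_step (-3) y (y + 1) yy _ y3 (sc y).
      apply: continuous_compact_integrable; first exact: segment_compact.
      exact: continuous_subspaceT.
    by apply: DeriveDef; [exact: dA|rewrite -derive1E].
  rewrite smooth_step0; last lra.
  apply: (@near_eq_is_derive R R^o R^o (cst 0)).
  near=> z; rewrite A0//; apply: ltW; near: z; apply: lt_nbhsl; lra.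
have Ac : continuous A.
  move=> y; apply: differentiable_continuous; apply/derivable1_diffP.
  exact: (@ex_derive _ _ _ _ _ _ _ (dA y)).
have Amono y z : y <= z -> 0 <= A z - A y <= z - y.
  move=> yz; have [c _ ->] := MVT_segment yz (fun x _ => dA x) (continuous_subspaceT Ac).
  have := smooth_step_ge0 c; have := smooth_step_le1 c.
  set s := smooth_step c; have : 0 <= z - y by lra.
  nra.
(* For [y >= 1], [A y = y - k], so translating by [k] gives the identity there. Since [|k| <= 1],
   the transition zone [-1, 1] ends up inside [-2, 2]. *)
pose k := 1 - A 1.
have [k1 k2] : - 1 <= k /\ k <= 1.
  have /Amono : (-1 : R^o) <= 1 by lra.
  by rewrite (A0 (-1))// /k; lra.
have A1 y : 1 <= y -> A y = A 1 + (y - 1).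
  move=> y1; have [|c] := @MVT_segment _ A smooth_step 1 y y1 (fun x _ => dA x).
    exact: continuous_subspaceT.
  rewrite in_itv/= => /andP[c1 _]; rewrite smooth_step1// mul1r; lra.
have dk x : is_derive x 1 (fun y : R^o => y + k : R^o) 1.
  by apply: (is_derive_eq (@is_deriveD R R^o R^o id (cst k) x 1 1 0 _ _)); rewrite addr0.
have As y : smooth_at A y.
  apply: (smooth_on_at openT I) => -[|j]; first by move=> z _; exact: Ac.
  apply: (@Ck_on_is_derive _ _ _ smooth_step); first exact: openT.
  by apply: smooth_at_on => z _; exact: smooth_at_smooth_step.
have /choice[d dP] : forall x, exists d, is_derive x 1 smooth_step d /\ 0 <= d.
  by move=> x; have [d] := is_derive_smooth_step x; exists d.
exists (fun x => A (x + k)), (fun x => smooth_step (x + k)), (fun x => d (x + k)).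
split.
- move=> x; apply: smooth_at_comp => //.
  by apply: smooth_atD; [exact: smooth_at_id|exact: smooth_at_cst].
- move=> x; split.
    by apply: (is_derive_eq
      (@is_derive1_comp R A (fun y => y + k) x _ _ (dA (x + k)) (dk x))); rewrite mulr1.
  by apply: (is_derive_eq (@is_derive1_comp R smooth_step (fun y => y + k) x _ _ (dP (x
    + k)).1 (dk x))); rewrite mulr1.
- move=> x; rewrite smooth_step_ge0 smooth_step_le1; split=> //.
  exact: (dP (x + k)).2.
- by move=> x x2; apply: A0; lra.
- by move=> x x2; rewrite A1; [rewrite /k; lra|lra].
Unshelve. all: by end_near. Qed.

End RealFunctions.

(** * Convex graphs *)

(* The differential applied to a vector, opaque to unification: otherwise
   failed matches unfold the choice operator behind ['d]. *)
HB.lock Definition dird (R : realType) (V W : normedModType R) (f : V -> W)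
  (x v : V) : W := 'd f x v.

Section DirectionalDifferentials.
Context {R : realType}.
Implicit Types (V W X : normedModType R).

Lemma dirdE V W (f : V -> W) x v : dird f x v = 'd f x v.
Proof. by rewrite dird.unlock. Qed.

Lemma dirdP V W (f : V -> W) x (a : R) u v :
  dird f x (a *: u + v) = a *: dird f x u + dird f x v.
Proof. by rewrite !dirdE; exact: linearP. Qed.

Lemma dird0 V W (f : V -> W) x : dird f x 0 = 0.
Proof. by rewrite dirdE; exact: linear0. Qed.

Lemma dirdD V W (f : V -> W) x u v : dird f x (u + v) = dird f x u + dird f x v.
Proof. by rewrite !dirdE; exact: linearD. Qed.

Lemma dirdZ V W (f : V -> W) x (a : R) u : dird f x (a *: u) = a *: dird f x u.
Proof. by rewrite !dirdE; exact: linearZ. Qed.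

Lemma dirdB V W (f : V -> W) x u v : dird f x (u - v) = dird f x u - dird f x v.
Proof. by rewrite !dirdE; exact: linearB. Qed.

Lemma dird_cst V W (a : W) (x v : V) : dird (fun _ : V => a) x v = 0.
Proof. by rewrite dirdE; exact: (congr1 (@^~ v) (diff_cst a x)). Qed.

Lemma dird_add V W (f g : V -> W) (x v : V) :
  differentiable f x -> differentiable g x ->
  dird (fun y => f y + g y) x v = dird f x v + dird g x v.
Proof. by move=> fx gx; rewrite !dirdE; exact: (congr1 (@^~ v) (diffD fx gx)). Qed.

Lemma dird_sub V W (f g : V -> W) (x v : V) :
  differentiable f x -> differentiable g x ->
  dird (fun y => f y - g y) x v = dird f x v - dird g x v.
Proof. by move=> fx gx; rewrite !dirdE; exact: (congr1 (@^~ v) (diffB fx gx)). Qed.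

Lemma dird_mul V (f g : V -> R^o) (x v : V) :
  differentiable f x -> differentiable g x ->
  dird (fun y => f y * g y : R^o) x v = f x * dird g x v + g x * dird f x v.
Proof. by move=> fx gx; rewrite !dirdE; exact: (congr1 (@^~ v) (diffM fx gx)). Qed.

Lemma dird_scale V W (f : V -> R^o) (a : W) (x v : V) :
  differentiable f x -> dird (fun y => f y *: a) x v = dird f x v *: a.
Proof. by move=> fx; rewrite !dirdE; exact: (congr1 (@^~ v) (diffZl a fx)). Qed.

Lemma dird_cstmul V (a : R) (f : V -> R^o) (x v : V) :
  differentiable f x -> dird (fun y => a * f y : R^o) x v = a * dird f x v.
Proof. by move=> fx; rewrite !dirdE; exact: (congr1 (@^~ v) (diffZ a fx)). Qed.

Lemma dird_lin V W (L : {linear V -> W}) (x v : V) :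
  continuous L -> dird L x v = L v.
Proof. by move=> Lc; rewrite !dirdE; exact: (congr1 (@^~ v) (diff_lin x Lc)). Qed.

Lemma dird_comp V W X (f : V -> W) (g : W -> X) (x v : V) :
  differentiable f x -> differentiable g (f x) ->
  dird (fun y => g (f y)) x v = dird g (f x) (dird f x v).
Proof.
by move=> fx gx; rewrite !dirdE; exact: (congr1 (@^~ v) (diff_comp fx gx)).
Qed.

Lemma dird_eq V W (f g : V -> W) (x v : V) :
  differentiable f x -> {near x, f =1 g} -> dird g x v = dird f x v.
Proof.
by move=> fx fg; rewrite !dirdE; exact: (congr1 (@^~ v) (eq_near_diff fx fg)).
Qed.

Lemma smooth_at_dird V W (f : V -> W) x (v : V) :
  smooth_at f x -> smooth_at (fun y => dird f y v) x.
Proof.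
move=> fx; have -> : (fun y => dird f y v) = (fun y => 'd f y v).
  by apply/funext => y; rewrite dirdE.
exact: smooth_at_diff.
Qed.

Lemma is_derive_dird (f : R^o -> R^o) (x : R^o) a v :
  is_derive x 1 f a -> dird f x v = v * a.
Proof. by rewrite dirdE; exact: is_derive_diff. Qed.

Lemma differentiable_sum_dird V W (I : Type) (r : seq I) (f : I -> V -> W)
    (x v : V) : (forall i, differentiable (f i) x) ->
  differentiable (fun y => \sum_(i <- r) f i y) x /\
  dird (fun y => \sum_(i <- r) f i y) x v = \sum_(i <- r) dird (f i) x v.
Proof.
move=> fx; elim: r => [|i r [IHd IH]].
  have -> : (fun y => \sum_(i <- [::]) f i y) = (fun _ => 0).
    by apply/funext => y; rewrite big_nil.
  by rewrite big_nil dird_cst; split; [exact: differentiable_cst|].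
have -> : (fun y => \sum_(j <- i :: r) f j y) = (fun y => f i y + \sum_(j <- r) f j y).
  by apply/funext => y; rewrite big_cons.
split; first exact: differentiableD.
by rewrite big_cons -IH dird_add.
Qed.

Lemma is_derive_line V (f : V -> R^o) x u (s : R) : differentiable f (x + s *: u) ->
  is_derive s 1 (fun r : R^o => f (x + r *: u) : R^o) (dird f (x + s *: u) u).
Proof.
move=> fx; set g := fun r : R^o => _.
have gE : (fun h : R => h^-1 *: ((g \o shift s) (h *: (1 : R^o)) - g s)) =
    (fun h : R => h^-1 *: ((f \o shift (x + s *: u)) (h *: u) - f (x + s *: u))).
  apply/funext => h; rewrite /g /= [h *: 1]mulr1; congr (_ *: (f _ - _)).
  by rewrite scalerDl addrCA.
apply: DeriveDef; first by rewrite /derivable gE; exact: diff_derivable.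
by rewrite /derive gE dirdE -[RHS]deriveE.
Qed.

End DirectionalDifferentials.

(** * Second directional derivatives *)

Section SecondDerivative.
Context {R : realType} {n : nat}.
Local Notation E := 'rV[R]_n.
Implicit Types (f : E -> R^o) (x y u v : E).

(** The inner derivative is along [u] and the outer one along [v]. The two slots are handled
    separately below, without appeal to the symmetry of second derivatives. *)
Definition diff2 f y u v : R := dird (fun z => dird f z u : R^o) y v.

Lemma smooth_at_linear_rV (W : normedModType R) (L : {linear E -> W}) y :
  has_coordinates W -> smooth_at L y.
Proof.
move=> hW; have -> : (L : E -> W) = fun y => \sum_i y 0 i *: L (delta_mx 0 i).
  apply/funext => z; rewrite {1}[z]row_sum_delta linear_sum.
  by apply: eq_bigr => i _; rewrite linearZ.
apply: smooth_at_sum => i; apply: smooth_atZ => //; last exact: smooth_at_cst.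
exact: smooth_at_coord.
Qed.

Lemma dird_coordE f y u : dird f y u = \sum_i u 0 i * dird f y (delta_mx 0 i).
Proof.
rewrite dirdE {1}[u]row_sum_delta linear_sum.
by apply: eq_bigr => i _; rewrite linearZ dirdE.
Qed.

Lemma differentiable_mxE (V : normedModType R) (Y : V -> E) (y u : V) i :
  differentiable Y y -> differentiable (fun q => Y q 0 i : R^o) y /\
  dird (fun q => Y q 0 i : R^o) y u = dird Y y u 0 i.
Proof.
move=> Yd; pose c (w : E) : R^o := w 0 i.
have cl : linear c by move=> a v w; rewrite /c !mxE.
pose L : {linear E -> R^o} := HB.pack c (GRing.isLinear.Build _ _ _ _ c cl).
have Lc : continuous L by move=> z; exact: coord_continuous.
have Ld : differentiable L (Y y) by exact: linear_differentiable.
split; first exact: (differentiable_comp Yd Ld).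
by rewrite -[RHS](dird_lin (Y y) (dird Y y u) Lc); exact: dird_comp.
Qed.

(** Product rule for a covector and a vector that both move with the point. It yields the Gauss
    formula when [Y] is a tangent field, and an Euler identity when [Y] is the position field. *)
Lemma dird_apply f (Y : E -> E) y u : smooth_at f y -> differentiable Y y ->
  differentiable (fun q => dird f q (Y q) : R^o) y /\
  dird (fun q => dird f q (Y q) : R^o) y u =
    dird f y (dird Y y u) + diff2 f y (Y y) u.
Proof.
move=> fs Yd.
pose c i (q : E) : R^o := Y q 0 i.
pose g i (q : E) : R^o := dird f q (delta_mx 0 i).
have cd i : differentiable (c i) y by have [] := differentiable_mxE u i Yd.
have cE i : dird (c i) y u = dird Y y u 0 i by have [] := differentiable_mxE u i Yd.
have gd i : differentiable (g i) y by exact/smooth_at_differentiable/smooth_at_dird.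
have FE : (fun q => dird f q (Y q) : R^o) = (fun q => \sum_i (c i q * g i q)).
  by apply/funext => q; rewrite dird_coordE.
have FE' w : (fun q => dird f q w : R^o) = (fun q => \sum_i ((w 0 i) * g i q)).
  by apply/funext => q; rewrite dird_coordE.
have [d1 E1] := differentiable_sum_dird
  (index_enum 'I_n) u (fun i => differentiableM (cd i) (gd i)).
have [d2 E2] := differentiable_sum_dird
  (index_enum 'I_n) u (fun i => differentiableZ (Y y 0 i) (gd i)).
rewrite FE /diff2 FE'; split; first exact: d1.
rewrite E1 E2 dird_coordE -big_split; apply: eq_bigr => i _ /=.
rewrite -cE addrC; apply: (etrans (dird_mul u (cd i) (gd i))); congr (_ + _).
  by rewrite -dird_cstmul.
exact: mulrC.
Qed.

Lemma diff2_linearl f y v (a : R) u w : smooth_at f y ->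
  diff2 f y (a *: u + w) v = a * diff2 f y u v + diff2 f y w v.
Proof.
move=> fs.
have du := smooth_at_differentiable (smooth_at_dird u fs).
have dw := smooth_at_differentiable (smooth_at_dird w fs).
rewrite /diff2 -dird_cstmul// -dird_add//; last exact: differentiableZ.
congr (dird _ _ _); apply/funext => z; exact: dirdP.
Qed.

Lemma diff2_linearr f y u (a : R) v w :
  diff2 f y u (a *: v + w) = a * diff2 f y u v + diff2 f y u w.
Proof. by rewrite /diff2 dirdP. Qed.

End SecondDerivative.

(** * Affine geometry of a graph over a hyperplane *)

Section ConvexGraph.
Context {R : realType} {n : nat}.
Local Notation E := 'rV[R]_n.
Variables (om : {linear E -> R^o}) (T : E) (phi : E -> R^o).
Hypothesis omT : om T = 1.
Hypothesis phi_smooth : forall y : E, smooth_at phi y.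
Hypothesis phiT : forall (y : E) (s : R), phi (y + s *: T) = phi y.
Hypothesis phi_convex : forall y u : E, om u = 0 -> u != 0 -> 0 < diff2 phi y u u.
Hypothesis phi_radial : forall y : E, dird phi y y < phi y.

Implicit Types (y u v : E).

(** The graph of [phi] over [ker om] in the direction [T]: as [phi] is constant along [T], one
    equation on [E] describes it without coordinates on [ker om]. *)
Let S : set E := [set y | om y = phi y].

Let phid y : differentiable phi y.
Proof. exact: smooth_at_differentiable. Qed.

Let oms y : smooth_at om y.
Proof. exact: smooth_at_linear_rV. Qed.

Let omd y : differentiable om y.
Proof. exact: smooth_at_differentiable. Qed.

Let omE y u : dird om y u = om u.
Proof. by apply: dird_lin => z; exact: smooth_at_continuous. Qed.

Let omP (a : R) u v : om (u - a *: v) = om u - a * om v.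
Proof. by rewrite linearB linearZ. Qed.

Lemma dird_shift_invariant (f : E -> R^o) y v : differentiable f y ->
  (forall s : R, f (y + s *: v) = f y) -> dird f y v = 0.
Proof.
move=> fd fT; have := @is_derive_line _ _ f y v 0; rewrite scale0r addr0.
move=> /(_ fd) [_ <-]; have -> : (fun r : R^o => f (y + r *: v) : R^o) = cst (f y).
  by apply/funext => s; rewrite fT.
exact: derive_cst.
Qed.

Let dphiT y : dird phi y T = 0. Proof. exact: dird_shift_invariant. Qed.

Let dphi_inv y (s : R) u : dird phi (y + s *: T) u = dird phi y u.
Proof.
have line (z : E) : dird phi z u = 'D_(1 : R^o) (fun r : R^o => phi (z + r *: u) : R^o) 0.
  have := @is_derive_line _ _ phi z u 0; rewrite scale0r addr0.
  by move=> /(_ (phid _)) [_ ->].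
have e : (fun r : R^o => phi (y + s *: T + r *: u) : R^o) = (fun r => phi (y + r *: u)).
  by apply/funext => r; rewrite addrAC phiT.
by rewrite (line (y + s *: T)) (line y) e.
Qed.

Let diff2_T y u : diff2 phi y u T = 0.
Proof.
apply: dird_shift_invariant => [|s]; last exact: dphi_inv.
exact/smooth_at_differentiable/smooth_at_dird.
Qed.

Let om_proj u : om (u - om u *: T) = 0.
Proof. by rewrite omP omT mulr1 subrr. Qed.

(** The direction [T] is null for the second derivative, so only the component [w] of [u] in
    [ker om] counts. It is nonzero: a tangent multiple of [T] satisfies [om u = 0] and hence
    vanishes. *)
Let diff2_gt0 y u : om u = dird phi y u -> u != 0 -> 0 < diff2 phi y u u.
Proof.
move=> uS u0; have uE : u = om u *: T + (u - om u *: T) by rewrite addrC subrK.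
have om0 := om_proj u; set w := u - _ in uE om0.
have -> : diff2 phi y u u = diff2 phi y w w.
  rewrite {2}uE diff2_linearr diff2_T mulr0 add0r {1}uE diff2_linearl//.
  rewrite /diff2 [X in _ * X + _](_ : _ = 0) ?mulr0 ?add0r//.
  have -> : (fun z => dird phi z T : R^o) = fun _ => 0.
    by apply/funext => z; rewrite dphiT.
  exact: dird_cst.
apply: phi_convex => //; apply: contraNN u0 => /eqP w0; move: uE; rewrite w0 addr0 => uE.
by move: uS; rewrite [in RHS]uE dirdZ dphiT scaler0 => om00; rewrite uE om00 scale0r.
Qed.

Let open_itv0 (e : R) : open [set t : R^o | `|t| < e].
Proof.
have -> : [set t : R^o | `|t| < e] = ball (0 : R^o) e.
  by apply/seteqP; split=> t; rewrite -ball_normE /= sub0r normrN.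
exact: ball_open.
Qed.

(** In one direction, differentiate [om = phi] along a curve of the graph. In the other, lift a line
    of direction in [ker om] to the graph. *)
Lemma graph_tangent y u : S y -> (tangent_to S y u <-> om u = dird phi y u).
Proof.
move=> Sy; split=> [[e [gam [e0 gs gS g0 gu]]]|uS].
  have in0 : [set t : R^o | `|t| < e] 0 by rewrite /= normr0.
  have gd : differentiable gam (0 : R^o).
    exact: smooth_at_differentiable (smooth_on_at (@open_itv0 e) in0 gs).
  have fd : differentiable (fun t => om (gam t)) (0 : R^o).
    exact: (differentiable_comp gd (omd _)).
  have eqn : {near (0 : R^o), (fun t => om (gam t) : R^o) =1 (fun t => phi (gam t))}.
    near=> t; apply: gS; near: t; apply: open_nbhs_nbhs; split=> //; exact: open_itv0.
  have := dird_eq (1 : R^o) fd eqn.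
  rewrite (dird_comp (1 : R^o) gd (omd _)) (dird_comp (1 : R^o) gd (phid _)) omE.
  by rewrite (dirdE gam) gu g0 => ->.
pose w := u - om u *: T.
have omw : om w = 0 by exact: om_proj.
pose l (t : R^o) : E := y + t *: w.
(* The correction along [T] restores the equation of the graph: it raises [om] by exactly the
   increment of [phi], and leaves [phi] unchanged. *)
pose gam (t : R^o) : E := l t + (phi (l t) - phi y) *: T.
have ls t : smooth_at l t.
  apply: smooth_atD; first exact: smooth_at_cst.
  by apply: smooth_atZ => //; [exact: smooth_at_id|exact: smooth_at_cst].
have phs (t : R^o) : smooth_at (fun t : R^o => phi (l t) : R^o) t.
  exact: smooth_at_comp.
have phs' (t : R^o) : smooth_at (fun t : R^o => phi (l t) - phi y : R^o) t.
  by apply: smooth_atB; [|exact: smooth_at_cst].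
have phs2 (t : R^o) : smooth_at (fun t : R^o => (phi (l t) - phi y) *: T) t.
  by apply: smooth_atZ => //; exact: smooth_at_cst.
exists 1, gam; split=> //.
- by apply: smooth_at_on => t _; apply: smooth_atD.
- move=> t _; rewrite /S /= /gam phiT linearD linearZ /= omT /l linearD linearZ /= omw.
  by rewrite Sy /GRing.scale /=; ring.
- by rewrite /gam /l scale0r addr0 subrr scale0r addr0.
have ld := smooth_at_differentiable (ls 0).
have dl : dird l (0 : R^o) (1 : R^o) = w.
  rewrite /l dird_add.
  - rewrite dird_cst add0r dird_scale; last by [].
    by rewrite (@dird_lin _ _ _ idfun) ?scale1r// => t; exact: cvg_id.
  - exact: differentiable_cst.
  - exact: differentiableZl.
have l0 : l 0 = y by rewrite /l scale0r addr0.
rewrite -dirdE /gam dird_add//; last exact: smooth_at_differentiable.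
rewrite dl dird_scale; last exact: smooth_at_differentiable.
rewrite dird_sub//; last exact: smooth_at_differentiable.
rewrite dird_cst subr0 dird_comp// dl l0.
by rewrite {2}/w dirdB dirdZ dphiT scaler0 subr0 -uS /w subrK.
Unshelve. all: by end_near. Qed.

Lemma graph_smooth_hypersurface : smooth_hypersurface S.
Proof.
move=> y Sy; exists setT, (fun z => om z - phi z : R^o); split.
- by split; first exact: openT.
- by move=> k; apply: smooth_at_on => z _; exact: smooth_atB.
- by move=> z _; split=> [->|/eqP]; [rewrite subrr|rewrite subr_eq0 => /eqP].
- exists T; rewrite -dirdE dird_sub// omE dphiT omT subr0; exact: oner_neq0.
Qed.

(** The form [om - dphi_y], whose kernel is the tangent space, takes the value
    [phi y - dphi_y y > 0] on the position vector; this determines the radial component [a]. *)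
Lemma graph_transverse y : S y -> transverse_radially S y.
Proof.
move=> Sy w; have d0 : phi y - dird phi y y != 0 by rewrite gt_eqF// subr_gt0.
pose a := (om w - dird phi y w) / (phi y - dird phi y y).
exists (w - a *: y), a; split; last by rewrite subrK.
apply/(graph_tangent _ Sy); rewrite omP dirdB dirdZ Sy.
have : a * (phi y - dird phi y y) = om w - dird phi y w by rewrite divfK.
by rewrite /GRing.scale /= => aE; lra.
Qed.

(* A field [Y] tangent to [S] satisfies [om (Y q) = dphi_q (Y q)] on [S];
   differentiating along a curve of velocity [u] gives
   [(om - dphi) (D_u Y) = D^2 phi (u, u)]. *)
Lemma graph_second_fundamental_form y u (a : R) (B : set E) (Y : E -> E) :
  S y -> tangent_to S y u -> open_nbhs y B -> smooth_on B Y ->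
  (forall q, B q -> S q -> tangent_to S q (Y q)) -> Y y = u ->
  tangent_to S y ('d Y y u - a *: y) ->
  a * (phi y - dird phi y y) = diff2 phi y u u.
Proof.
move=> Sy uT [Bo By] Ys YS Yy /(graph_tangent _ Sy).
have Yd : differentiable Y y by exact: smooth_at_differentiable (smooth_on_at Bo By Ys).
rewrite omP dirdB dirdZ Sy -dirdE => eqn.
have [Fd FE] := dird_apply u (phi_smooth y) Yd.
suff : om (dird Y y u) = dird phi y (dird Y y u) + diff2 phi y u u.
  by move=> h; move: eqn; rewrite h /GRing.scale /=; lra.
rewrite -[X in diff2 phi y X]Yy -FE.
have [e [gam [e0 gs gS g0 gu]]] := uT.
have in0 : [set t : R^o | `|t| < e] 0 by rewrite /= normr0.
have gd : differentiable gam (0 : R^o).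
  exact: smooth_at_differentiable (smooth_on_at (@open_itv0 e) in0 gs).
have gB : \forall t \near (0 : R^o), B (gam t).
  by apply: (differentiable_continuous gd); rewrite g0; exact: open_nbhs_nbhs.
have Sn : \forall t \near (0 : R^o), `|t| < e.
  by apply: open_nbhs_nbhs; split=> //; exact: open_itv0.
have omYd : differentiable (fun q => om (Y q) : R^o) y.
  exact: (differentiable_comp Yd (omd _)).
have gd0 : differentiable (fun q => om (Y q) : R^o) (gam 0) by rewrite g0.
have fd : differentiable (fun t => om (Y (gam t)) : R^o) (0 : R^o).
  exact: (differentiable_comp gd gd0).
have neq : {near (0 : R^o), (fun t => om (Y (gam t)) : R^o)
    =1 (fun t => dird phi (gam t) (Y (gam t)) : R^o)}.
  near=> t; have Bt : B (gam t) by near: t.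
  have St : S (gam t) by apply: gS; near: t.
  exact/(graph_tangent _ St)/YS.
have := dird_eq (1 : R^o) fd neq.
rewrite (dird_comp (1 : R^o) gd gd0)
  (@dird_comp _ _ _ _ gam (fun q => dird phi q (Y q)) _ _ gd).
  by rewrite (dirdE gam) gu g0 => ->; rewrite (dird_comp u Yd (omd _)) omE.
by rewrite g0.
Unshelve. all: by end_near. Qed.

(** The form is the quotient of [diff2 phi y u u] by [phi y - dird phi y y], both positive. It
    remains to exhibit one extension of [u] to a tangent field. *)
Lemma graph_strongly_convex : strongly_convex S.
Proof.
split; first exact: graph_smooth_hypersurface.
move=> y Sy u uT u0; have uS := (graph_tangent _ Sy).1 uT.
have d0 : 0 < phi y - dird phi y y by rewrite subr_gt0.
have D0 := diff2_gt0 uS u0.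
(* Any value selected by [xget] obeys the Gauss formula. The other case is refuted by a value that
   qualifies, so the default 0 does not occur. *)
rewrite /second_fundamental_form; case: xgetP => [a _ [B [Y [yB Ys YS Yy Ya]]]|].
  by rewrite -(pmulr_lgt0 _ d0) (graph_second_fundamental_form Sy uT yB Ys YS Yy Ya).
move=> /(_ (diff2 phi y u u / (phi y - dird phi y y))) []; exists setT.
pose g (q : E) : R^o := dird phi q u.
(* The lift to the graph of the constant field on [ker om] given by the projection of [u]. Its
   derivative along [u] is [diff2 phi y u u *: T]. *)
pose Y q : E := g q *: T + (u - om u *: T).
have gs q : smooth_at g q by exact: smooth_at_dird.
have gTs q : smooth_at (fun q => g q *: T) q.
  by apply: smooth_atZ; [by []|exact: gs|exact: smooth_at_cst].
have Ys q : smooth_at Y q by apply: smooth_atD; last exact: smooth_at_cst.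
exists Y; split.
- by split; first exact: openT.
- by apply: smooth_at_on => q _; exact: Ys.
- move=> q _ Sq; apply/(graph_tangent _ Sq); rewrite /Y.
  rewrite linearD linearZ om_proj addr0 omT dirdD dirdB !dirdZ dphiT.
  by rewrite !scaler0 subr0 add0r; exact: mulr1.
- by rewrite /Y /g -uS addrC subrK.
- apply/(graph_tangent _ Sy).
  have dYE : dird Y y u = diff2 phi y u u *: T.
    rewrite /Y dird_add.
    + rewrite dird_cst addr0 dird_scale//; exact: smooth_at_differentiable.
    + exact: smooth_at_differentiable.
    + exact: differentiable_cst.
  rewrite -dirdE dYE omP dirdB !dirdZ linearZ omT dphiT Sy scaler0 sub0r.
  rewrite [X in X - _](_ : _ = diff2 phi y u u); last exact: mulr1.
  have aux (a p q : R) : p - q != 0 -> a - a / (p - q) * p = - (a / (p - q) * q).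
    by move=> pq; field.
  by apply: aux; rewrite gt_eqF.
Qed.

End ConvexGraph.

(** * Translation-invariant and homogeneous functions on a fibre *)

Section FibreConvexity.
Context {R : realType} {n : nat}.
Local Notation E := 'rV[R]_n.
Implicit Types (f g : E -> R^o) (y z u v w T : E).

Lemma dird_shift f y T (s : R) u : (forall z (r : R), f (z + r *: T) = f z) ->
  differentiable f y -> dird f (y + s *: T) u = dird f y u.
Proof.
move=> fT fy; pose L z := z - s *: T.
have Ld : differentiable L (y + s *: T).
  apply: smooth_at_differentiable; apply: smooth_atB; first exact: smooth_at_id.
  exact: smooth_at_cst.
have Ly : L (y + s *: T) = y by rewrite /L addrK.
have fd : differentiable f (L (y + s *: T)) by rewrite Ly.
have fE : (fun z => f (L z)) = f.
  by apply/funext => z; rewrite /L -scaleNr fT.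
rewrite -{1}fE (@dird_comp _ _ _ _ L f)// Ly; congr (dird _ _ _).
rewrite /L dird_sub; last exact: differentiable_cst.
  by rewrite dird_cst subr0 (@dird_lin _ _ _ idfun)// => z; exact: cvg_id.
exact/smooth_at_differentiable/smooth_at_id.
Qed.

(** Smoothness is assumed at [y] only: a squared Finsler norm composed with the projection may be
    singular on the line spanned by [T]. *)
Lemma diff2_shift f y T u v : (forall z (r : R), f (z + r *: T) = f z) ->
  smooth_at f y -> diff2 f y u T = 0 /\ diff2 f y T v = 0.
Proof.
move=> fT fs; split.
  apply: (@dird_shift_invariant _ _ (fun z => dird f z u)).
    exact/smooth_at_differentiable/smooth_at_dird.
  by move=> s; apply: dird_shift => //; exact: smooth_at_differentiable.
have near0 : {near y, (fun _ => 0 : R^o) =1 (fun z => dird f z T : R^o)}.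
  near=> z; apply/esym; apply: dird_shift_invariant => //.
  apply: smooth_at_differentiable; near: z.
  exact: (smooth_at_near fs).
by rewrite /diff2 (dird_eq _ (differentiable_cst _ _) near0) dird_cst.
Unshelve. all: by end_near. Qed.

(** Turns the iterated one-variable derivatives of the fundamental tensor into [diff2]. The inner
    variable [s] goes with [w], whence the order of the arguments on the right. *)
Lemma fundamental_diff2 f y u w : smooth_at f y ->
  derive1 (fun r : R => derive1 (fun s : R => f (y + r *: u + s *: w)) 0) 0 =
  diff2 f y w u.
Proof.
move=> fs.
have l0 : {for (0 : R^o), continuous (fun r : R^o => y + r *: u)}.
  apply: differentiable_continuous; apply: smooth_at_differentiable.
  apply: smooth_atD; first exact: smooth_at_cst.
  by apply: smooth_atZ => //; [exact: smooth_at_id|exact: smooth_at_cst].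
have fn : \forall r \near (0 : R^o), smooth_at f (y + r *: u).
  by apply: l0; rewrite scale0r addr0; exact: (smooth_at_near fs).
rewrite derive1E -(@near_eq_derive _ R^o R^o (fun r : R^o => dird f (y + r *: u) w)).
  have := @is_derive_line _ _ (fun z => dird f z w) y u 0.
  rewrite scale0r addr0 => -[|_ ->] //.
  exact/smooth_at_differentiable/smooth_at_dird.
near=> r; have := @is_derive_line _ _ f (y + r *: u) w 0.
rewrite scale0r addr0 => -[|_ <-]; last by rewrite derive1E.
by apply: smooth_at_differentiable; near: r.
Unshelve. all: by end_near. Qed.

Lemma is_derive_quadratic (a : R) :
  is_derive (0 : R^o) 1 (fun r : R^o => (1 + r) ^+ 2 * a : R^o) (2 * a).
Proof.
have h : is_derive (0 : R^o) 1 (((cst (1 : R^o) + id) ^+ 2 * cst (a : R^o)) : R^o -> R^o)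
  (2 * a).
  by apply: is_derive_eq; rewrite /GRing.scale /= !fctE /=; ring.
have -> : (fun r : R^o => (1 + r) ^+ 2 * a : R^o) =
  (((cst (1 : R^o) + id) ^+ 2 * cst (a : R^o)) : R^o -> R^o) by apply/funext => r.
exact: h.
Qed.

Lemma is_derive_affine (a : R) :
  is_derive (0 : R^o) 1 (fun r : R^o => (1 + r) * a : R^o) a.
Proof.
have h : is_derive (0 : R^o) 1 (((cst (1 : R^o) + id) * cst (a : R^o)) : R^o -> R^o) a.
  by apply: is_derive_eq; rewrite /GRing.scale /= mulr0 !add0r mulr1.
have -> : (fun r : R^o => (1 + r) * a : R^o) =
  (((cst (1 : R^o) + id) * cst (a : R^o)) : R^o -> R^o) by apply/funext => r.
exact: h.
Qed.

Section Homogeneous.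
Variables (K : E -> R^o) (y : E).
Hypothesis K_homogeneous : forall z (l : R), 0 < l -> K (l *: z) = l ^+ 2 * K z.
Hypothesis K_smooth : smooth_at K y.

Let near_pos : \forall r \near (0 : R^o), 0 < 1 + r.
Proof.
near=> r; have : -1 < r; last by lra.
near: r; apply: lt_nbhsr; lra.
Unshelve. all: by end_near. Qed.

(** Euler's identity in degree two: differentiate [K ((1 + r) z) = (1 + r) ^ 2 * K z] at [r = 0]. *)
Lemma euler_dird z : differentiable K z -> dird K z z = 2 * K z.
Proof.
move=> Kd; have := @is_derive_line _ _ K z z 0; rewrite scale0r addr0 => /(_ Kd) [_ <-].
rewrite -(@near_eq_derive _ R^o R^o (fun r : R^o => (1 + r) ^+ 2 * K z : R^o)).
  exact: (@derive_val _ _ _ _ _ _ _ (is_derive_quadratic (K z))).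
near=> r; rewrite -{2}[z]scale1r -scalerDl K_homogeneous//.
by near: r; exact: near_pos.
Unshelve. all: by end_near. Qed.

(** The differential is homogeneous of degree one: differentiate [K z = l ^ 2 * K (l^-1 *: z)] at
    [l *: y]. *)
Let dird_scaled u (l : R) : 0 < l -> dird K (l *: y) u = l * dird K y u.
Proof.
move=> l0; have ln0 : l != 0 by rewrite gt_eqF.
pose L z := l^-1 *: z.
have Ld z : differentiable L z.
  apply: smooth_at_differentiable.
  by apply: smooth_atZ => //; [exact: smooth_at_cst|exact: smooth_at_id].
have Ly : L (l *: y) = y by rewrite /L scalerA mulVf// scale1r.
have KE : (fun z => l ^+ 2 * K (L z) : R^o) = K.
  apply/funext => z; rewrite /L K_homogeneous ?invr_gt0//.
  by rewrite mulrA -exprMn mulfV// expr1n mul1r.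
have Kd : differentiable K y by exact: smooth_at_differentiable.
have KLd : differentiable (fun z => K (L z)) (l *: y).
  by apply: (differentiable_comp (Ld _)); rewrite Ly.
rewrite -{1}KE dird_cstmul// (@dird_comp _ _ _ _ L K)//; last by rewrite Ly.
have -> : dird L (l *: y) u = l^-1 *: u.
  have -> : L = ( *:%R l^-1 : {linear E -> E}) by [].
  by apply: dird_lin => z; exact: scaler_continuous.
by rewrite Ly dirdZ /GRing.scale /= expr2 -mulrA [l * (l^-1 * _)]mulrA mulfV// mul1r.
Qed.

Lemma euler_diff2r u : diff2 K y u y = dird K y u.
Proof.
rewrite /diff2; have := @is_derive_line _ _ (fun z => dird K z u) y y 0; rewrite
  scale0r addr0.
move=> -[|_ <-]; first exact/smooth_at_differentiable/smooth_at_dird.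
rewrite -(@near_eq_derive _ R^o R^o (fun r : R^o => (1 + r) * dird K y u : R^o)).
  exact: (@derive_val _ _ _ _ _ _ _ (is_derive_affine (dird K y u))).
near=> r; rewrite -[X in dird K (X + _)]scale1r -scalerDl dird_scaled//.
by near: r; exact: near_pos.
Unshelve. all: by end_near. Qed.

(** Differentiating [dird K q q = 2 * K q] in [q] produces [dird K y u + diff2 K y y u] on the left
    and [2 * dird K y u] on the right. *)
Lemma euler_diff2l u : diff2 K y y u = dird K y u.
Proof.
have Kd : differentiable K y by exact: smooth_at_differentiable.
have [Dd DE] := dird_apply u K_smooth (smooth_at_differentiable (smooth_at_id y)).
have nearE : {near y, (fun q => dird K q q : R^o) =1 (fun q => 2 * K q : R^o)}.
  near=> q; apply: euler_dird; apply: smooth_at_differentiable.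
  by near: q; exact: (smooth_at_near K_smooth).
have := dird_eq u Dd nearE; rewrite dird_cstmul// DE.
rewrite (@dird_lin _ _ _ idfun) /=; last by move=> z; exact: cvg_id.
lra.
Unshelve. all: by end_near. Qed.

(* Cauchy-Schwarz for the positive semidefinite form [diff2 K y], since
   [diff2 K y u y = dird K y u] and [diff2 K y y y = 2 * K y]. *)
Lemma dird_sqr_le u : (forall w, 0 <= diff2 K y w w) ->
  dird K y u ^+ 2 <= 2 * K y * diff2 K y u u.
Proof.
move=> psd; have Kd : differentiable K y by exact: smooth_at_differentiable.
have q l : 0 <= l ^+ 2 * (2 * K y) + l * (2 * dird K y u) + diff2 K y u u.
  have := psd (l *: y + u).
  rewrite diff2_linearl// !diff2_linearr !euler_diff2r euler_diff2l euler_dird//.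
  by move=> h; apply: (le_trans h); rewrite le_eqVlt; apply/orP; left; apply/eqP; ring.
set a := dird K y u in q *; set d := diff2 K y u u in q *; set k := K y in q *.
have d0 : 0 <= d by have := q 0; rewrite expr0n /= !mul0r !add0r.
have k0 : 0 <= 2 * k by have := psd y; rewrite euler_diff2r euler_dird.
have [k00|kn0] := eqVneq (2 * k) 0.
  rewrite k00 mul0r; have [-> |a0] := eqVneq a 0; first by rewrite expr0n.
  (* With no quadratic term [q] is affine with slope [2 * a]; this point gives it the value -1. *)
  have := q (- (d + 1) / (2 * a)); rewrite k00 mulr0 add0r.
  have -> : - (d + 1) / (2 * a) * (2 * a) = - (d + 1)
    by rewrite divfK// mulf_neq0// pnatr_eq0.
  by move=> h; exfalso; lra.
have kp : 0 < 2 * k by rewrite lt_neqAle eq_sym kn0.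
(* The minimum of the quadratic polynomial, where nonnegativity is the discriminant inequality. *)
have := q (- a / (2 * k)).
have -> : (- a / (2 * k)) ^+ 2 * (2 * k) + - a / (2 * k) * (2 * a) + d =
  (2 * k * d - a ^+ 2) / (2 * k).
  by field; apply: contraNneq kn0 => ->; rewrite mulr0.
by rewrite pmulr_lge0 ?invr_gt0// subr_ge0.
Qed.

End Homogeneous.
End FibreConvexity.

(** * Operations that preserve convexity and the radial condition *)

Section ConvexAt.
Context {R : realType} {n : nat}.
Local Notation E := 'rV[R]_n.
Implicit Types (f g : E -> R^o) (y z u v w T : E).

Lemma diff2_add f g y u v : smooth_at f y -> smooth_at g y ->
  diff2 (fun z => f z + g z : R^o) y u v = diff2 f y u v + diff2 g y u v.
Proof.
move=> fs gs; have fd := smooth_at_differentiable (smooth_at_dird u fs).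
have gd := smooth_at_differentiable (smooth_at_dird u gs).
rewrite /diff2 -dird_add//; apply: dird_eq; first exact: differentiableD.
near=> z; apply/esym/dird_add; apply: smooth_at_differentiable; near: z.
  exact: (smooth_at_near fs).
exact: (smooth_at_near gs).
Unshelve. all: by end_near. Qed.

Lemma diff2_cstmul (a : R) f y u v : smooth_at f y ->
  diff2 (fun z => a * f z : R^o) y u v = a * diff2 f y u v.
Proof.
move=> fs; have fd := smooth_at_differentiable (smooth_at_dird u fs).
rewrite /diff2 -dird_cstmul//; apply: dird_eq; first exact: differentiableZ.
near=> z; apply/esym/dird_cstmul; apply: smooth_at_differentiable; near: z.
exact: (smooth_at_near fs).
Unshelve. all: by end_near. Qed.

Lemma dird_real_comp (g : R^o -> R^o) (a : R) f y u :
  differentiable f y -> is_derive (f y) 1 g a ->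
  dird (fun z => g (f z) : R^o) y u = a * dird f y u.
Proof.
move=> fd gd; rewrite (@dird_comp _ _ _ _ f g)//.
  by rewrite (is_derive_dird _ gd) mulrC.
by apply/derivable1_diffP; case: gd.
Qed.

Lemma diff2_real_comp (g g1 : R^o -> R^o) (a : R) f y u : smooth_at f y ->
  (\forall t \near f y, is_derive (t : R^o) 1 g (g1 t)) -> is_derive (f y) 1 g1 a ->
  diff2 (fun z => g (f z) : R^o) y u u =
    g1 (f y) * diff2 f y u u + a * dird f y u ^+ 2.
Proof.
move=> fs gn g1d; have fd := smooth_at_differentiable fs.
have fn : \forall z \near y, is_derive (f z : R^o) 1 g (g1 (f z)).
  exact: (smooth_at_continuous fs gn).
have dd := smooth_at_differentiable (smooth_at_dird u fs).
have g1d' : differentiable g1 (f y) by apply/derivable1_diffP; case: g1d.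
have g1fd : differentiable (fun z => g1 (f z) : R^o) y.
  exact: (differentiable_comp fd g1d').
have nearE : {near y, (fun z => g1 (f z) * dird f z u : R^o) =1
    (fun z => dird (fun z => g (f z) : R^o) z u : R^o)}.
  near=> z; apply/esym/dird_real_comp.
    by apply: smooth_at_differentiable; near: z; exact: (smooth_at_near fs).
  by near: z.
rewrite {1}/diff2 (dird_eq _ (differentiableM g1fd dd) nearE) dird_mul//.
rewrite (dird_real_comp _ fd g1d) -/(diff2 f y u u); congr (_ + _).
by rewrite expr2 mulrCA.
Unshelve. all: by end_near. Qed.

(* The conditions under which the graph of [f] is transverse to the position
   vector and strongly convex with respect to it at [y]. *)
Definition convex_at (om : E -> R) f y :=
  [/\ smooth_at f y, forall u, om u = 0 -> u != 0 -> 0 < diff2 f y u u &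
     dird f y y < f y].

Lemma convex_at_eq (om : E -> R) f g y : {near y, f =1 g} ->
  convex_at om f y -> convex_at om g y.
Proof.
move=> fg [fs fc fr]; have gs := smooth_at_eq fg fs.
have fd := smooth_at_differentiable fs.
have fgy : f y = g y by exact: (nbhs_singleton fg).
split=> //; last by rewrite (dird_eq _ fd fg) -fgy.
move=> u u0 un0; rewrite /diff2.
have nearE : {near y, (fun z => dird f z u : R^o) =1 (fun z => dird g z u : R^o)}.
  have fg' : \forall z \near y, {near z, f =1 g} by exact: near_join.
  near=> z; apply/esym/dird_eq; last by near: z.
  by apply: smooth_at_differentiable; near: z; exact: (smooth_at_near fs).
rewrite (dird_eq _ _ nearE); first exact: fc.
exact/smooth_at_differentiable/smooth_at_dird.
Unshelve. all: by end_near. Qed.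

Lemma convex_at_comb (om : E -> R) f g y (a : R) : 0 < a < 1 ->
  convex_at om f y -> convex_at om g y ->
  convex_at om (fun z => a * f z + (1 - a) * g z : R^o) y.
Proof.
move=> /andP[a0 a1] [fs fc fr] [gs gc gr].
have afs : smooth_at (fun z => a * f z : R^o) y.
  by apply: smooth_atM => //; exact: smooth_at_cst.
have ags : smooth_at (fun z => (1 - a) * g z : R^o) y.
  by apply: smooth_atM => //; exact: smooth_at_cst.
have b0 : 0 < 1 - a by lra.
split.
- exact: smooth_atD.
- move=> u u0 un0; rewrite diff2_add// !diff2_cstmul//.
  by apply: addr_gt0; apply: mulr_gt0 => //; [exact: fc|exact: gc].
- rewrite dird_add; [|exact: smooth_at_differentiable..].
  rewrite !dird_cstmul; [|exact: smooth_at_differentiable..].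
  by apply: ltrD; rewrite ltr_pM2l.
Qed.

(** With [t = th1 (h - q)] in [0, 1], the second derivative is [(1 - t) D^2 q + t D^2 h] plus [th2]
    times a square, hence positive. The radial condition combines with the same weights, up to an
    error that convexity of [th] controls. *)
Lemma convex_at_max (om : E -> R) (th th1 th2 : R^o -> R^o) (q h : E -> R^o) y :
  (forall x, smooth_at th x) ->
  (forall x : R^o, is_derive x 1 th (th1 x) /\ is_derive x 1 th1 (th2 x)) ->
  (forall x, 0 <= th1 x <= 1 /\ 0 <= th2 x) ->
  (forall x, 0 <= th x /\ x <= th x) ->
  convex_at om q y -> convex_at om h y ->
  convex_at om (fun z => q z + th (h z - q z) : R^o) y.
Proof.
move=> ths thd th12 thm [qs qc qr] [hs hc hr].
have hqs : smooth_at (fun z => h z - q z : R^o) y by exact: smooth_atB.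
have thqs : smooth_at (fun z => th (h z - q z) : R^o) y by exact: smooth_at_comp.
have [d1 d2] := thd (h y - q y).
have [/andP[t0 t1] t2] := th12 (h y - q y).
have [m0 m1] := thm (h y - q y).
have hqd := smooth_at_differentiable hqs.
have hqE u : diff2 (fun z => h z - q z : R^o) y u u = diff2 h y u u - diff2 q y u u.
  have -> : (fun z => h z - q z : R^o) = (fun z => h z + (-1) * q z : R^o).
    by apply/funext => z; rewrite mulN1r.
  rewrite diff2_add//; last by apply: smooth_atM => //; exact: smooth_at_cst.
  by rewrite diff2_cstmul// mulN1r.
split; first exact: smooth_atD.
- move=> u u0 un0; rewrite diff2_add// (@diff2_real_comp th th1 _ (fun z => h z - q z)
    _ _ hqs _ d2).
    rewrite hqE; have := qc u u0 un0; have := hc u u0 un0.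
    set a := diff2 h y u u; set b := diff2 q y u u; set c := dird _ _ _.
    move=> a0 b0; have c0 : 0 <= th2 (h y - q y) * c ^+ 2.
      by rewrite mulr_ge0// sqr_ge0.
    move: t0 t1 c0; set t := th1 _; set cc := _ * c ^+ 2 => t0 t1 c0.
    suff : 0 < b + t * (a - b) by lra.
    have [->|tn0] := eqVneq t 0; first by lra.
    have tp : 0 < t by rewrite lt_neqAle eq_sym tn0.
    have : 0 < t * a by exact: mulr_gt0.
    have : 0 <= (1 - t) * b by apply: mulr_ge0; lra.
    lra.
  by near=> t; case: (thd t).
- rewrite dird_add; [|exact: smooth_at_differentiable..].
  rewrite (@dird_real_comp th _ (fun z => h z - q z) _ _ hqd d1).
  rewrite dird_sub; [|exact: smooth_at_differentiable..].
  move: t0 t1 m0 m1; set t := th1 _; set m := th _.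
  move: qr hr; set a := dird q y y; set b := dird h y y => qr hr t0 t1 m0 m1.
  (* As [t] is in [0, 1], [t * s] is at most the positive part of [s], which [th] dominates. *)
  have e1 : t * (h y - q y) <= m.
    have [s0|s0] := leP 0 (h y - q y).
      by apply: le_trans m1; rewrite -[leRHS]mul1r ler_wpM2r.
    by apply: le_trans m0; rewrite mulr_ge0_le0// ltW.
  have [->|tn0] := eqVneq t 0; first by lra.
  have tp : 0 < t by rewrite lt_neqAle eq_sym tn0.
  have : t * b < t * h y by rewrite ltr_pM2l.
  have : (1 - t) * a <= (1 - t) * q y by apply: ler_wpM2l; lra.
  lra.
Unshelve. all: by end_near. Qed.

(** With [H ^ 2 = c + K], the second derivative is [(2 H^2 D^2 K (u, u) - dK(u)^2) / (4 H^3)]; by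
    Cauchy-Schwarz the numerator is at least [2 c D^2 K (u, u)]. Radially, Euler's identity gives
    [K / H < H]. The lemma serves both the indicatrix and the quadrics. *)
Lemma convex_at_sqrt (om : {linear E -> R^o}) T (K : E -> R^o) (c : R) y :
  om T = 1 -> 0 < c ->
  (forall z (l : R), 0 < l -> K (l *: z) = l ^+ 2 * K z) ->
  (forall z (r : R), K (z + r *: T) = K z) ->
  smooth_at K y -> 0 <= K y ->
  (forall u, om u = 0 -> u != 0 -> 0 < diff2 K y u u) ->
  convex_at om (fun z => Num.sqrt (c + K z) : R^o) y.
Proof.
move=> omT c0 Kh KT Ks K0 Kpd.
(* Cauchy-Schwarz is applied between [u] and [y], and [y] need not lie in [ker om]; since [T] is
   null, semidefiniteness extends to all vectors. *)
have psd w : 0 <= diff2 K y w w.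
  have wE : w = om w *: T + (w - om w *: T) by rewrite addrC subrK.
  have om0 : om (w - om w *: T) = 0.
    by rewrite linearB linearZ /= omT [_ *: 1]mulr1 subrr.
  set v := w - _ in wE om0.
  have [e1 _] := diff2_shift w 0 KT Ks; have [_ e2] := diff2_shift 0 v KT Ks.
  rewrite [X in diff2 K y _ X]wE diff2_linearr e1 mulr0 add0r.
  rewrite wE diff2_linearl// e2 mulr0 add0r.
  have [->|v0] := eqVneq v 0; last by apply/ltW/Kpd.
  by rewrite /diff2 dird0.
have Kd := smooth_at_differentiable Ks.
have cKs : smooth_at (fun z => c + K z : R^o) y.
  by apply: smooth_atD => //; exact: smooth_at_cst.
have cK0 : 0 < c + K y by lra.
have cK2 u v : diff2 (fun z => c + K z : R^o) y u v = diff2 K y u v.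
  rewrite diff2_add//; last exact: smooth_at_cst.
  rewrite {1}/diff2; have -> : (fun z => dird (fun _ : E => c : R^o) z u) = fun _ => 0.
    by apply/funext => z; rewrite dird_cst.
  by rewrite dird_cst add0r.
have cK1 u : dird (fun z => c + K z : R^o) y u = dird K y u.
  by rewrite dird_add; [rewrite dird_cst add0r|exact: differentiable_cst|].
set H := Num.sqrt (c + K y).
have H0 : 0 < H by rewrite sqrtr_gt0.
have HH : H ^+ 2 = c + K y by rewrite sqr_sqrtr// ltW.
have d1 (t : R^o) : 0 < t -> is_derive t 1 (Num.sqrt : R^o -> R^o) ((2 * Num.sqrt t)^-1).
  exact: is_derive1_sqrt.
have d2 : is_derive (c + K y : R^o) 1 (fun t : R^o => (2 * Num.sqrt t)^-1 : R^o)
    (- (2 * H)^-1 ^+ 2 * (2 * (2 * H)^-1)).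
  have i1 : is_derive (c + K y : R^o) 1 (fun t : R^o => 2 * Num.sqrt t : R^o) (2 * (2 *
    H)^-1).
    exact: (@is_deriveZ R R^o R^o Num.sqrt 2 (c + K y) 1 _ (d1 _ cK0)).
  have n0 : 2 * Num.sqrt (c + K y) != 0 by rewrite mulf_neq0// gt_eqF.
  apply: (is_derive_eq (@is_deriveV R (fun t => 2 * Num.sqrt t) (c + K y) _ 1 n0 i1)).
  by rewrite exprVn.
split.
- by apply: (@smooth_at_comp _ _ _ _ _ (Num.sqrt : R^o -> R^o)) => //; exact:
    smooth_at_sqrt.
- move=> u u0 un0.
  rewrite (@diff2_real_comp Num.sqrt _ _ (fun z => c + K z) _ _ cKs _ d2); last first.
    by near=> t; apply: d1; near: t; exact: lt_nbhsr.
  rewrite cK2 cK1 -/H; have := dird_sqr_le Kh Ks u psd; have := Kpd u u0 un0.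
  set a := diff2 _ _ _ _; set b := dird _ _ _ => a0 ab.
  have -> : (2 * H)^-1 * a + - (2 * H)^-1 ^+ 2 * (2 * (2 * H)^-1) * b ^+ 2 =
    (2 * H ^+ 2 * a - b ^+ 2) / (4 * H ^+ 3).
    by field; rewrite gt_eqF.
  apply: divr_gt0; last by rewrite mulr_gt0// exprn_gt0.
  rewrite HH; have : 0 < c * a by exact: mulr_gt0.
  lra.
- rewrite (@dird_real_comp Num.sqrt _ (fun z => c + K z) _ _ (smooth_at_differentiable
    cKs) (d1 _ cK0)).
  rewrite cK1 (euler_dird Kh)// -/H.
  have -> : (2 * H)^-1 * (2 * K y) = K y / H by field; rewrite gt_eqF.
  by rewrite ltr_pdivrMr// -expr2 HH; lra.
Unshelve. all: by end_near. Qed.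

End ConvexAt.

(** * The indicatrix in bundle charts *)

Section BundleCharts.
Context {R : realType} {n : nat} {M : smoothManifold R n}.
Local Notation E := 'rV[R]_n.
Implicit Types (p : M) (c d : atlas M).

Lemma tcoordP p c (a : R) (u v : tangent p) :
  tcoord c (a *: u + v) = a *: tcoord c u + tcoord c v.
Proof. by []. Qed.

Lemma tcoordB p c (u v : tangent p) : tcoord c (u - v) = tcoord c u - tcoord c v.
Proof. by []. Qed.

Lemma tvecP p c (a : R) (x y : E) : cdom c p ->
  tvec p c (a *: x + y) = a *: tvec p c x + tvec p c y.
Proof.
by move=> cp; apply: (tcoord_inj cp); rewrite tcoordP !tcoord_tvec.
Qed.

Lemma tvecZ p c (a : R) (x : E) : cdom c p -> tvec p c (a *: x) = a *: tvec p c x.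
Proof.
by move=> cp; apply: (tcoord_inj cp); rewrite -[a *: tvec _ _ _]addr0 tcoordP
  !tcoord_tvec// addr0.
Qed.

Lemma tvecB p c (x y : E) : cdom c p -> tvec p c (x - y) = tvec p c x - tvec p c y.
Proof. by move=> cp; apply: (tcoord_inj cp); rewrite tcoordB !tcoord_tvec. Qed.

Lemma bundle_cinvE p c (y : E) : cdom c p ->
  bundle_cinv c (cmap c p, y) = TVec p (tvec p c y).
Proof. by move=> cp; rewrite /bundle_cinv /=; rewrite cmapK. Qed.

Lemma cimg_cmap p c : cdom c p -> cimg c (cmap c p).
Proof. by exists p. Qed.

Lemma cdom_cinv c (x : E) : cimg c x -> cdom c (cinv c x) /\ cmap c (cinv c x) = x.
Proof. by move=> [p cp <-]; rewrite cmapK. Qed.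

Lemma near_cimg c (x : E) : cimg c x -> \forall y \near x, cimg c y.
Proof. by move=> cx; apply: open_nbhs_nbhs; split => //; exact: cimg_open. Qed.

Lemma near_cimg1 c (xy : E * E) : cimg c xy.1 -> \forall z \near xy, cimg c z.1.
Proof. by move=> /near_cimg cx; exact: (cvg_fst cx). Qed.

Lemma near_bundle_cinv c (xy : E * E) (P : set (tangentBundle M)) :
  cimg c xy.1 -> nbhs (bundle_cinv c xy) P ->
  \forall z \near xy, P (bundle_cinv c z).
Proof.
move=> cx; rewrite nbhsE => -[B [Bo Bxy] BP].
have : nbhs xy (in_chart c B) by apply: open_nbhs_nbhs; split=> //; exact: Bo.
by apply: filterS => z [_] /BP.
Qed.

Definition base_smooth_at (f : M -> R) p :=
  forall c, cdom c p -> smooth_at (fun x => f (cinv c x) : R^o) (cmap c p).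

Definition bundle_smooth_at (g : tangentBundle M -> R) p (v : tangent p) :=
  forall c, cdom c p ->
    smooth_at (fun xy => g (bundle_cinv c xy) : R^o) (cmap c p, tcoord c v).

Lemma bundle_smooth_atP (g : tangentBundle M -> R) c (xy : E * E) : cimg c xy.1 ->
  (forall p (v : tangent p), bundle_smooth_at g v) ->
  smooth_at (fun xy => g (bundle_cinv c xy) : R^o) xy.
Proof.
case: xy => x y /= [p cp <-] gs; have := gs p (tvec p c y) c cp.
by rewrite tcoord_tvec.
Qed.

Lemma fibre_smooth_at (g : tangentBundle M -> R) p c (y : E) : cdom c p ->
  bundle_smooth_at g (tvec p c y) ->
  smooth_at (fun z => g (TVec p (tvec p c z)) : R^o) y.
Proof.
move=> cp /(_ c cp); rewrite tcoord_tvec// => gs.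
have -> : (fun z => g (TVec p (tvec p c z)) : R^o) =
    (fun z : E => g (bundle_cinv c (cmap c p, z)) : R^o).
  by apply/funext => z; rewrite bundle_cinvE.
apply: (@smooth_at_comp _ _ _ _ (fun z : E => (cmap c p, z))
  (fun xy => g (bundle_cinv c xy) : R^o)) => //.
by apply: smooth_at_pair; [exact: smooth_at_cst|exact: smooth_at_id].
Qed.

End BundleCharts.

Section ConeTriple.
Context {R : realType} {n : nat} {M : smoothManifold R n}.
Local Notation E := 'rV[R]_n.
Variables (Omega : forall p : M, {scalar tangent p}) (T : forall p : M, tangent p)
  (F : tangentBundle M -> R).
Hypothesis hcone : cone_triple Omega T F.
Implicit Types (p : M) (c d : atlas M).

Definition kproj (v : tangentBundle M) : tangentBundle M :=
  TVec (tbase v) (tvect v - Omega _ (tvect v) *: T (tbase v)).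

(** Composing with the projection extends [F ^ 2] from ker Omega to TM as a function invariant along
    [T]. *)
Definition ksqr (v : tangentBundle M) : R := F (kproj v) ^+ 2.

(* [t = height w] is the equation of the indicatrix [t^2 - F(w)^2 = 1], t > 0. *)
Definition height (v : tangentBundle M) : R := Num.sqrt (1 + ksqr v).

Definition comega c (xy : E * E) : R := Omega _ (tvect (bundle_cinv c xy)).

Definition cfield c (x : E) : E := tcoord c (T (cinv c x)).

Definition ckproj c (xy : E * E) : E * E := (xy.1, xy.2 - comega c xy *: cfield c xy.1).

Lemma OmegaT p : Omega _ (T p) = 1. Proof. exact: (cone_form_field hcone). Qed.

Lemma Omega_kproj v : Omega _ (tvect (kproj v)) = 0.
Proof.
by case: v => p v; rewrite /kproj /= linearB linearZ /= OmegaT mulr1 subrr.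
Qed.

Lemma kproj_shift p (v : tangent p) (s : R) :
  kproj (TVec p (v + s *: T p)) = kproj (TVec p v).
Proof.
have e : Omega p (v + s *: T p) = Omega p v + s.
  by rewrite linearD linearZ /= OmegaT mulr1.
rewrite /kproj /= e; congr TVec.
by rewrite scalerDl opprD addrACA subrr addr0.
Qed.

Lemma kproj_ker p (v : tangent p) : Omega _ v = 0 -> kproj (TVec p v) = TVec p v.
Proof. by rewrite /kproj /= => ->; rewrite scale0r subr0. Qed.

Lemma kproj_decomp p (v : tangent p) :
  v = Omega _ v *: T p + tvect (kproj (TVec p v)).
Proof. by rewrite /kproj /= addrC subrK. Qed.

Lemma kprojZ p (v : tangent p) (l : R) :
  kproj (TVec p (l *: v)) = TVec p (l *: tvect (kproj (TVec p v))).
Proof.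
have e : Omega p (l *: v) = l * Omega p v by rewrite linearZ.
by rewrite /kproj /= e scalerBr scalerA.
Qed.

Lemma kernel_kproj v : kernel_bundle Omega (kproj v).
Proof. exact: Omega_kproj. Qed.

(** [smooth_form] speaks of vectors with constant coordinates; the expansion makes Omega jointly
    smooth in the base point and the vector. *)
Lemma comegaE c x y : cimg c x ->
  comega c (x, y) = \sum_i y 0 i * Omega _ (tvec (cinv c x) c (delta_mx 0 i)).
Proof.
move=> cx; have [cp _] := cdom_cinv cx.
pose L (z : E) : R^o := Omega _ (tvec (cinv c x) c z).
have Ll : linear L by move=> a u v; rewrite /L tvecP// linearP.
pose LL : {linear E -> R^o} := HB.pack L (GRing.isLinear.Build _ _ _ _ L Ll).
have -> : comega c (x, y) = LL y by [].
rewrite [in LHS](row_sum_delta y) linear_sum.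
by apply: eq_bigr => i _; rewrite linearZ.
Qed.

Lemma smooth_at_comega c xy : cimg c xy.1 -> smooth_at (comega c : _ -> R^o) xy.
Proof.
case: xy => x y /= cx.
have s : smooth_at (fun xy : E * E =>
    \sum_i (xy.2 0 i : R^o) * Omega _ (tvec (cinv c xy.1) c (delta_mx 0 i)) : R^o) (x, y).
  apply: smooth_at_sum => i; apply: smooth_atM.
    by apply: smooth_at_mxE; exact: smooth_at_snd.
  apply: (@smooth_at_comp _ _ _ _ fst
    (fun x : E => Omega _ (tvec (cinv c x) c (delta_mx 0 i)) : R^o)) => //.
    exact: smooth_at_fst.
  apply: (smooth_on_at (@cimg_open _ _ _ c) cx).
  exact: (cone_form_smooth hcone).
apply: smooth_at_eq s; near=> z; have cz : cimg c z.1 by near: z; exact: near_cimg1.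
by rewrite [z in RHS]surjective_pairing comegaE.
Unshelve. all: by end_near. Qed.

Lemma smooth_at_cfield c x : cimg c x -> smooth_at (cfield c) x.
Proof.
move=> cx; apply: (smooth_on_at (@cimg_open _ _ _ c) cx).
exact: (cone_field_smooth hcone).
Qed.

Lemma smooth_at_ckproj c xy : cimg c xy.1 -> smooth_at (ckproj c) xy.
Proof.
move=> cx; apply: smooth_at_pair; first exact: smooth_at_fst.
apply: smooth_atB; first exact: smooth_at_snd.
apply: smooth_atZ => //; first exact: smooth_at_comega.
apply: (@smooth_at_comp _ _ _ _ fst (cfield c)) => //; first exact: smooth_at_fst.
exact: smooth_at_cfield.
Qed.

Lemma ckprojE c xy : cimg c xy.1 -> bundle_cinv c (ckproj c xy) = kproj (bundle_cinv c xy).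
Proof.
move=> cx; have [cp _] := cdom_cinv cx; rewrite /bundle_cinv /kproj /=.
by congr TVec; rewrite tvecB// tvecZ// /cfield tvec_tcoord.
Qed.

Lemma near_ckproj c xy (P : set (tangentBundle M)) : cimg c xy.1 ->
  nbhs (kproj (bundle_cinv c xy)) P ->
  \forall z \near xy, P (kproj (bundle_cinv c z)).
Proof.
move=> cx; rewrite -ckprojE// => hP.
have nP := @near_bundle_cinv _ _ _ c (ckproj c xy) P cx hP.
have nP' := smooth_at_continuous (smooth_at_ckproj cx) nP.
near=> z; rewrite -ckprojE; first by near: z.
by near: z; exact: near_cimg1.
Unshelve. all: by end_near. Qed.

(** [F] is continuous along ker Omega only, but [kproj] takes its values there, so the composite is
    continuous without restriction. *)
Lemma continuous_F_chart c xy : cimg c xy.1 ->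
  {for xy, continuous (fun z => F (kproj (bundle_cinv c z)) : R^o)}.
Proof.
move=> cx W FW; have /subspace_continuousP := finsler_continuous (cone_finsler hcone).
move=> /(_ _ (kernel_kproj (bundle_cinv c xy)) W FW) /(near_ckproj cx) h.
by apply: filterS h => z; apply; exact: kernel_kproj.
Qed.

(** [F] is smooth through a local extension [g] to an open set of TM, which agrees with it on
    nonzero kernel vectors. Composed with the projection, [g] and [F] therefore coincide near
    [v]. *)
Lemma bundle_smooth_ksqr p (v : tangent p) : tvect (kproj (TVec p v)) != 0 ->
  bundle_smooth_at ksqr v.
Proof.
move=> v0 c cp; have cx := cimg_cmap cp; set xy := (_, _).
have xyE : bundle_cinv c xy = TVec p v by rewrite bundle_cinvE// tvec_tcoord.
have kE : [set v | kernel_bundle Omega v /\ tvect v != 0] (kproj (bundle_cinv c xy)).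
  by rewrite xyE; split=> //; exact: kernel_kproj.
have [B [g [[Bo Bv] gs Fg]]] := finsler_smooth (cone_finsler hcone) kE.
have Bxy : in_chart c B (ckproj c xy).
  by split=> //; rewrite ckprojE.
have gks : smooth_at (fun z => g (bundle_cinv c (ckproj c z)) : R^o) xy.
  apply: (@smooth_at_comp _ _ _ _ (ckproj c) (fun z => g (bundle_cinv c z) : R^o)) => //.
    exact: smooth_at_ckproj.
  exact: (smooth_on_at (Bo c) Bxy (gs c)).
(* The projection has to stay nonzero nearby, as [F] and [g] are compared off the zero section
   only. *)
have k0 : \forall z \near xy, (ckproj c z).2 != 0.
  have c2 : {for xy, continuous (fun z => (ckproj c z).2)}.
    apply: smooth_at_continuous.
    apply: (@smooth_at_comp _ _ _ _ (ckproj c) snd) => //; last exact: smooth_at_snd.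
    exact: smooth_at_ckproj.
  have : nbhs (ckproj c xy).2 [set w : E | w != 0].
    apply: open_nbhs_nbhs; split.
      have -> : [set w : E | w != 0] = ~` [set 0].
        by apply/seteqP; split=> w /= /eqP.
      apply: closed_openC; apply: accessible_closed_set1.
      by apply: hausdorff_accessible; exact: norm_hausdorff.
    apply: contra_neq v0 => k0; rewrite -xyE.
    have -> : kproj (bundle_cinv c xy) =
        TVec (cinv c xy.1) (tvec (cinv c xy.1) c (ckproj c xy).2).
      by rewrite -ckprojE.
    rewrite k0 /=.
    by rewrite -(scale0r (0 : E)) tvecZ ?scale0r//; have [] := cdom_cinv cx.
  exact: c2.
apply: smooth_at_eq (smooth_atM gks gks); near=> z.
have cz : cimg c z.1 by near: z; exact: near_cimg1.
rewrite /ksqr expr2 -Fg ?ckprojE//.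
- by near: z; apply: near_ckproj => //; apply: open_nbhs_nbhs.
- split; first exact: kernel_kproj.
  have [cpz _] := cdom_cinv cz.
  have : (ckproj c z).2 != 0 by near: z.
  apply: contraNneq => z0; have := congr1 (tcoord c) z0.
  by rewrite -ckprojE// /= tcoord_tvec// => ->.
Unshelve. all: by end_near. Qed.

Lemma F0 p : F (TVec p 0) = 0.
Proof.
have D0 : kernel_bundle Omega (TVec p 0) by rewrite /kernel_bundle /= linear0.
(* Homogeneity with factor 2 at the zero vector reads [F 0 = 2 * F 0]. *)
have := finsler_homogeneous (cone_finsler hcone) D0 (ltr0n R 2).
by rewrite scaler0; lra.
Qed.

Lemma ksqr_ge0 v : 0 <= ksqr v.
Proof. exact: sqr_ge0. Qed.

Lemma ksqrZ p (v : tangent p) (l : R) : 0 < l ->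
  ksqr (TVec p (l *: v)) = l ^+ 2 * ksqr (TVec p v).
Proof.
move=> l0; rewrite /ksqr kprojZ -exprMn; congr (_ ^+ 2).
exact: (finsler_homogeneous (cone_finsler hcone) (kernel_kproj (TVec p v)) l0).
Qed.

Lemma height_ge1 v : 1 <= height v.
Proof.
by rewrite -[leLHS]sqrtr1; apply: ler_wsqrtr; rewrite lerDl ksqr_ge0.
Qed.

Lemma kproj0_ksqr v : tvect (kproj v) = 0 -> ksqr v = 0.
Proof.
move=> v0; have -> : ksqr v = F (TVec (tbase v) 0) ^+ 2 by rewrite -v0.
by rewrite F0 expr0n.
Qed.

Definition fibre_fun (g : tangentBundle M -> R) p c (y : E) : R^o :=
  g (TVec p (tvec p c y)).

Section Fibre.
Variables (p : M) (c : atlas M).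
Hypothesis cp : cdom c p.

Definition fomega (y : E) : R^o := Omega p (tvec p c y).

Fact fomega_linear : linear fomega.
Proof. by move=> a u v; rewrite /fomega tvecP// linearP. Qed.

Definition fomega_lin : {linear E -> R^o} :=
  HB.pack fomega (GRing.isLinear.Build _ _ _ _ fomega fomega_linear).

Definition ffield : E := tcoord c (T p).

Lemma fomega_field : fomega ffield = 1.
Proof. by rewrite /fomega /ffield tvec_tcoord// OmegaT. Qed.

Lemma tvec_shift (y : E) (s : R) : tvec p c (y + s *: ffield) = tvec p c y + s *: T p.
Proof. by rewrite addrC tvecP// /ffield tvec_tcoord// addrC. Qed.

(** Adding multiples of [u] in ker Omega translates the projection by the same vectors, so the
    second derivative of [ksqr] along [u] is that of [F ^ 2] at the projected point. *)
Lemma fibre_ksqr_pos_def (y u : E) : tvect (kproj (TVec p (tvec p c y))) != 0 ->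
  fomega u = 0 -> u != 0 -> 0 < diff2 (fibre_fun ksqr p c) y u u.
Proof.
set v' := tvect _ => v0 u0 un0.
have Ks : smooth_at (fibre_fun ksqr p c) y.
  by apply: fibre_smooth_at => //; exact: bundle_smooth_ksqr.
have tu0 : tvec p c u != 0.
  by apply: contraNneq un0 => /(congr1 (tcoord c)); rewrite tcoord_tvec// => ->.
have := finsler_pos_def (cone_finsler hcone) (kernel_kproj (TVec p (tvec p c y))) v0 u0 tu0.
rewrite /fundamental_tensor pmulr_rgt0 ?invr_gt0//.
have -> : (fun r : R => derive1 (fun s : R =>
    F (TVec p (v' + r *: tvec p c u + s *: tvec p c u)) ^+ 2) 0) =
  (fun r : R => derive1 (fun s : R => fibre_fun ksqr p c (y + r *: u + s *: u)) 0).
  apply/funext => r; congr (derive1 _ 0); apply/funext => s.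
  rewrite /fibre_fun /ksqr [y + _ + _]addrC tvecP// [y + _]addrC tvecP//.
  congr (F _ ^+ 2).
  set w := tvec p c u in u0 *; set vy := tvec p c y in v' v0 *.
  have e : Omega p (s *: w + (r *: w + vy)) = Omega p vy.
    have w0 : Omega p w = 0 by [].
    by rewrite !linearD !linearZ /= w0 !mulr0 !add0r.
  rewrite /kproj /= e /v' /kproj /=; congr TVec.
  have aux (x a b d : tangent p) : x - a + b + d = d + (b + x) - a.
    by rewrite [d + _]addrC [b + x]addrC [x - a + b]addrAC [_ - a + d]addrAC.
  exact: aux.
by rewrite fundamental_diff2.
Qed.

Lemma convex_at_height (y : E) : tvect (kproj (TVec p (tvec p c y))) != 0 ->
  convex_at fomega (fibre_fun height p c) y.
Proof.
move=> v0; apply: (@convex_at_sqrt _ _ fomega_lin ffield (fibre_fun ksqr p c) 1).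
- exact: fomega_field.
- by [].
- by move=> z l l0; rewrite /fibre_fun tvecZ// ksqrZ.
- by move=> z r; rewrite /fibre_fun tvec_shift /ksqr kproj_shift.
- by apply: fibre_smooth_at => //; exact: bundle_smooth_ksqr.
- exact: ksqr_ge0.
- by move=> u u0 un0; exact: fibre_ksqr_pos_def.
Qed.

End Fibre.

End ConeTriple.

(** * Gluing *)

Section Gluing.
Context {R : realType} {n : nat} {M : smoothManifold R n}.
Local Notation E := 'rV[R]_n.
Variables (Omega : forall p : M, {scalar tangent p}) (T : forall p : M, tangent p)
  (F : tangentBundle M -> R) (U : set (tangentBundle M)).
Local Notation heightF := (height Omega T F).
Local Notation kprojF := (kproj Omega T).
Implicit Types (p : M) (c : atlas M) (Phi Psi : tangentBundle M -> R).

(* The graph [Omega v = Phi v] over ker Omega_p satisfies the conclusions of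
   the theorem in T_pM. *)
Definition admissible Phi p : Prop :=
  [/\ forall (v : tangent p) (s : R), Phi (TVec p (v + s *: T p)) = Phi (TVec p v),
      forall c, cdom c p -> forall y, convex_at (fomega Omega p c) (fibre_fun Phi p c) y,
      forall v : tangent p,
        heightF (TVec p v) <= Phi (TVec p v) <= heightF (TVec p v) + 1 &
      forall v : tangent p, Phi (TVec p v) != heightF (TVec p v) -> forall t,
        heightF (TVec p v) <= t <= Phi (TVec p v) ->
        U (TVec p (t *: T p + tvect (kprojF (TVec p v))))].

Lemma admissible_ext Phi Psi p :
  (forall v : tangent p, Phi (TVec p v) = Psi (TVec p v)) ->
  admissible Phi p -> admissible Psi p.
Proof.
move=> e [h1 h2 h3 h4]; split.
- by move=> v s; rewrite -!e.
- move=> c cp y; have -> : fibre_fun Psi p c = fibre_fun Phi p c.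
    by apply/funext => z; rewrite /fibre_fun e.
  exact: h2.
- by move=> v; rewrite -e.
- by move=> v; rewrite -e; exact: h4.
Qed.

(** A combination never exceeds the larger of the two values, whose segment down to the indicatrix
    already lies in [U]. This is why admissibility asks for the whole segment and not only for its
    upper end. *)
Lemma admissible_comb Phi Psi p (a : R) : 0 < a < 1 ->
  admissible Phi p -> admissible Psi p ->
  admissible (fun v => a * Phi v + (1 - a) * Psi v) p.
Proof.
move=> a01 [h1 h2 h3 h4] [g1 g2 g3 g4]; have /andP[a0 a1] := a01; split.
- by move=> v s; rewrite h1 g1.
- by move=> c cp y; exact: (convex_at_comb a01 (h2 c cp y) (g2 c cp y)).
- move=> v; have /andP[] := h3 v; have /andP[] := g3 v.
  set H := heightF _; set x := Phi _; set y := Psi _ => y0 y1 x0 x1.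
  by apply/andP; split; nra.
- move=> v; have /andP[] := h3 v; have /andP[] := g3 v.
  have := h4 v; have := g4 v.
  set H := heightF _; set x := Phi _; set y := Psi _ => g4v h4v y0 y1 x0 x1 ne t.
  move=> /andP[t0 t1].
  have [xy|yx] := leP x y.
    apply: g4v; last by apply/andP; split => //; nra.
    by apply: contra_neq ne => yH; nra.
  apply: h4v; last by apply/andP; split => //; nra.
  by apply: contra_neq ne => xH; nra.
Qed.

(** [Psi] may be arbitrary where [f] vanishes, in particular outside the chart used to build it.
    Smoothness is therefore asked of the product, on all of TM. *)
Definition bump_patch (B : set M) (f : M -> R) Psi : Prop :=
  [/\ open B, forall p, B p -> f p = 1, forall p, 0 <= f p <= 1,
      forall p, base_smooth_at f p &
      (forall p, f p != 0 -> admissible Psi p) /\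
      forall p (v : tangent p), bundle_smooth_at (fun w => f (tbase w) * Psi w) v].

(** A nested convex combination instead of a normalised sum: each index takes the fraction [f k] of
    the weight left by its predecessors. The final 0 gets no weight as soon as some bump equals
    1. *)
Definition combine (f : nat -> M -> R) (Psi : nat -> tangentBundle M -> R)
    (l : seq nat) (w : tangentBundle M) : R :=
  foldr (fun k x => f k (tbase w) * Psi k w + (1 - f k (tbase w)) * x) 0 l.

Section Combine.
Variables (B : nat -> set M) (f : nat -> M -> R) (Psi : nat -> tangentBundle M -> R).
Hypothesis BfPsi : forall k, bump_patch (B k) (f k) (Psi k).

Lemma base_bundle_smooth (g : M -> R) p (v : tangent p) : base_smooth_at g p ->
  bundle_smooth_at (fun w => g (tbase w)) v.
Proof.
move=> gs c cp.
apply: (@smooth_at_comp _ _ _ _ fst (fun x : E => g (cinv c x) : R^o)) => //.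
  exact: smooth_at_fst.
exact: gs.
Qed.

Lemma bundle_smooth_combine l p (v : tangent p) : bundle_smooth_at (combine f Psi l) v.
Proof.
elim: l => [|k l IH] c cp; first exact: smooth_at_cst.
have [_ _ _ fs [_ fPs]] := BfPsi k.
apply: smooth_atD; first exact: fPs.
apply: smooth_atM; last exact: IH.
apply: smooth_atB; first exact: smooth_at_cst.
exact: (base_bundle_smooth v (fs p)).
Qed.

(** At [p], a bump equal to 0 drops its patch and a bump equal to 1 discards the rest of the list;
    otherwise the combination is strict and the tail is admissible by induction. *)
Lemma admissible_combine l p : has (fun k => f k p == 1) l ->
  admissible (combine f Psi l) p.
Proof.
elim: l => //= k l IH; have [_ _ f01 _ [fA _]] := BfPsi k.
have [f0|f0] := eqVneq (f k p) 0.
  rewrite f0 eq_sym oner_eq0 /= => /IH; apply: admissible_ext => v /=.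
  by rewrite f0 mul0r add0r subr0 mul1r.
have [f1 _|f1 /= /IH lA] := eqVneq (f k p) 1.
  apply: admissible_ext (fA p f0) => v /=.
  by rewrite f1 mul1r subrr mul0r addr0.
have a01 : 0 < f k p < 1.
  by have /andP[f0' f1'] := f01 p; rewrite !lt_neqAle f0' f1' f1 eq_sym f0.
exact: admissible_ext (admissible_comb a01 (fA p f0) lA) => v.
Qed.

Lemma combine_cat (s r : seq nat) j w : f j (tbase w) = 1 ->
  combine f Psi (s ++ j :: r) w = combine f Psi (s ++ [:: j]) w.
Proof.
move=> fj; elim: s => [|k s IH] /=; first by rewrite fj subrr !mul0r.
by rewrite /combine /= -!/(combine _ _ _ _) IH.
Qed.

Lemma combine_iota m j w : (j < m)%N -> f j (tbase w) = 1 ->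
  combine f Psi (iota 0 m) w = combine f Psi (iota 0 j.+1) w.
Proof.
move=> jm fj; have -> : m = (j + (m - j.+1).+1)%N by lia.
have -> : iota 0 j.+1 = iota 0 j ++ [:: j] by rewrite -addn1 iotaD.
by rewrite iotaD /= add0n combine_cat.
Qed.

(* On [B j] the bump [f j] is 1, so that all later patches are ignored: the
   convex combination is locally finite without any paracompactness. *)
Lemma exists_admissible_of_patches : (forall p, exists k, B k p) ->
  exists Phi, forall p, admissible Phi p /\
    forall v : tangent p, bundle_smooth_at Phi v.
Proof.
move=> /choice[N BN]; exists (fun w => combine f Psi (iota 0 (N (tbase w)).+1) w).
(* [N] is an arbitrary choice with no regularity in the base point. Both truncations equal the one
   at the larger index, so on [B j] the value does not depend on [N]. *)
have BE j w : B j (tbase w) -> combine f Psi (iota 0 (N (tbase w)).+1) w =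
    combine f Psi (iota 0 j.+1) w.
  move=> Bj; have [_ /(_ _ Bj) fj _ _ _] := BfPsi j.
  have [_ /(_ _ (BN (tbase w))) fN _ _ _] := BfPsi (N (tbase w)).
  rewrite -(@combine_iota (maxn (N (tbase w)) j).+1 (N (tbase w)))//; last first.
    by rewrite ltnS leq_maxl.
  by rewrite -(@combine_iota (maxn (N (tbase w)) j).+1 j)// ltnS leq_maxr.
move=> p; split.
  apply: (@admissible_combine (iota 0 (N p).+1)).
  apply/hasP; exists (N p); first by rewrite mem_iota /= add0n.
  by have [_ /(_ _ (BN p)) -> _ _ _] := BfPsi (N p).
move=> v c cp; have := @bundle_smooth_combine (iota 0 (N p).+1) p v c cp.
apply: smooth_at_eq; near=> xy; rewrite -BE//.
near: xy; have [Bo _ _ _ _] := BfPsi (N p).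
have cx : cimg c (cmap c p) by exact: cimg_cmap.
have nB : \forall x \near cmap c p, B (N p) (cinv c x).
  have cc : {in cimg c, continuous (cinv c)}.
    by rewrite -continuous_open_subspace; [exact: cinv_continuous|exact: cimg_open].
  have := cc (cmap c p); rewrite inE => /(_ cx); apply.
  by rewrite cmapK//; apply: open_nbhs_nbhs.
exact: (cvg_fst nB).
Unshelve. all: by end_near. Qed.

End Combine.

(** Lindelof argument: every point has a basic open set inside the [B] of some patch, and the basis
    is countable, so one patch per basic set suffices. *)
Lemma exists_admissible :
  (forall p, exists B f Psi, bump_patch B f Psi /\ B p) ->
  exists Phi, forall p, admissible Phi p /\
    forall v : tangent p, bundle_smooth_at Phi v.
Proof.
move=> patches; have [Bs Bc [Bo Bb]] := @mspace_second_countable _ _ M.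
have /countable_injP[i i_inj] := Bc.
have trivial_patch : bump_patch set0 (fun _ => 0) (fun _ => 0).
  split=> //; [exact: open0|by move=> p; rewrite lexx ler01|by move=> p c _; exact:
    smooth_at_cst|].
  split=> [p|p v c cp]; first by rewrite eqxx.
  exact: smooth_at_cst.
(* The index [k] is read as the code of a basic set. It receives a patch that covers this set if
   there is one, and otherwise the patch over the empty set. *)
have /choice[D DP] : forall k, exists D : (set M * (M -> R) * (tangentBundle M -> R))%type,
    bump_patch D.1.1 D.1.2 D.2 /\
    forall V, Bs V -> i V = k ->
      (exists B f Psi, bump_patch B f Psi /\ V `<=` B) -> V `<=` D.1.1.
  move=> k; have [[V [BV iV [B [f [Psi [P VB]]]]]]|nV] := pselect (exists V,
      [/\ Bs V, i V = k & exists B f Psi, bump_patch B f Psi /\ V `<=` B]).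
    exists (B, f, Psi); split=> // V' BV' iV' _.
    by have -> : V' = V by apply: i_inj; rewrite ?inE// iV iV'.
  exists (set0, (fun _ => 0), (fun _ => 0)); split=> // V BV iV h.
  by exfalso; apply: nV; exists V.
apply: (@exists_admissible_of_patches (fun k => (D k).1.1) (fun k => (D k).1.2)
  (fun k => (D k).2)) => [k|p]; first by case: (DP k).
have [B [f [Psi [P Bp]]]] := patches p.
have [V [BV Vp] VB] : exists2 V, Bs V /\ V p & V `<=` B.
  have [Bop _ _ _ _] := P.
  have /Bb [V /= [BV Vp] VB] : nbhs p B by exact: open_nbhs_nbhs.
  by exists V.
exists (i V); apply: (DP (i V)).2 Vp => //.
by exists B, f, Psi.
Qed.

End Gluing.

(** * The hypersurface *)

Section Hypersurface.
Context {R : realType} {n : nat} {M : smoothManifold R n}.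
Local Notation E := 'rV[R]_n.
Variables (Omega : forall p : M, {scalar tangent p}) (T : forall p : M, tangent p)
  (F : tangentBundle M -> R) (U : set (tangentBundle M)).
Hypothesis hcone : cone_triple Omega T F.
Variable Phi : tangentBundle M -> R.
Hypothesis Phi_admissible : forall p : M, admissible Omega T F U Phi p.
Hypothesis Phi_smooth : forall (p : M) (v : tangent p), bundle_smooth_at Phi v.
Local Notation heightF := (height Omega T F).
Local Notation kprojF := (kproj Omega T).
Implicit Types (p : M) (c : atlas M).

Definition graph : set (tangentBundle M) :=
  [set v | Omega (tbase v) (tvect v) = Phi v].

Lemma graph_bundle_hypersurface : bundle_hypersurface graph.
Proof.
move=> c [x y] /= [cx Sxy]; exists (fst @^-1` cimg c).
exists (fun xy => comega Omega c xy - Phi (bundle_cinv c xy) : R^o).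
have gs (xy : E * E) : cimg c xy.1 ->
    smooth_at (fun xy => comega Omega c xy - Phi (bundle_cinv c xy) : R^o) xy.
  move=> cxy; apply: smooth_atB; first exact: (smooth_at_comega hcone).
  exact: bundle_smooth_atP.
split.
- split=> //; apply: open_comp; last exact: cimg_open.
  by move=> z _; exact: cvg_fst.
- by apply: smooth_at_on => xy; exact: gs.
- move=> xy cxy; split=> [[_ e]|/eqP].
    by apply/eqP; rewrite subr_eq0; apply/eqP.
  by rewrite subr_eq0 => /eqP e; split.
(* Along the vertical direction of [T], Omega grows at unit rate while [Phi] is constant. *)
exists (0, cfield T c x); rewrite -dirdE.
have [cp _] := cdom_cinv cx.
have := @is_derive_line _ _ _ (x, y) (0, cfield T c x) 0.
rewrite scale0r addr0 => /(_ _ (smooth_at_differentiable (gs (x, y) cx))) [_ <-].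
rewrite (_ : (fun r : R^o => _) = (id : R^o -> R^o)); last first.
  apply/funext => r; have -> : (x, y) + r *: (0, cfield T c x) = (x, r *: cfield T c x + y).
    by apply: injective_projections; rewrite /= ?scaler0 ?addr0// addrC.
  rewrite /comega /bundle_cinv /= tvecP// addrC.
  have [PhiT _ _ _] := Phi_admissible (cinv c x).
  rewrite [r *: _ + _]addrC /cfield tvec_tcoord// PhiT linearD linearZ /=.
  rewrite (OmegaT hcone) mulr1; move: Sxy; rewrite /graph /bundle_cinv /= => ->.
  by rewrite addrA addNr add0r.
by rewrite derive_id; exact: oner_neq0.
Qed.

(** The indicatrix is the graph of the height function. At a point of either graph where [Phi] and
    the height differ, Omega is an end of the segment between them, and admissibility puts the point
    in [U]. *)
Lemma graph_away (G : tangentBundle M -> R) :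
  (forall (p : M) (t : R) (w : tangent p), Omega p w = 0 ->
     G (TVec p (t *: T p + w)) = t ^+ 2 - F (TVec p w) ^+ 2) ->
  graph `\` U = indicatrix Omega G `\` U.
Proof.
move=> hG; have indE v : indicatrix Omega G v <-> Omega (tbase v) (tvect v) = heightF v.
  case: v => p v; rewrite /indicatrix /=.
  have -> : G (TVec p v) = Omega p v ^+ 2 - ksqr Omega T F (TVec p v).
    rewrite {1}(kproj_decomp Omega T v) hG//.
    exact: (Omega_kproj hcone (TVec p v)).
  have k0 := ksqr_ge0 Omega T F (TVec p v).
  split=> [[Gv Ov]|->].
    have e : 1 + ksqr Omega T F (TVec p v) = Omega p v ^+ 2 by rewrite -Gv subrK.
    by rewrite /height e sqrtr_sqr gtr0_norm.
  have h1 := height_ge1 Omega T F (TVec p v).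
  split; last by apply: lt_le_trans h1.
  by rewrite sqr_sqrtr ?addrK// addr_ge0.
have UE p (v : tangent p) t : Omega p v = t ->
    TVec p (t *: T p + tvect (kprojF (TVec p v))) = TVec p v.
  by move=> <-; rewrite -kproj_decomp.
apply/seteqP; split; case=> p v [] /= h nU; split=> //.
  apply/indE => /=; have [_ _ hh hU] := Phi_admissible p.
  have [<-|ne] := eqVneq (Phi (TVec p v)) (heightF (TVec p v)); first exact: h.
  exfalso; apply: nU; rewrite -(UE _ _ _ h); apply: (hU v ne).
  by have /andP[-> _] := hh v; rewrite lexx.
move/indE: h => /= h; have [_ _ hh hU] := Phi_admissible p.
have [e|ne] := eqVneq (Phi (TVec p v)) (heightF (TVec p v)).
  by rewrite /graph /= h e.
exfalso; apply: nU; rewrite -(UE _ _ _ h); apply: (hU v ne).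
by have /andP[-> _] := hh v; rewrite lexx.
Qed.

Section Fibre.
Variables (p : M) (c : atlas M).
Hypothesis cp : cdom c p.

Let om := fomega_lin Omega cp.
Let phi := fibre_fun Phi p c.

Lemma fibre_graphE : tcoord c @` @fiber _ _ _ graph p = [set y | om y = phi y].
Proof.
apply/seteqP; split=> [_ [v vS <-]|y e].
  by rewrite /= /phi /fibre_fun /om /= /fomega tvec_tcoord.
by exists (tvec p c y); [exact: e|rewrite tcoord_tvec].
Qed.

Let omT : om (ffield T p c) = 1. Proof. exact: (fomega_field hcone cp). Qed.

Let phi_smooth (y : E) : smooth_at phi y. Proof. exact: fibre_smooth_at. Qed.

Let phiT (y : E) (s : R) : phi (y + s *: ffield T p c) = phi y.
Proof.
by rewrite /phi /fibre_fun tvec_shift//; case: (Phi_admissible p) => + _ _ _; apply.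
Qed.

Let phi_convex (y u : E) : om u = 0 -> u != 0 -> 0 < diff2 phi y u u.
Proof. by have [_ /(_ c cp y) [_ h _] _ _] := Phi_admissible p; exact: h. Qed.

Let phi_radial (y : E) : dird phi y y < phi y.
Proof. by have [_ /(_ c cp y) [_ _ h] _ _] := Phi_admissible p. Qed.

Lemma graph_fibre_strongly_convex : strongly_convex (tcoord c @` @fiber _ _ _ graph p).
Proof. by rewrite fibre_graphE; exact: (graph_strongly_convex omT). Qed.

Lemma graph_fibre_transverse (v : tangent p) : graph (TVec p v) ->
  transverse_radially (tcoord c @` @fiber _ _ _ graph p) (tcoord c v).
Proof.
move=> vS; rewrite fibre_graphE; apply: (graph_transverse omT) => //.
by rewrite -fibre_graphE; exists v.
Qed.

Let is_derive_ray (y : E) (l : R) :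
  is_derive (l : R^o) 1 (fun l : R^o => phi (l *: y) : R^o) (dird phi (l *: y) y).
Proof.
have := @is_derive_line _ _ phi 0 y l; rewrite add0r.
have -> : (fun r : R^o => phi (0 + r *: y) : R^o) = (fun r : R^o => phi (r *: y) : R^o).
  by apply/funext => r; rewrite add0r.
by apply; exact: smooth_at_differentiable.
Qed.

(** Crossings are the solutions of [l^-1 * phi (l *: y) = om y]. The radial condition makes the
    derivative of the left side negative, so by the mean value theorem it cannot take the same value
    twice. *)
Lemma graph_ray_unique (y : E) (l1 l2 : R) : 0 < l1 -> l1 < l2 ->
  l1 * om y = phi (l1 *: y) -> l2 * om y = phi (l2 *: y) -> False.
Proof.
move=> l10 l12 e1 e2.
pose r (l : R) : R := l^-1 * phi (l *: y).
pose dr (l : R) : R := l^-1 * dird phi (l *: y) y - l^-1 ^+ 2 * phi (l *: y).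
have rd (l : R) : 0 < l -> is_derive l 1 r (dr l).
  move=> l0; have ln0 : l != 0 by rewrite gt_eqF.
  have := @is_deriveM R R^o _ _ _ _ _ _ (is_derive_inv ln0) (is_derive_ray y l).
  move=> h; apply: (is_derive_eq h).
  by rewrite /GRing.scale /= /dr mulN1r mulrN expr2 [phi _ * _]mulrC.
have [] := @MVT R r dr l1 l2 l12.
- by move=> l; rewrite in_itv /= => /andP[l1l _]; apply: rd; apply: lt_trans l1l.
- apply: derivable_within_continuous => l; rewrite in_itv /= => /andP[l1l _].
  by case: (rd l (lt_le_trans l10 l1l)).
move=> l; rewrite in_itv /= => /andP[l1l _].
have l0 : 0 < l by apply: lt_trans l1l.
have rE k : 0 < k -> k * om y = phi (k *: y) -> r k = om y.
  by move=> k0 ke; rewrite /r -ke mulKf// gt_eqF.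
rewrite !rE// ?(lt_trans l10)// subrr.
have := phi_radial (l *: y); rewrite dirdZ => h.
have dr0 : dr l < 0.
  have -> : dr l = l^-1 ^+ 2 * (l * dird phi (l *: y) y - phi (l *: y)).
    by rewrite /dr; field; rewrite gt_eqF.
  by rewrite pmulr_rlt0 ?subr_lt0// exprn_gt0// invr_gt0.
by move=> /esym/eqP; rewrite mulf_eq0 lt_eqF//= subr_eq0 gt_eqF.
Qed.

Lemma graph_ray_exists (v : tangent p) : F (kprojF (TVec p v)) < Omega p v ->
  exists2 l : R, 0 < l & graph (TVec p (l *: v)).
Proof.
set f := F _; set t := Omega p v => ft.
have f0 : 0 <= f by apply: (finsler_ge0 (cone_finsler hcone)); exact: (kernel_kproj hcone).
have t0 : 0 < t by apply: le_lt_trans ft.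
pose y := tcoord c v.
pose k (l : R) : R := l * t - phi (l *: y).
have phiE l : phi (l *: y) = Phi (TVec p (l *: v)).
  by rewrite /phi /fibre_fun tvecZ// /y tvec_tcoord.
have kc : continuous k.
  move=> l; apply: (@smooth_at_continuous R R^o R^o); apply: smooth_atB.
    by apply: smooth_atM; [exact: smooth_at_id|exact: smooth_at_cst].
  apply: (@smooth_at_comp _ _ _ _ (fun l : R^o => l *: y) phi) => //.
  by apply: smooth_atZ => //; [exact: smooth_at_id|exact: smooth_at_cst].
have hE l : 0 < l -> heightF (TVec p (l *: v)) = Num.sqrt (1 + (l * f) ^+ 2).
  by move=> l0; rewrite /height (ksqrZ hcone)// exprMn.
have [_ _ bd _] := Phi_admissible p.
(* At [l0] Omega is 1/2, below [1 <= height <= Phi]. At [l1] it exceeds [l1 * f] by 3, while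
   [Phi <= height + 1 <= l1 * f + 2]. Between them the intermediate value theorem gives a
   crossing. *)
pose l0 := (2 * t)^-1; pose l1 := 3 / (t - f).
have tf : 0 < t - f by rewrite subr_gt0.
have l00 : 0 < l0 by rewrite invr_gt0 mulr_gt0.
have l10 : 0 < l1 by rewrite divr_gt0.
have k0 : k l0 <= 0.
  rewrite /k phiE; have /andP[+ _] := bd (l0 *: v).
  have := height_ge1 Omega T F (TVec p (l0 *: v)).
  have -> : l0 * t = 1 / 2 by rewrite /l0; field; rewrite gt_eqF.
  lra.
have k1 : 0 <= k l1.
  rewrite /k phiE; have /andP[_] := bd (l1 *: v); rewrite hE//.
  have l1f : 0 <= l1 * f by rewrite mulr_ge0// ltW.
  have : Num.sqrt (1 + (l1 * f) ^+ 2) <= 1 + l1 * f.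
    rewrite -[leRHS]ger0_norm ?addr_ge0// -sqrtr_sqr; apply: ler_wsqrtr; nra.
  have : l1 * t - l1 * f = 3 by rewrite -mulrBr /l1 divfK// gt_eqF.
  lra.
have l01 : l0 <= l1.
  rewrite /l0 /l1 ler_pdivlMr// mulrC ler_pdivrMr ?mulr_gt0//; lra.
have [|l] := @IVT R k l0 l1 0 l01 (continuous_subspaceT kc).
  by rewrite ge_min le_max k0 k1 orbT.
rewrite in_itv /= => /andP[l0l _] /eqP; rewrite subr_eq0 => /eqP kl.
exists l; first exact: lt_le_trans l0l.
by rewrite /graph /= linearZ /= -phiE -kl.
Qed.

End Fibre.

Lemma graph_transverse_to_rays p :
  transverse_to_rays (cone_domain Omega T F) graph p.
Proof.
move=> v [p' [t [w [w0 wt e]]]].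
have {e w0 wt} vA : F (kprojF (TVec p v)) < Omega p v.
  have -> : Omega p v = t.
    rewrite -[LHS]/(Omega (tbase (TVec p v)) (tvect (TVec p v))) e /=.
    by rewrite linearD linearZ /= (OmegaT hcone) mulr1 w0 addr0.
  rewrite e addrC (kproj_shift hcone).
  by rewrite kproj_ker.
have [c cp] := cdom_cover p; split; last first.
  by move=> l l0 lS d dp; exact: graph_fibre_transverse.
have [l l0 lS] := graph_ray_exists cp vA.
exists l; split=> // l' [l'0 l'S].
have gE k : graph (TVec p (k *: v)) -> k * fomega Omega p c (tcoord c v) =
    fibre_fun Phi p c (k *: tcoord c v).
  rewrite /graph /= /fomega /fibre_fun tvecZ// tvec_tcoord// => <-.
  by rewrite linearZ.
case: (ltgtP l l') => // ll'.
  by case: (@graph_ray_unique p c cp _ _ _ l0 ll' (gE _ lS) (gE _ l'S)).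
by case: (@graph_ray_unique p c cp _ _ _ l'0 ll' (gE _ l'S) (gE _ lS)).
Qed.

End Hypersurface.

(** * Local construction *)

Section SmoothMax.
Context {R : realType}.

(** Passing to [e * th (x / e)] shrinks the transition zone to [-2e, 2e] and preserves the bounds on
    the slope. The comparisons with 0, [x] and [2 * e] follow from slopes in [0, 1] and the known
    values outside the zone. *)
Lemma smooth_max_scaled (e : R) : 0 < e -> exists th th1 th2 : R^o -> R^o,
  [/\ forall x, smooth_at th x,
      forall x : R^o, is_derive x 1 th (th1 x) /\ is_derive x 1 th1 (th2 x),
      forall x, 0 <= th1 x <= 1 /\ 0 <= th2 x,
      forall x, 0 <= th x /\ x <= th x &
      [/\ forall x, x <= - (2 * e) -> th x = 0,
          forall x, 2 * e <= x -> th x = x &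
          forall x, x <= 2 * e -> th x <= 2 * e]].
Proof.
move=> e0; have en0 : e != 0 by rewrite gt_eqF.
have [th [th1 [th2 [ths thd th12 thm thp]]]] := @smooth_max_exists R.
have thc : continuous th by move=> x; exact: smooth_at_continuous.
have mono x y : x <= y -> 0 <= th y - th x <= y - x.
  move=> xy; have [c _ ->] := MVT_segment xy
    (fun x _ => (thd x).1) (continuous_subspaceT thc).
  have [/andP[s0 s1] _] := th12 c; set s := th1 c in s0 s1 *.
  have : 0 <= y - x by lra.
  nra.
have th0 x : 0 <= th x.
  have [x2|x2] := leP x (-2); first by rewrite thm.
  by have := mono (-2) x (ltW x2); rewrite (thm (-2))//; lra.
have thx x : x <= th x.
  have [x2|x2] := leP 2 x; first by rewrite thp.
  by have := mono x 2 (ltW x2); rewrite (thp 2)//; lra.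
have thu x : x <= 2 -> th x <= 2.
  by move=> x2; have := mono x 2 x2; rewrite (thp 2)//; lra.
have ed (x : R^o) : is_derive x 1 (fun y : R^o => e^-1 * y : R^o) e^-1.
  by apply: (is_derive_eq (@is_deriveZ R R^o R^o id e^-1 x 1 1 _)); exact: mulr1.
exists (fun x => e * th (e^-1 * x)), (fun x => th1 (e^-1 * x)),
  (fun x => e^-1 * th2 (e^-1 * x)).
split.
- move=> x; apply: smooth_atM; first exact: smooth_at_cst.
  apply: (@smooth_at_comp _ _ _ _ (fun y : R^o => e^-1 * y : R^o) th) => //.
  by apply: smooth_atM; [exact: smooth_at_cst|exact: smooth_at_id].
- move=> x; split.
    have h := @is_derive1_comp R th (fun y => e^-1 * y) x _ _ (thd (e^-1 * x)).1 (ed x).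
    apply: (is_derive_eq (@is_deriveZ R R^o R^o _ e x 1 _ h)).
    by rewrite /GRing.scale /=; field.
  have h := @is_derive1_comp R th1 (fun y => e^-1 * y) x _ _ (thd (e^-1 * x)).2 (ed x).
  by apply: (is_derive_eq h); rewrite mulrC.
- by move=> x; have [h1 h2] := th12 (e^-1 * x); split=> //; rewrite mulr_ge0// invr_ge0 ltW.
- move=> x; split; first by rewrite mulr_ge0// ltW.
  by rewrite -[leLHS](mulVKf en0) ler_pM2l.
split.
- by move=> x x2; rewrite thm ?mulr0// ler_pdivrMl// mulrN mulrC.
- by move=> x x2; rewrite thp ?mulVKf// ler_pdivlMl// mulrC.
- move=> x x2; rewrite [leRHS]mulrC ler_pM2l//; apply: thu.
  by rewrite ler_pdivrMl// mulrC.
Qed.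

End SmoothMax.

(** * The Euclidean squared norm *)

Section SquaredNorm.
Context {R : realType} {n : nat}.
Local Notation E := 'rV[R]_n.
Implicit Types (x y z u v : E).

(** A quadratic form is used in place of the norm of row vectors because it is smooth and has a
    positive definite second derivative. *)
Definition sqnorm y : R := \sum_i y 0 i ^+ 2.

Lemma sqnorm_ge0 y : 0 <= sqnorm y.
Proof. by apply: sumr_ge0 => i _; exact: sqr_ge0. Qed.

Lemma sqnorm_coord y i : y 0 i ^+ 2 <= sqnorm y.
Proof. by rewrite /sqnorm (bigD1 i)//= lerDl sumr_ge0// => j _; exact: sqr_ge0. Qed.

Lemma sqnorm0 : sqnorm 0 = 0.
Proof. by rewrite /sqnorm big1// => i _; rewrite mxE expr0n. Qed.

Lemma sqnorm_gt0 y : y != 0 -> 0 < sqnorm y.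
Proof.
move=> y0; rewrite lt_neqAle sqnorm_ge0 andbT; apply: contra_neq y0 => /esym yn0.
apply/rowP => i; rewrite mxE; apply/eqP; rewrite -sqrf_eq0 eq_le sqr_ge0 andbT.
by rewrite -yn0 sqnorm_coord.
Qed.

Lemma sqnormZ (a : R) y : sqnorm (a *: y) = a ^+ 2 * sqnorm y.
Proof. by rewrite /sqnorm mulr_sumr; apply: eq_bigr => i _; rewrite mxE exprMn. Qed.

Lemma smooth_at_sqnorm (V : normedModType R) (f : V -> E) (x : V) :
  smooth_at f x -> smooth_at (fun z : V => sqnorm (f z) : R^o) x.
Proof.
move=> fs; apply: smooth_at_sum => i.
have -> : (fun z : V => f z 0 i ^+ 2 : R^o) = (fun z : V => f z 0 i * f z 0 i : R^o).
  by apply/funext => z; rewrite expr2.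
by apply: smooth_atM; exact: smooth_at_mxE.
Qed.

Lemma sqnorm_ball x (e : R) : 0 < e -> exists2 r : R, 0 < r &
  forall y, sqnorm (y - x) <= r -> ball x e y.
Proof.
move=> e0; exists ((e / 2) ^+ 2); first by rewrite exprn_gt0// divr_gt0.
move=> y yr; split=> // i j; rewrite ord1 -ball_normE /= distrC.
have e2 : 0 <= e / 2 by rewrite divr_ge0// ltW.
have : `|(y - x) 0 j| <= e / 2.
  by rewrite -ler_sqr ?nnegrE// real_normK ?num_real// (le_trans (sqnorm_coord _ _)).
rewrite !mxE => h; apply: le_lt_trans h _; lra.
Qed.

Lemma sqnorm_compact x (r : R) : compact [set y | sqnorm (y - x) <= r].
Proof.
(* [t ^ 2 <= r] implies [|t| <= 1 + r], which gives an enclosing box without square roots. *)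
pose A i : set R := `[x 0 i - (1 + r), x 0 i + (1 + r)]%classic.
have cA : compact [set y : E | forall i, A i (y ord0 i)].
  by apply: rV_compact => i; exact: segment_compact.
apply: (subclosed_compact _ cA).
  apply: (@preimage_closed _ _ (fun y : E => sqnorm (y - x) : R^o) [set t | t <= r]).
    move=> y _; apply: (@smooth_at_continuous R E R^o); apply: smooth_at_sqnorm.
    by apply: smooth_atB; [exact: smooth_at_id|exact: smooth_at_cst].
  exact: closed_le.
move=> y yr i; rewrite /A /= in_itv /=.
have := le_trans (sqnorm_coord (y - x) i) yr; rewrite !mxE => h.
have r0 : 0 <= r by apply: le_trans h; exact: sqr_ge0.
by apply/andP; split; nra.
Qed.

Lemma diff2_sqnorm_linear (L : {linear E -> E}) (a : R) y u :
  diff2 (fun z => a * sqnorm (L z) : R^o) y u u = 2 * a * sqnorm (L u).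
Proof.
have Ls z : smooth_at L z by exact: smooth_at_linear_rV.
have Ld z : differentiable L z by exact: smooth_at_differentiable.
have cd z i : differentiable (fun q => L q 0 i : R^o) z /\
    dird (fun q => L q 0 i : R^o) z u = L u 0 i.
  have [h1 h2] := differentiable_mxE u i (Ld z); split=> //.
  by rewrite h2 dird_lin// => w; exact: smooth_at_continuous.
have d1 z : dird (fun q => sqnorm (L q) : R^o) z u = \sum_i (2 * L u 0 i) * L z 0 i.
  have sqd i : differentiable (fun q => L q 0 i * L q 0 i : R^o) z.
    by apply: differentiableM; case: (cd z i).
  have [_ e] := differentiable_sum_dird (index_enum 'I_n) u sqd.
  have -> : (fun q => sqnorm (L q) : R^o) = (fun q => \sum_i L q 0 i * L q 0 i : R^o).
    by apply/funext => q; apply: eq_bigr => i _; rewrite expr2.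
  rewrite e; apply: eq_bigr => i _; have [c1 c2] := cd z i.
  by rewrite dird_mul// c2; ring.
rewrite diff2_cstmul; last by apply: smooth_at_sqnorm.
rewrite /diff2; have -> : (fun z => dird (fun q => sqnorm (L q) : R^o) z u : R^o) =
    (fun z => \sum_i (2 * L u 0 i) * L z 0 i : R^o) by apply/funext => z; rewrite d1.
have mdi i : differentiable (fun q => (2 * L u 0 i) * L q 0 i : R^o) y.
  by apply: differentiableZ; case: (cd y i).
have [_ ->] := differentiable_sum_dird (index_enum 'I_n) u mdi.
rewrite /sqnorm !mulr_sumr; apply: eq_bigr => i _; have [c1 c2] := cd y i.
by rewrite dird_cstmul// c2; ring.
Qed.

End SquaredNorm.

(** * Bounds uniform in the base point *)

Section LocalBounds.
Context {R : realType} {n : nat} {M : smoothManifold R n}.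
Local Notation E := 'rV[R]_n.
Variables (Omega : forall p : M, {scalar tangent p}) (T : forall p : M, tangent p)
  (F : tangentBundle M -> R) (U : set (tangentBundle M)).
Hypothesis hcone : cone_triple Omega T F.
Local Notation heightF := (height Omega T F).
Local Notation ksqrF := (ksqr Omega T F).
Local Notation kprojF := (kproj Omega T).
Implicit Types (p : M) (c d : atlas M).

Lemma cimg_sqnorm_ball c (x0 : E) : cimg c x0 ->
  exists2 r : R, 0 < r & forall x, sqnorm (x - x0) <= r -> cimg c x.
Proof.
move=> /near_cimg /nbhs_ballP [e /= e0 be].
have [r r0 rb] := sqnorm_ball x0 e0; exists r => // x xr.
by apply: be; exact: rb.
Qed.

Lemma continuous_ksqr_chart c (xy : E * E) : cimg c xy.1 ->
  {for xy, continuous (fun z => ksqrF (bundle_cinv c z) : R^o)}.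
Proof.
move=> cx; have Fc := continuous_F_chart hcone cx.
exact: (@continuousM R _ _ _ xy Fc Fc).
Qed.

(** The kernel of Omega moves with [x], so the minimum is taken over the fixed unit sphere of [E],
    of [ksqr] plus the square of Omega; this is positive, since Omega is nonzero on a nonzero vector
    with zero projection. On ker Omega the added term drops, and homogeneity passes from the sphere
    to all vectors. *)
Lemma ksqr_lower_bound c (x0 : E) : cimg c x0 -> exists r a : R,
  [/\ 0 < r, 0 < a, a <= 1 & forall x, sqnorm (x - x0) <= r -> cimg c x /\
    forall y, a * sqnorm (ckproj Omega T c (x, y)).2 <= ksqrF (bundle_cinv c (x, y))].
Proof.
move=> cx0; have [r r0 rc] := cimg_sqnorm_ball cx0.
pose C : set (E * E) := [set x | sqnorm (x - x0) <= r] `*` [set y | sqnorm y = 1].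
pose g (z : E * E) : R := ksqrF (bundle_cinv c z) + comega Omega c z ^+ 2.
have Cc : compact C.
  apply: compact_setX; first exact: sqnorm_compact.
  apply: (subclosed_compact _ (@sqnorm_compact _ _ 0 1)); last first.
    by move=> y /= y1; rewrite subr0 y1.
  apply: (@preimage_closed _ _ (fun y : E => sqnorm y : R^o) [set t | t = 1]).
    move=> y _; apply: (@smooth_at_continuous R E R^o); apply: smooth_at_sqnorm.
    exact: smooth_at_id.
  exact: closed_eq.
have gc : {within C, continuous (g : _ -> R^o)}.
  apply: continuous_in_subspaceT => z; rewrite inE => -[/= /rc cz _].
  have oc := smooth_at_continuous (smooth_at_comega hcone cz).
  have o2 := @continuousM R _ _ _ z oc oc.
  exact: (@continuousD _ _ _ _ _ z (continuous_ksqr_chart cz) o2).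
have g0 z : C z -> 0 < g z.
  case: z => x y [/= /rc cx y1]; have [cp _] := cdom_cinv cx.
  have [k0|k0] := eqVneq (tvect (kprojF (bundle_cinv c (x, y)))) 0; last first.
    apply: ltr_pwDl; last exact: sqr_ge0.
    rewrite /ksqr exprn_gt0//; apply: (finsler_gt0 (cone_finsler hcone)) k0.
    exact: (kernel_kproj hcone).
  apply: ltr_pwDr; last exact: ksqr_ge0.
  rewrite lt_neqAle sqr_ge0 andbT eq_sym sqrf_eq0.
  apply/eqP => o0; have := @sqnorm0 R n; have -> : (0 : E) = y.
    move: k0; rewrite /kproj /= -/(comega Omega c (x, y)) o0 scale0r subr0.
    by move=> /(congr1 (tcoord c)); rewrite tcoord_tvec.
  by rewrite y1 => /eqP; rewrite oner_eq0.
(* Taking the minimum with 1 normalises [a] for the comparison with the quadric; an empty [C] is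
   treated apart. *)
have [a [a0 a1 ag]] : exists a : R, [/\ 0 < a, a <= 1 & forall z, C z -> a <= g z].
  have [Cn0|Cn0] := pselect (C !=set0); last first.
    by exists 1; split=> // z Cz; exfalso; apply: Cn0; exists z.
  have [z zC zmin] := compact_EVT_min Cn0 Cc gc.
  exists (Num.min (g z) 1); split.
  - by rewrite lt_min ltr01 g0//; exact: set_mem.
  - by rewrite ge_min lexx orbT.
  - by move=> z' z'C; rewrite ge_min zmin//; exact: mem_set.
exists r, a; split=> // x xr; have cx := rc x xr; split=> // y.
have [cp _] := cdom_cinv cx.
set w := (ckproj Omega T c (x, y)).2.
have [w0|w0] := eqVneq w 0; first by rewrite w0 sqnorm0 mulr0 ksqr_ge0.
have Nw : 0 < sqnorm w by exact: sqnorm_gt0.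
pose l := Num.sqrt (sqnorm w).
have l0 : 0 < l by rewrite sqrtr_gt0.
have ll : l ^+ 2 = sqnorm w by rewrite sqr_sqrtr// ltW.
have kE : kprojF (bundle_cinv c (x, y)) = bundle_cinv c (x, w) by rewrite -ckprojE.
have ow : Omega _ (tvec (cinv c x) c w) = 0.
  by have := Omega_kproj hcone (bundle_cinv c (x, y)); rewrite kE.
have -> : ksqrF (bundle_cinv c (x, y)) = ksqrF (bundle_cinv c (x, w)).
  rewrite /ksqr kE; congr (F _ ^+ 2).
  by rewrite [bundle_cinv c (x, w)]/bundle_cinv kproj_ker.
have wE : w = l *: (l^-1 *: w) by rewrite scalerA mulfV ?scale1r// gt_eqF.
have -> : ksqrF (bundle_cinv c (x, w)) = l ^+ 2 * ksqrF (bundle_cinv c (x, l^-1 *: w)).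
  by rewrite {1}wE /bundle_cinv /= tvecZ// (ksqrZ hcone).
rewrite -ll mulrC ler_pM2l ?exprn_gt0//.
have Cw : C (x, l^-1 *: w).
  by split=> //=; rewrite sqnormZ -ll exprVn mulVf// gt_eqF// exprn_gt0.
apply: le_trans (ag _ Cw) _; rewrite /g /comega /bundle_cinv /= tvecZ//.
by rewrite linearZ /= ow mulr0 expr0n addr0.
Qed.

(** The map from (x, t, w) to t T_x + w is continuous at (x0, 1, 0). A product neighbourhood inside
    the preimage of [U] provides sizes valid for all base points near [x0] at once. *)
Lemma tube_in_neighborhood c (x0 : E) : cimg c x0 ->
  nbhs (TVec (cinv c x0) (T (cinv c x0))) U ->
  exists r rho tau : R, [/\ 0 < r, 0 < rho, 0 < tau, tau <= 1 &
    forall x, sqnorm (x - x0) <= r -> forall (t : R) (w : E),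
      `|t - 1| <= tau -> sqnorm w <= rho -> U (bundle_cinv c (x, t *: cfield T c x + w))].
Proof.
move=> cx0 nU; have [cp _] := cdom_cinv cx0.
pose m (z : E * (R^o * E)) : E * E := (z.1, z.2.1 *: cfield T c z.1 + z.2.2).
have ms : smooth_at m (x0, (1, 0)).
  apply: smooth_at_pair; first exact: smooth_at_fst.
  have s2 : smooth_at (fun z : E * (R^o * E) => z.2) (x0, (1, 0)) by exact: smooth_at_snd.
  apply: smooth_atD; last first.
    by apply: (@smooth_at_comp _ _ _ _ snd snd) => //; exact: smooth_at_snd.
  apply: smooth_atZ => //.
    by apply: (@smooth_at_comp _ _ _ _ snd fst) => //; exact: smooth_at_fst.
  apply: (@smooth_at_comp _ _ _ _ fst (cfield T c)) => //; first exact: smooth_at_fst.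
  exact: (smooth_at_cfield hcone).
have m0 : m (x0, (1, 0)) = (x0, cfield T c x0).
  by rewrite /m /= scale1r addr0.
have nU' : nbhs (bundle_cinv c (x0, cfield T c x0)) U.
  by rewrite /bundle_cinv /= /cfield tvec_tcoord.
have nm : \forall z \near (x0, ((1 : R^o), (0 : E))), U (bundle_cinv c (m z)).
  have h : \forall z \near m (x0, ((1 : R^o), (0 : E))), U (bundle_cinv c z).
    by rewrite m0; exact: (@near_bundle_cinv _ _ _ c (x0, cfield T c x0) U).
  exact: (smooth_at_continuous ms h).
have /nbhs_ballP [e /= e0 be] := nm.
have [r r0 rb] := sqnorm_ball x0 e0; have [rho rho0 rhob] := sqnorm_ball (0 : E) e0.
exists r, rho, (Num.min (e / 2) 1); split=> //.
- by rewrite lt_min ltr01 divr_gt0.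
- by rewrite ge_min lexx orbT.
move=> x xr t w; rewrite le_min => /andP[te _] wr.
apply: (be (x, (t, w))); split=> /=; first exact: rb.
split=> /=; last by apply: rhob; rewrite subr0.
by rewrite -ball_normE /= distrC; apply: le_lt_trans te _; lra.
Qed.

End LocalBounds.

(** * Transition maps, and the arithmetic of the quadric *)

Section LocalPatch.
Context {R : realType} {n : nat} {M : smoothManifold R n}.
Local Notation E := 'rV[R]_n.
Implicit Types (p : M) (c d : atlas M).

Lemma smooth_at_dird_apply (V W : normedModType R) (tau : E -> W) (f k : V -> E)
    (z : V) : has_coordinates W -> smooth_at tau (f z) -> smooth_at f z ->
  smooth_at k z -> smooth_at (fun x => dird tau (f x) (k x)) z.
Proof.
move=> hW ts fs ks.
have -> : (fun x => dird tau (f x) (k x)) =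
    (fun x => \sum_i (k x 0 i : R^o) *: dird tau (f x) (delta_mx 0 i)).
  apply/funext => x; rewrite dirdE {1}[k x]row_sum_delta linear_sum.
  by apply: eq_bigr => i _; rewrite linearZ dirdE.
apply: smooth_at_sum => i; apply: smooth_atZ => //; first exact: smooth_at_mxE.
apply: (@smooth_at_comp _ _ _ _ f (fun y => dird tau y (delta_mx 0 i))) => //.
exact: smooth_at_dird.
Qed.

Lemma tcoord_change p c d (v : tangent p) : cdom c p -> cdom d p ->
  tcoord d v = dird (cmap d \o cinv c) (cmap c p) (tcoord c v).
Proof.
by move=> cp dp; have /asboolP[_ vE] := tangent_valP v; rewrite dirdE; exact: vE.
Qed.

Lemma smooth_at_transition c d p : cdom c p -> cdom d p ->
  smooth_at (cmap d \o cinv c) (cmap c p).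
Proof.
move=> cp dp; apply: (smooth_on_at (@ctransition_open _ _ _ c d)); first by exists p.
exact: ctransition_smooth.
Qed.

Lemma near_transition c d p : cdom c p -> cdom d p ->
  \forall x \near cmap c p, cdom c (cinv c x) /\ cdom d (cinv c x) /\
    cmap c (cinv c x) = x.
Proof.
move=> cp dp; have h : nbhs (cmap c p) (cmap c @` (cdom c `&` cdom d)).
  by apply: open_nbhs_nbhs; split; [exact: ctransition_open|exists p].
by apply: filterS h => _ [q [cq dq] <-]; rewrite cmapK.
Qed.

(** Outside the tube [a * N >= 40 * e]. The quadric uses a quarter of this growth, and the remaining
    three quarters absorb the offset [3 * e] and the margin [2 * e]. *)
Lemma cap_le_height (a rho tau e N K : R) : 0 < a <= 1 -> 0 < rho <= tau ->
  tau <= 1 -> 40 * e = a * rho -> rho <= N -> a * N <= K ->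
  Num.sqrt ((1 + 3 * e) ^+ 2 + a / 4 * N) + 2 * e <= Num.sqrt (1 + K).
Proof.
move=> /andP[a0 a1] /andP[r0 rt] t1 eE rN aK.
have aN : a * rho <= a * N by rewrite ler_pM2l.
have ar1 : a * rho <= 1 by nra.
have ar0 : 0 < a * rho by rewrite mulr_gt0.
have N0 : 0 < N by lra.
have q20 : 0 <= (1 + 3 * e) ^+ 2 + a / 4 * N.
  by rewrite addr_ge0 ?sqr_ge0// mulr_ge0 ?ltW// divr_gt0.
set q := Num.sqrt ((1 + _) ^+ 2 + _).
have q0 : 0 <= q by rewrite sqrtr_ge0.
have qq : q ^+ 2 = (1 + 3 * e) ^+ 2 + a / 4 * N by rewrite sqr_sqrtr.
have e0 : 0 < e by lra.
have e1 : 40 * e <= 1 by lra.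
have p0 : 0 <= q + 2 * e by lra.
rewrite -(ger0_norm p0) -sqrtr_sqr; apply: ler_wsqrtr.
set X := a * N in aN aK; have qqX : q ^+ 2 = (1 + 3 * e) ^+ 2 + X / 4.
  by rewrite qq /X; field.
(* Bounds the cross term [4 * e * q] of the square by [2 * e * (1 + q ^ 2)], in which [q] appears
   only through its known square. *)
have h1 : 0 <= e * (1 - q) ^+ 2 by rewrite mulr_ge0 ?sqr_ge0// ltW.
have h2 : e * X <= X / 40 by nra.
nra.
Qed.

(** Inside the tube the quadric, even raised by the smoothing margin [2 * e], stays in the slab of
    half-width [tau] about height 1 that is known to lie in [U]. *)
Lemma cap_le_top (a rho tau e N : R) : 0 < a <= 1 -> 0 < rho <= tau ->
  tau <= 1 -> 40 * e = a * rho -> 0 <= N -> N <= rho ->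
  Num.sqrt ((1 + 3 * e) ^+ 2 + a / 4 * N) + 2 * e <= 1 + tau.
Proof.
move=> /andP[a0 a1] /andP[r0 rt] t1 eE N0 Nr.
have aN : a * N <= tau by apply: (@le_trans _ _ (1 * N)); [rewrite ler_wpM2r|lra].
have ar1 : a * rho <= tau
  by apply: (@le_trans _ _ (1 * rho)); [rewrite ler_wpM2r// ltW|lra].
have ar0 : 0 < a * rho by rewrite mulr_gt0.
have e0 : 0 < e by lra.
have e1 : 40 * e <= tau by lra.
have p0 : 0 <= 1 + tau - 2 * e by lra.
rewrite -lerBrDr -(ger0_norm p0).
rewrite -sqrtr_sqr; apply: ler_wsqrtr.
have -> : a / 4 * N = (a * N) / 4 by field.
nra.
Qed.

End LocalPatch.

(** * The capped indicatrix over a chart *)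

Section Patch.
Context {R : realType} {n : nat} {M : smoothManifold R n}.
Local Notation E := 'rV[R]_n.
Variables (Omega : forall p : M, {scalar tangent p}) (T : forall p : M, tangent p)
  (F : tangentBundle M -> R) (U : set (tangentBundle M)).
Hypothesis hcone : cone_triple Omega T F.
Local Notation heightF := (height Omega T F).
Local Notation ksqrF := (ksqr Omega T F).
Local Notation kprojF := (kproj Omega T).
Variables (c0 : atlas M) (x0 : E) (r a rho tau e : R).
Hypotheses (a01 : 0 < a <= 1) (rho_tau : 0 < rho <= tau) (tau1 : tau <= 1)
  (eE : 40 * e = a * rho).
Hypothesis cimg_ball : forall x : E, sqnorm (x - x0) <= r -> cimg c0 x.
Hypothesis ksqr_ge : forall x : E, sqnorm (x - x0) <= r -> forall y : E,
  a * sqnorm (ckproj Omega T c0 (x, y)).2 <= ksqrF (bundle_cinv c0 (x, y)).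
Hypothesis tube_U : forall x : E, sqnorm (x - x0) <= r -> forall (t : R) (w : E),
  `|t - 1| <= tau -> sqnorm w <= rho -> U (bundle_cinv c0 (x, t *: cfield T c0 x + w)).
Variables th th1 th2 : R^o -> R^o.
Hypotheses (th_smooth : forall x, smooth_at th x)
  (th_derive : forall x : R^o, is_derive x 1 th (th1 x) /\ is_derive x 1 th1 (th2 x))
  (th12_ge0 : forall x, 0 <= th1 x <= 1 /\ 0 <= th2 x)
  (th_ge : forall x, 0 <= th x /\ x <= th x)
  (th_lo : forall x, x <= - (2 * e) -> th x = 0)
  (th_hi : forall x, 2 * e <= x -> th x = x)
  (th_le : forall x, x <= 2 * e -> th x <= 2 * e).
Implicit Types (p : M) (c d : atlas M).

Let e_gt0 : 0 < e.
Proof.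
have /andP[a0 _] := a01; have /andP[r0 _] := rho_tau.
by have := mulr_gt0 a0 r0; rewrite -eE; lra.
Qed.

Let cap0_gt0 : 0 < 1 + 3 * e.
Proof. by have e0 := e_gt0; lra. Qed.

(** Always measured in the chart [c0] of the patch, whatever chart the rest is read in. *)
Definition knorm (v : tangentBundle M) : R := sqnorm (tcoord c0 (tvect (kprojF v))).

(** At zero projection its value is [1 + 3 * e] against 1 for the indicatrix; the gap has to exceed
    the width [2 * e] of the regularised maximum. *)
Definition cap (v : tangentBundle M) : R :=
  Num.sqrt ((1 + 3 * e) ^+ 2 + a / 4 * knorm v).

(* Near T the hyperboloid [cap] lies above the indicatrix, away from T it lies
   below: the smooth maximum of both coincides with [cap] near the singular
   point of the indicatrix and with the indicatrix outside the tube. *)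
Definition capped (v : tangentBundle M) : R := cap v + th (heightF v - cap v).

Let cap_arg_gt0 v : 0 < (1 + 3 * e) ^+ 2 + a / 4 * knorm v.
Proof.
have /andP[a0 _] := a01; apply: ltr_pwDl; first exact: exprn_gt0.
by rewrite mulr_ge0 ?sqnorm_ge0// divr_ge0// ltW.
Qed.

(** In another chart [d], [knorm] is read through the differential of the transition map, applied to
    a vector that moves with the point. *)
Lemma bundle_smooth_cap p (v : tangent p) : cdom c0 p -> bundle_smooth_at cap v.
Proof.
move=> cp d dp; set z0 := (_, _); have cz0 : cimg d z0.1 by exact: cimg_cmap.
have s1 : smooth_at (fun z => dird (cmap c0 \o cinv d) z.1 (ckproj Omega T d z).2) z0.
  apply: smooth_at_dird_apply => //.
  - exact: smooth_at_transition.
  - exact: smooth_at_fst.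
  - apply: (@smooth_at_comp _ _ _ _ (ckproj Omega T d) snd) => //.
      exact: (smooth_at_ckproj hcone).
    exact: smooth_at_snd.
have s2 : smooth_at (fun z => knorm (bundle_cinv d z) : R^o) z0.
  apply: smooth_at_eq (smooth_at_sqnorm s1); near=> z.
  have [dz [cz zE]] : cdom d (cinv d z.1) /\ cdom c0 (cinv d z.1) /\ cmap d (cinv d
    z.1) = z.1.
    by near: z; exact: (cvg_fst (near_transition dp cp)).
  have ciz : cimg d z.1 by exists (cinv d z.1).
  have kE := ckprojE Omega T ciz.
  rewrite /knorm -kE (tcoord_change _ dz cz) /= zE.
  by rewrite tcoord_tvec.
apply: (@smooth_at_comp _ _ _ _ _ (Num.sqrt : R^o -> R^o)) => //.
  apply: smooth_atD; first exact: smooth_at_cst.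
  by apply: smooth_atM => //; exact: smooth_at_cst.
apply: smooth_at_sqrt; exact: cap_arg_gt0.
Unshelve. all: by end_near. Qed.

Lemma bundle_smooth_height p (v : tangent p) : tvect (kprojF (TVec p v)) != 0 ->
  bundle_smooth_at heightF v.
Proof.
move=> v0 d dp; have ks := bundle_smooth_ksqr hcone v0 dp.
apply: (@smooth_at_comp _ _ _ _ _ (Num.sqrt : R^o -> R^o)) => //.
  by apply: smooth_atD => //; exact: smooth_at_cst.
by apply: smooth_at_sqrt; rewrite ltr_pwDl// ksqr_ge0.
Qed.

(** Where the projection vanishes, the difference of height and cap is [- 3 * e]. By mere continuity
    of [F] it stays below [- 2 * e] nearby, where [th] vanishes; no smoothness of [F] at the zero
    section is involved. *)
Lemma near_capped p (v : tangent p) d : cdom c0 p -> cdom d p ->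
  tvect (kprojF (TVec p v)) = 0 ->
  \forall z \near (cmap d p, tcoord d v), cap (bundle_cinv d z) = capped (bundle_cinv d z).
Proof.
move=> cp dp v0; set z0 := (_, _); have cz0 : cimg d z0.1 by exact: cimg_cmap.
have z0E : bundle_cinv d z0 = TVec p v by rewrite bundle_cinvE// tvec_tcoord.
have kc := continuous_ksqr_chart hcone cz0.
have hc : {for z0, continuous (fun z => heightF (bundle_cinv d z) : R^o)}.
  apply: (@continuous_comp _ _ _ (fun z => 1 + ksqrF (bundle_cinv d z) : R^o) (Num.sqrt
    : R^o -> R^o)).
    have c1 : {for z0, continuous (fun _ : E * E => 1 : R^o)} by exact: cst_continuous.
    exact: (continuousD c1 kc).
  exact: sqrt_continuous.
have cc := smooth_at_continuous (bundle_smooth_cap v cp dp).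
have hcc : {for z0, continuous (fun z => heightF (bundle_cinv d z) - cap (bundle_cinv d
  z) : R^o)}.
  exact: (continuousB hc cc).
have s0 : heightF (bundle_cinv d z0) - cap (bundle_cinv d z0) < - (2 * e).
  rewrite z0E /height (kproj0_ksqr hcone v0) addr0 sqrtr1 /cap /knorm v0.
  have -> : tcoord c0 (0 : tangent p) = 0 by [].
  rewrite sqnorm0 mulr0 addr0 sqrtr_sqr gtr0_norm//.
  by have e0 := e_gt0; lra.
have nh : \forall s \near (heightF (bundle_cinv d z0) - cap (bundle_cinv d z0) : R^o),
  s < - (2 * e).
  exact: lt_nbhsl.
have hz : \forall z \near z0,
    heightF (bundle_cinv d z) - cap (bundle_cinv d z) < - (2 * e) by exact: (hcc _ nh).
apply: filterS hz => z zs.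
by rewrite /capped th_lo ?addr0// ltW.
Qed.

Lemma bundle_smooth_capped p (v : tangent p) : cdom c0 p -> bundle_smooth_at capped v.
Proof.
move=> cp d dp; have cs := bundle_smooth_cap v cp dp.
have [v0|v0] := eqVneq (tvect (kprojF (TVec p v))) 0.
  exact: smooth_at_eq (near_capped cp dp v0) cs.
have hs := bundle_smooth_height v0 dp.
apply: smooth_atD => //.
by apply: (@smooth_at_comp _ _ _ _ _ th) => //; exact: smooth_atB.
Qed.

Section Fibre.
Variables (p : M) (d : atlas M).
Hypotheses (cp : cdom c0 p) (dp : cdom d p).

Let lproj (y : E) : E := tcoord c0 (tvect (kprojF (TVec p (tvec p d y)))).

Let lproj_linear : linear lproj.
Proof.
move=> b u v; pose kp (w : tangent p) : tangent p := w - Omega p w *: T p.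
have kpP w1 w2 : kp (b *: w1 + w2) = b *: kp w1 + kp w2.
  have e1 : Omega p (b *: w1 + w2) = b * Omega p w1 + Omega p w2 by rewrite linearP.
  by rewrite /kp e1 scalerDl -scalerA scalerBr opprD addrACA.
have lE y : lproj y = tcoord c0 (kp (tvec p d y)) by [].
by rewrite !lE tvecP// kpP tcoordP.
Qed.

Let lproj_shift (y : E) (s : R) : lproj (y + s *: ffield T p d) = lproj y.
Proof.
pose kp (w : tangent p) : tangent p := w - Omega p w *: T p.
have lE z : lproj z = tcoord c0 (kp (tvec p d z)) by [].
suff kE : kp (tvec p d (y + s *: ffield T p d)) = kp (tvec p d y).
  exact: (etrans (lE _) (etrans (congr1 (tcoord c0) kE) (esym (lE y)))).
rewrite tvec_shift//; set w := tvec p d y.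
have e1 : Omega p (w + s *: T p) = Omega p w + s.
  by rewrite linearD linearZ /= (OmegaT hcone) mulr1.
by rewrite /kp e1 scalerDl opprD addrACA subrr addr0.
Qed.

Let lprojL : {linear E -> E} :=
  HB.pack lproj (GRing.isLinear.Build _ _ _ _ lproj lproj_linear).

(** The cap is the square root of a constant plus a quadratic form, namely [sqnorm] of the
    projection read in [c0]. This form is positive definite on ker Omega because the projection is
    the identity there. *)
Lemma convex_at_cap (y : E) : convex_at (fomega Omega p d) (fibre_fun cap p d) y.
Proof.
have /andP[a0 _] := a01.
apply: (@convex_at_sqrt _ _ (fomega_lin Omega dp) (ffield T p d)
  (fun z => a / 4 * sqnorm (lprojL z)) ((1 + 3 * e) ^+ 2)).
- exact: (fomega_field hcone dp).
- exact: exprn_gt0.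
- by move=> z l l0; rewrite linearZ sqnormZ mulrCA.
- move=> z s; have h : lprojL (z + s *: ffield T p d) = lprojL z by exact: lproj_shift.
  by rewrite h.
- apply: smooth_atM; first exact: smooth_at_cst.
  by apply: smooth_at_sqnorm; exact: smooth_at_linear_rV.
- by rewrite mulr_ge0 ?sqnorm_ge0// divr_ge0// ltW.
- move=> u u0 un0; rewrite diff2_sqnorm_linear mulr_gt0 ?mulr_gt0 ?divr_gt0//.
  apply: sqnorm_gt0; apply: contra_neq un0 => /= l0.
  move: l0; rewrite /lproj kproj_ker// => /=.
  have -> : (0 : E) = tcoord c0 (0 : tangent p) by [].
  move=> /(tcoord_inj cp) /(congr1 (tcoord d)); rewrite tcoord_tvec// => ->.
Qed.

(** Off the line of [T] both functions are smooth and the regularised maximum applies. On that line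
    the indicatrix may be singular, but [capped] agrees with [cap] nearby. *)
Lemma convex_at_capped (y : E) : convex_at (fomega Omega p d) (fibre_fun capped p d) y.
Proof.
have [v0|v0] := eqVneq (tvect (kprojF (TVec p (tvec p d y)))) 0; last first.
  exact: (convex_at_max th_smooth th_derive th12_ge0 th_ge (convex_at_cap y)
    (convex_at_height hcone dp v0)).
apply: convex_at_eq (convex_at_cap y).
have := near_capped cp dp v0; rewrite tcoord_tvec// => nc.
have ic : {for y, continuous (fun z : E => (cmap d p, z))}.
  apply: smooth_at_continuous; apply: smooth_at_pair; first exact: smooth_at_cst.
  exact: smooth_at_id.
have hz : \forall z \near y, cap (bundle_cinv d (cmap d p, z)) =
    capped (bundle_cinv d (cmap d p, z)) by exact: (ic _ nc).
by apply: filterS hz => z; rewrite bundle_cinvE.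
Qed.

End Fibre.

Lemma admissible_capped p : cdom c0 p -> sqnorm (cmap c0 p - x0) <= r ->
  admissible Omega T F U capped p.
Proof.
move=> cp pr.
have N_ge0 v : 0 <= knorm v by exact: sqnorm_ge0.
have vE (v : tangent p) : TVec p v = bundle_cinv c0 (cmap c0 p, tcoord c0 v).
  by rewrite bundle_cinvE// tvec_tcoord.
have kn (v : tangent p) : (ckproj Omega T c0 (cmap c0 p, tcoord c0 v)).2 =
    tcoord c0 (tvect (kprojF (TVec p v))).
  rewrite vE -ckprojE; last exact: cimg_cmap.
  by rewrite /= tcoord_tvec// cmapK.
have kK (v : tangent p) : a * knorm (TVec p v) <= ksqrF (TVec p v).
  by have := ksqr_ge pr (tcoord c0 v); rewrite kn -vE.
have out (v : tangent p) : rho <= knorm (TVec p v)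
  -> capped (TVec p v) = heightF (TVec p v).
  move=> vr; have h := cap_le_height a01 rho_tau tau1 eE vr (kK v).
  by rewrite /capped th_hi ?subrKC// lerBrDr addrC.
have ins (v : tangent p) : capped (TVec p v) != heightF (TVec p v) ->
    knorm (TVec p v) <= rho /\ capped (TVec p v) <= 1 + tau.
  move=> ne; have vr : knorm (TVec p v) <= rho.
    by rewrite leNgt; apply: contra_neqN ne => /ltW; exact: out.
  split=> //; have h := cap_le_top a01 rho_tau tau1 eE (N_ge0 _) vr.
  (* If the indicatrix is at most [2 * e] above the cap, then [th] adds at most [2 * e]. Otherwise
     [capped] is the height, contrary to assumption. *)
  have [s2|s2] := leP (heightF (TVec p v) - cap (TVec p v)) (2 * e).
    by apply: le_trans h; rewrite /capped lerD2l; exact: th_le.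
  by move: ne; rewrite /capped th_hi ?subrKC ?eqxx// ltW.
have ge (v : tangent p) : heightF (TVec p v) <= capped (TVec p v).
  rewrite /capped; have [_] := th_ge (heightF (TVec p v) - cap (TVec p v)); lra.
split.
- by move=> v s; rewrite /capped /cap /knorm /height /ksqr (kproj_shift hcone).
- by move=> d dp y; exact: convex_at_capped.
(* Where the graph is modified, [capped <= 1 + tau <= 2], and the height is at least 1. *)
- move=> v; rewrite ge /=; have [->|/ins[_ h]] := eqVneq (capped (TVec p v)) (heightF
    (TVec p v)).
    by rewrite lerDl.
  by have t1 := tau1; have := height_ge1 Omega T F (TVec p v); lra.
- move=> v /ins[vr vt] t /andP[t0 t1].
  have h1 := height_ge1 Omega T F (TVec p v).
  have t2 := le_trans t1 vt; have t3 := le_trans h1 t0.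
  have tt : `|t - 1| <= tau by rewrite ger0_norm; lra.
  have := tube_U pr tt vr; rewrite bundle_cinvE// tvecP//.
  have -> : tvec p c0 (cfield T c0 (cmap c0 p)) = T p.
    rewrite /cfield; have := cmapK cp => cE; apply: (tcoord_inj cp).
    by rewrite tcoord_tvec// cE.
  by rewrite tvec_tcoord.
Qed.

End Patch.

(** * Bump functions on the manifold *)

Section Bump.
Context {R : realType} {n : nat} {M : smoothManifold R n}.
Local Notation E := 'rV[R]_n.
Variables (c0 : atlas M) (x0 : E) (r : R).
Hypothesis r_gt0 : 0 < r.
Hypothesis cimg_ball : forall x : E, sqnorm (x - x0) <= r -> cimg c0 x.
Implicit Types (p : M) (d : atlas M).

(** The coefficients 3 and [4 / r] make the argument of [smooth_step] at least 1 when the squared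
    distance is at most [r / 2], and at most -1 when it is at least [r]. *)
Let profile (x : E) : R^o := smooth_step (3 - 4 / r * sqnorm (x - x0)).

Definition bump p : R := if `[< cdom c0 p >] then profile (cmap c0 p) else 0.

Lemma bump_ge0_le1 p : 0 <= bump p <= 1.
Proof.
rewrite /bump; case: ifPn => _; first by rewrite smooth_step_ge0 smooth_step_le1.
by rewrite lexx ler01.
Qed.

Let r_neq0 : r != 0. Proof. by rewrite gt_eqF. Qed.

Lemma bump_eq1 p : cdom c0 p -> sqnorm (cmap c0 p - x0) <= r / 2 -> bump p = 1.
Proof.
move=> cp pr; rewrite /bump asboolT// /profile smooth_step1//.
have : 4 / r * sqnorm (cmap c0 p - x0) <= 4 / r * (r / 2).
  by rewrite ler_pM2l// divr_gt0.
have -> : 4 / r * (r / 2) = 2 by field.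
lra.
Qed.

Lemma bump_neq0 p : bump p != 0 -> cdom c0 p /\ sqnorm (cmap c0 p - x0) <= r.
Proof.
rewrite /bump; case: asboolP => cp; last by rewrite eqxx.
move=> b0; split=> //; rewrite leNgt; apply: contraNN b0 => pr.
rewrite /profile smooth_step0//.
have : 4 / r * r <= 4 / r * sqnorm (cmap c0 p - x0).
  by rewrite ler_pM2l ?divr_gt0// ltW.
have -> : 4 / r * r = 4 by field.
lra.
Qed.

(** The support lies in the image of a compact ball of the chart, which is closed since the manifold
    is Hausdorff. This makes the extension by 0 smooth beyond the chart domain. *)
Lemma bump_near0 p : ~ cdom c0 p -> \forall q \near p, bump q = 0.
Proof.
move=> ncp; pose K := cinv c0 @` [set x | sqnorm (x - x0) <= r].
have Kc : closed K.
  apply: compact_closed; first exact: mspace_hausdorff.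
  apply: continuous_compact; last exact: sqnorm_compact.
  apply: continuous_subspaceW (@cinv_continuous _ _ M c0).
  by move=> x /cimg_ball.
have nK : nbhs p (~` K).
  apply: open_nbhs_nbhs; split; first exact: closed_openC.
  by move=> [x /cimg_ball cx xE]; apply: ncp; rewrite -xE; have [] := cdom_cinv cx.
apply: filterS nK => q qK; apply/eqP; apply: contraPT qK => /bump_neq0[cq qr].
by apply; exists (cmap c0 q) => //; rewrite cmapK.
Qed.

Let profile_smooth x : smooth_at profile x.
Proof.
apply: (@smooth_at_comp _ _ _ _ (fun x : E => 3 - 4 / r * sqnorm (x - x0) : R^o)
  (@smooth_step R)) => //; last exact: smooth_at_smooth_step.
apply: smooth_atB; first exact: smooth_at_cst.
apply: smooth_atM; first exact: smooth_at_cst.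
apply: smooth_at_sqnorm; apply: smooth_atB; first exact: smooth_at_id.
exact: smooth_at_cst.
Qed.

Lemma near_cinv d p (P : set M) : cdom d p -> nbhs p P ->
  \forall x \near cmap d p, P (cinv d x).
Proof.
move=> dp nP; have cc : {in cimg d, continuous (cinv d)}.
  by rewrite -continuous_open_subspace; [exact: cinv_continuous|exact: cimg_open].
have := cc (cmap d p); rewrite inE => /(_ (cimg_cmap dp)); apply.
by rewrite cmapK.
Qed.

Lemma base_smooth_bump p : base_smooth_at bump p.
Proof.
move=> d dp; have [cp|ncp] := pselect (cdom c0 p); last first.
  apply: smooth_at_eq (smooth_at_cst (0 : R^o) _).
  by apply: filterS (near_cinv dp (bump_near0 ncp)) => x ->.
have s : smooth_at (fun x => profile ((cmap c0 \o cinv d) x) : R^o) (cmap d p).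
  apply: (@smooth_at_comp _ _ _ _ (cmap c0 \o cinv d) profile) => //.
  exact: smooth_at_transition.
apply: smooth_at_eq s; apply: filterS (near_transition dp cp) => x [_ [cx _]].
by rewrite /bump asboolT.
Qed.

(** Over the chart domain this is a product of smooth functions; elsewhere the bump vanishes on a
    whole neighbourhood, whatever [g] is. *)
Lemma bundle_smooth_bump_mul (g : tangentBundle M -> R) :
  (forall p (v : tangent p), cdom c0 p -> bundle_smooth_at g v) ->
  forall p (v : tangent p), bundle_smooth_at (fun w => bump (tbase w) * g w) v.
Proof.
move=> gs p v d dp; have [cp|ncp] := pselect (cdom c0 p).
  apply: smooth_atM; last exact: gs.
  exact: (base_bundle_smooth v (@base_smooth_bump p)).
apply: smooth_at_eq (smooth_at_cst (0 : R^o) _).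
have b0 : \forall z \near (cmap d p, tcoord d v), bump (cinv d z.1) = 0.
  exact: (cvg_fst (near_cinv dp (bump_near0 ncp))).
by apply: filterS b0 => z /= ->; rewrite mul0r.
Qed.

End Bump.

(** * Existence of patches, and conclusion *)

Lemma exists_patch (R : realType) (n : nat) (M : smoothManifold R n)
    (Omega : forall p : M, {scalar tangent p}) (T : forall p : M, tangent p)
    (F : tangentBundle M -> R) (U : set (tangentBundle M)) :
  cone_triple Omega T F -> (forall p : M, nbhs (TVec p (T p)) U) ->
  forall p : M, exists B f Psi, bump_patch Omega T F U B f Psi /\ B p.
Proof.
move=> hcone hU p0; have [c0 cp0] := cdom_cover p0.
pose x0 := cmap c0 p0; have cx0 : cimg c0 x0 by exact: cimg_cmap.
have [r1 [a [r10 a0 a1 ksqr_ge]]] := ksqr_lower_bound hcone cx0.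
have [r2 [rho [tau [r20 rho0 tau0 tau1 tube]]]] := tube_in_neighborhood hcone cx0 (hU _).
(* [r] serves both local bounds, [rho'] is cut down to [tau] as the arithmetic of the cap requires,
   and [e] is fixed by [40 * e = a * rho']. *)
pose r := Num.min r1 r2; pose rho' := Num.min rho tau; pose e := a * rho' / 40.
have r0 : 0 < r by rewrite lt_min r10.
have rho'0 : 0 < rho' by rewrite lt_min rho0.
have e0 : 0 < e by rewrite divr_gt0// mulr_gt0.
have eE : 40 * e = a * rho' by rewrite mulrC divfK// pnatr_eq0.
have [th [th1 [th2 [ths thd th12 thge [thlo thhi thle]]]]] := smooth_max_scaled e0.
have a01 : 0 < a <= 1 by rewrite a0.
have rho_tau : 0 < rho' <= tau by rewrite rho'0 ge_min lexx orbT.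
have ball1 x : sqnorm (x - x0) <= r -> sqnorm (x - x0) <= r1.
  by move=> xr; apply: le_trans xr _; rewrite ge_min lexx.
have ball2 x : sqnorm (x - x0) <= r -> sqnorm (x - x0) <= r2.
  by move=> xr; apply: le_trans xr _; rewrite ge_min lexx orbT.
have cimg_ball x : sqnorm (x - x0) <= r -> cimg c0 x.
  by move=> /ball1 /ksqr_ge [].
have ksqr_ge' x : sqnorm (x - x0) <= r -> forall y : 'rV[R]_n,
    a * sqnorm (ckproj Omega T c0 (x, y)).2 <= ksqr Omega T F (bundle_cinv c0 (x, y)).
  by move=> /ball1 /ksqr_ge [].
have tube' x : sqnorm (x - x0) <= r -> forall (t : R) (w : 'rV[R]_n),
    `|t - 1| <= tau -> sqnorm w <= rho' -> U (bundle_cinv c0 (x, t *: cfield T c0 x + w)).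
  move=> /ball2 /tube h t w tt wr; apply: h => //; apply: le_trans wr _.
  by rewrite ge_min lexx.
(* Half the radius, so that the bump is identically 1 here; the strict inequality makes the set
   open. *)
exists [set p | cdom c0 p /\ sqnorm (cmap c0 p - x0) < r / 2].
exists (bump c0 x0 r), (capped Omega T F c0 a e th).
split; last by split=> //; rewrite subrr sqnorm0 divr_gt0.
split.
- have cc : {in cdom c0, continuous (cmap c0)}.
    by rewrite -continuous_open_subspace; [exact: cmap_continuous|exact: cdom_open].
  have sc : continuous (fun x : 'rV[R]_n => sqnorm (x - x0) : R^o).
    move=> x; apply: (@smooth_at_continuous R 'rV[R]_n R^o); apply: smooth_at_sqnorm.
    by apply: smooth_atB; [exact: smooth_at_id|exact: smooth_at_cst].
  have Vo : open [set x : 'rV[R]_n | sqnorm (x - x0) < r / 2].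
    move/continuousP: sc => sc.
    exact: (sc [set t : R^o | t < r / 2] (@open_lt R (r / 2))).
  exact: (continuous_inP (cmap c0) (@cdom_open _ _ M c0)).1 cc _ Vo.
- by move=> p [cp pr]; apply: bump_eq1 => //; exact: ltW.
- exact: bump_ge0_le1.
- by move=> p; exact: base_smooth_bump.
split=> [p /(bump_neq0 r0)[cp pr]|].
  exact: (admissible_capped hcone a01 rho_tau tau1 eE ksqr_ge' tube' ths thd th12
    thge thlo thhi thle).
apply: bundle_smooth_bump_mul => // p v cp.
by apply: (bundle_smooth_capped hcone a01 rho_tau eE).
Qed.

Theorem theorem5p6 (R : realType) (n : nat) (hn : (2 <= n)%N)
  (M : smoothManifold R n)
  (Omega : forall p : M, {scalar tangent p})
  (T : forall p : M, tangent p)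
  (F : tangentBundle M -> R)
  (hcone : cone_triple Omega T F)
  (G : tangentBundle M -> R)
  (hG : forall (p : M) (t : R) (w : tangent p), Omega p w = 0 ->
          G (TVec p (t *: T p + w)) = t ^+ 2 - F (TVec p w) ^+ 2)
  (U : set (tangentBundle M))
  (hU : forall p : M, nbhs (TVec p (T p)) U)
  (hUcompact : forall p : M,
     compact (closure (U `&` [set v | tbase v = p])) /\
     closure (U `&` [set v | tbase v = p]) `<=` cone_domain Omega T F) :
  exists S : set (tangentBundle M),
    [/\ bundle_hypersurface S,
        S `\` U = indicatrix Omega G `\` U &
        forall p : M,
          transverse_to_rays (cone_domain Omega T F) S p /\
          fiber_strongly_convex S p].
Proof.
have [Phi PhiP] := exists_admissible (exists_patch hcone hU).
have Phi_admissible p := (PhiP p).1; have Phi_smooth p := (PhiP p).2.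
exists (graph Omega Phi); split.
- exact: (graph_bundle_hypersurface hcone Phi_admissible Phi_smooth).
- exact: (graph_away hcone Phi_admissible hG).
- move=> p; split; first exact: (graph_transverse_to_rays hcone Phi_admissible Phi_smooth).
  move=> c cp; exact: (graph_fibre_strongly_convex hcone Phi_admissible Phi_smooth cp).
Qed.
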